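(* Let $k\in\mathbb{N}/2$, $\ell\in\mathbb{R}_+$ with $k\le\ell$, let $\varphi_{\ell,k}$ be the generalized Wu function, and let $\Phi(x)=\varphi_{\ell,k}(\|x\|_2)$ on $\mathbb{R}^{2k+1}$. Then $$\mathcal{N}_\Phi(\mathbb{R}^{2k+1})=P*L^2(\mathbb{R}^{2k+1}):=\{P*g:g\in L^2(\mathbb{R}^{2k+1})\},$$ where $P(x)=\frac{\Gamma(\ell+1)}{\Gamma(\ell-k+1)}(2/\pi)^{k/2}(1-\|x\|_2^2)_+^{\ell-k}$. Moreover, the convolution operator $C_P:L^2(\mathbb{R}^{2k+1})\to\mathcal{N}_\Phi(\mathbb{R}^{2k+1})$, $C_Pg=P*g$, is a bijective isometry.
   Context: $\mathbb{R}_+=[0,\infty)$, $\mathbb{N}/2=\{0,\tfrac12,1,\tfrac32,\dots\}$. $f_\ell(r)=(1-r^2)_+^\ell$, $f_\ell*f_\ell(r)=\int_{\mathbb{R}}f_\ell(|y|)f_\ell(|r-y|)dy$. The $f$-form is $\mathcal{F}\varphi(r)=\varphi(\sqrt{2r})$, $\mathcal{F}^{-1}\varphi(r)=\varphi(r^2/2)$. For $\nu>0$, $I_\nu\varphi(r)=\int_r^\infty\frac{(x-r)^{\nu-1}}{\Gamma(\nu)}\varphi(x)dx$; $I_0=\mathrm{id}$; $I_{-n}=(-1)^n d^n/dr^n$ ($n\in\mathbb{N}$); $I_{-\nu}=I_{n-\nu}I_{-n}$ with $n=\lceil\nu\rceil$. The generalized Wu function is $\varphi_{\ell,k}:=\mathscr{D}^k(f_\ell*f_\ell)$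 with $\mathscr{D}^k:=\mathcal{F}^{-1}I_{-k}\mathcal{F}$. The native space $\mathcal{N}_\Phi(\mathbb{R}^d)$ is the reproducing kernel Hilbert space of real functions on $\mathbb{R}^d$ with reproducing kernel $(x,y)\mapsto\Phi(x-y)$, with its Hilbert norm. *)

(* Defs.v *)
From HB Require Import structures.
From mathcomp Require Import all_boot all_order all_algebra.
From mathcomp Require Import all_classical all_reals all_analysis.
Set Implicit Arguments. Unset Strict Implicit. Unset Printing Implicit Defensive.
Import Order.TTheory GRing.Theory Num.Theory.
Import numFieldNormedType.Exports.
Local Open Scope classical_set_scope.
Local Open Scope ring_scope.

Section Defs.
Variable R : realType.

(* Rsp n is R^(n+1), built as R * (R * ( ... * R)) with the product sigma-algebra. *)
Fixpoint Rsp (n : nat) : {d : measure_display & measurableType d} :=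
  match n with
  | 0 => existT (fun d => measurableType d) _ (measurableTypeR R)
  | n.+1 => existT (fun d => measurableType d) _
              (measurableTypeR R * projT2 (Rsp n))%type
  end.

Definition Rn (n : nat) : measurableType (projT1 (Rsp n)) := projT2 (Rsp n).

Fixpoint lebn (n : nat) : set (Rn n) -> \bar R :=
  match n return set (Rn n) -> \bar R with
  | 0 => @lebesgue_measure R
  | n.+1 => ((@lebesgue_measure R) \x @lebn n)%E
  end.

Fixpoint sqnorm (n : nat) : Rn n -> R :=
  match n return Rn n -> R with
  | 0 => fun x => x ^+ 2
  | n.+1 => fun x => x.1 ^+ 2 + sqnorm x.2
  end.

Definition enorm (n : nat) (x : Rn n) : R := Num.sqrt (sqnorm x).

Fixpoint subv (n : nat) : Rn n -> Rn n -> Rn n :=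
  match n return Rn n -> Rn n -> Rn n with
  | 0 => fun x y => x - y
  | n.+1 => fun x y => (x.1 - y.1, subv x.2 y.2)
  end.

Definition tpow (x a : R) : R := if 0 < x then x `^ a else 0.

Definition Gamma (s : R) : R :=
  fine (\int[@lebesgue_measure R]_(x in [set x : R | (0 < x)%R]) (x `^ (s - 1) * expR (- x))%:E)%E.

Definition fl (l r : R) : R := tpow (1 - r ^+ 2) l.

Definition fl_conv (l r : R) : R :=
  fine (\int[@lebesgue_measure R]_y (fl l `|y| * fl l `|r - y|)%:E)%E.

Definition Fform (phi : R -> R) : R -> R := fun r => phi (Num.sqrt (2 * r)).
Definition Finv (phi : R -> R) : R -> R := fun r => phi (r ^+ 2 / 2).

Definition Ipos (nu : R) (phi : R -> R) : R -> R :=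
  if nu == 0 then phi
  else fun r => fine (\int[@lebesgue_measure R]_(x in [set x : R | (r < x)%R])
                        ((x - r) `^ (nu - 1) / Gamma nu * phi x)%:E)%E.

(* derivative on R_+ = [0, oo) (one-sided at the endpoint 0: right derivative) *)
Definition rderiv (phi : R -> R) : R -> R :=
  fun r => lim ((fun h : R => h^-1 * (phi (r + h) - phi r)) @ 0^'+).

Definition Ineg_nat (n : nat) (phi : R -> R) : R -> R :=
  fun r => (-1) ^+ n * iter n rderiv phi r.

Definition Ineg (nu : R) (phi : R -> R) : R -> R :=
  let n := `|Num.ceil nu|%N in Ipos (n%:R - nu) (Ineg_nat n phi).

Definition Dk (k : R) (phi : R -> R) : R -> R := Finv (Ineg k (Fform phi)).

Definition wu (l k : R) : R -> R := Dk k (fl_conv l).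

Definition L2 (n : nat) (g : Rn n -> R) : Prop :=
  measurable_fun setT g /\ (\int[@lebn n]_x ((g x) ^+ 2)%:E < +oo)%E.

Definition L2norm (n : nat) (g : Rn n -> R) : R :=
  Num.sqrt (fine (\int[@lebn n]_x ((g x) ^+ 2)%:E)%E).

Definition convRn (n : nat) (f g : Rn n -> R) : Rn n -> R :=
  fun x => fine (\int[@lebn n]_y (f (subv x y) * g y)%:E)%E.

Definition hnorm (T : Type) (ip : (T -> R) -> (T -> R) -> R) (f : T -> R) : R :=
  Num.sqrt (ip f f).

Definition is_inner_product_space (T : Type) (H : set (T -> R))
    (ip : (T -> R) -> (T -> R) -> R) : Prop :=
  [/\ H (fun _ => 0),
      (forall f g, H f -> H g -> H (fun x => f x + g x)),
      (forall a f, H f -> H (fun x => a * f x)),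
      (forall f g, H f -> H g -> ip f g = ip g f) &
      [/\ (forall a f g h, H f -> H g -> H h ->
             ip (fun x => a * f x + g x) h = a * ip f h + ip g h),
          (forall f, H f -> 0 <= ip f f) &
          (forall f, H f -> ip f f = 0 -> f = (fun _ => 0))]].

Definition is_complete_ip (T : Type) (H : set (T -> R))
    (ip : (T -> R) -> (T -> R) -> R) : Prop :=
  forall u : nat -> T -> R, (forall j, H (u j)) ->
  (forall e : R, 0 < e -> exists N, forall p q, (N <= p)%N -> (N <= q)%N ->
      hnorm ip (fun x => u p x - u q x) < e) ->
  exists2 f, H f & (forall e : R, 0 < e -> exists N, forall p, (N <= p)%N ->
      hnorm ip (fun x => u p x - f x) < e).

Definition is_reproducing_kernel (T : Type) (H : set (T -> R))
    (ip : (T -> R) -> (T -> R) -> R) (K : T -> T -> R) : Prop :=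
  (forall y, H (fun x => K x y)) /\
  (forall f y, H f -> ip f (fun x => K x y) = f y).

(* (H, ip) is a (real) reproducing kernel Hilbert space with reproducing kernel K;
   the native space N_Phi is the (unique) such space for K(x,y) = Phi(x - y). *)
Definition is_RKHS (T : Type) (H : set (T -> R))
    (ip : (T -> R) -> (T -> R) -> R) (K : T -> T -> R) : Prop :=
  [/\ is_inner_product_space H ip, is_complete_ip H ip &
      is_reproducing_kernel H ip K].

Definition is_native_space (n : nat) (Phi : Rn n -> R) (H : set (Rn n -> R))
    (ip : (Rn n -> R) -> (Rn n -> R) -> R) : Prop :=
  is_RKHS H ip (fun x y => Phi (subv x y)).

End Defs.

(* Main.v *)
(* Put p_j(x) = (1 - |x|^2)_+^(l - j/2) on R^(j+1) and let W_j be the radial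
   profile of a multiple of p_j * p_j, as a function of t = |x|^2 / 2.  Integrating
   out one coordinate turns p_(j+1) * p_(j+1) into a multiple of p_j * p_j, that is
   W_j = I_(1/2) W_(j+1), and by polar coordinates W_j = I_1 W_(j+2).  Starting from
   j = 0 this gives W_m = I_(-m/2) W_0, so that phi_(l,k)(|x|) = (P * P)(x).

   The space of all P * g with the inner product of L^2 is then a reproducing kernel
   Hilbert space for this kernel, provided that P * g = 0 forces g = 0.  Instead of
   using that the zero set of the Fourier transform of P is null, we use a virial
   argument: if p is even or odd and p * g = 0, then (z_i p) * g = 0, because
   <p * (phi g), q * g> = +- <phi g, p * (q * g)> = +- <phi g, q * (p * g)> = 0
   for all bounded phi and all q.  Hence all moments of z |-> P(z) g(x - z) vanish, for almost
   every x, and g = 0.  Finally a reproducing kernel determines its space, since the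
   combinations of kernel sections are dense in it. *)

Require Import Defs.
From HB Require Import structures.
From mathcomp Require Import all_boot all_order all_algebra.
From mathcomp Require Import all_classical all_reals all_analysis.
From mathcomp Require Import measurable_realfun ring lra.
Set Implicit Arguments.
Unset Strict Implicit.
Unset Printing Implicit Defensive.
Import Order.TTheory GRing.Theory Num.Theory.
Import numFieldNormedType.Exports.
Local Open Scope classical_set_scope.
Local Open Scope ring_scope.

(** * Lebesgue measure on R^(n+1) *)

(** The delicate end of the chain of profiles is its last link. For odd [m] the ceiling in [Ineg]
    asks for (m + 1)/2 derivatives, which lead to [wu_profile l m.+1]. Its exponent may drop to
    -1/2, so this profile can be infinite or discontinuous, and the last derivative is known only
    almost everywhere. That is enough, because it enters only under the half-order integral that
    returns to [wu_profile l m]. The slice identities are therefore stated for values in the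
    extended reals and for exponents from -1/2 on, where Tonelli applies at once; finiteness and
    continuity are added for exponents at least 0. The constant of [P] is forced: a slice of p * p
    produces two Beta factors, whose Gamma quotients telescope along the chain, and what they leave
    over is a power of 2 / pi. In the virial step the multiplier phi has to be bounded because
    multiplication by a coordinate can lead out of L^2. Elements of L^2 are plain functions here, so
    injectivity of g |-> P * g is an almost everywhere statement, whereas P * g is defined at every
    point. *)

Section ProductSigmaFinite.
Context d1 d2 (T1 : measurableType d1) (T2 : measurableType d2) (R : realType).
Variables (m1 : {sigma_finite_measure set T1 -> \bar R})
  (m2 : {sigma_finite_measure set T2 -> \bar R}).

Lemma sigma_finite_prod : sigma_finite setT (m1 \x m2)%E.
Proof.
have /sigma_finiteP[F [TF ndF Foo]] := sigma_finiteT m1.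
have /sigma_finiteP[G [TG ndG Goo]] := sigma_finiteT m2.
exists (fun n => F n `*` G n) => [|n]; last first.
  have [mF Fy] := Foo n; have [mG Gy] := Goo n.
  split; first exact: measurableX.
  by rewrite product_measure1E// lte_mul_pinfty// ge0_fin_numE.
apply/seteqP; split=> // -[x y] _.
have [i _ Fix] : (\bigcup_i F i) x by rewrite -TF.
have [j _ Gjy] : (\bigcup_i G i) y by rewrite -TG.
exists (maxn i j) => //; split=> /=.
- by move: x Fix; apply/subsetPset/ndF; exact: leq_maxl.
- by move: y Gjy; apply/subsetPset/ndG; exact: leq_maxr.
Qed.

(* The library declares this instance as well, but a later instance for
   subprobabilities shadows it. *)
Definition prod_sigma_finite := (m1 \x m2)%E.
HB.instance Definition _ := Measure.on prod_sigma_finite.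
HB.instance Definition _ :=
  Measure_isSigmaFinite.Build _ _ _ prod_sigma_finite sigma_finite_prod.

Definition prodM : {sigma_finite_measure set (T1 * T2)%type -> \bar R} :=
  prod_sigma_finite.

End ProductSigmaFinite.

Section LebesgueRn.
Context {R : realType}.

Local Notation leb := (@lebesgue_measure R).

(** The measure [lebn] with its sigma-finiteness bundled in, as Tonelli asks for at every level of
    the recursion; [lebME] identifies the two. *)
Fixpoint lebM (n : nat) : {sigma_finite_measure set (Rn R n) -> \bar R} :=
  match n return {sigma_finite_measure set (Rn R n) -> \bar R} with
  | 0 => leb
  | n.+1 => prodM leb (lebM n)
  end.

Lemma lebME n : lebM n = @lebn R n :> (set (Rn R n) -> \bar R).
Proof. by elim: n => // n IH; rewrite -[RHS]/(leb \x @lebn R n)%E -IH. Qed.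

Lemma measurable_fst_comp d d1 d2 (T : measurableType d) (T1 : measurableType d1)
    (T2 : measurableType d2) (f : T -> T1 * T2) :
  measurable_fun setT f -> measurable_fun setT (fun z => (f z).1).
Proof. by move=> mf; exact: (measurableT_comp measurable_fst). Qed.

Lemma measurable_snd_comp d d1 d2 (T : measurableType d) (T1 : measurableType d1)
    (T2 : measurableType d2) (f : T -> T1 * T2) :
  measurable_fun setT f -> measurable_fun setT (fun z => (f z).2).
Proof. by move=> mf; exact: (measurableT_comp measurable_snd). Qed.

Lemma measurable_sqnorm n d (T : measurableType d) (f : T -> Rn R n) :
  measurable_fun setT f -> measurable_fun setT (fun z => sqnorm (f z)).
Proof.
elim: n f => [|n IH] f mf /=; first exact: measurable_funX.
apply: measurable_funD; last by apply: IH; exact: measurable_snd_comp.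
by apply: measurable_funX; exact: measurable_fst_comp.
Qed.

Lemma measurable_subv n d (T : measurableType d) (f g : T -> Rn R n) :
  measurable_fun setT f -> measurable_fun setT g ->
  measurable_fun setT (fun z => subv (f z) (g z)).
Proof.
elim: n f g => [|n IH] f g mf mg /=; first exact: measurable_funB.
apply: measurable_fun_pair.
  by apply: measurable_funB; exact: measurable_fst_comp.
by apply: IH; exact: measurable_snd_comp.
Qed.

Lemma measurable_tpow d (T : measurableType d) (f : T -> R) (a : R) :
  measurable_fun setT f -> measurable_fun setT (fun z => tpow (f z) a).
Proof.
move=> mf; rewrite /tpow; apply: measurable_fun_ifT.
- exact: measurable_fun_ltr.
- exact: (measurableT_comp (@measurable_powR R a)).
- exact: measurable_cst.
Qed.

End LebesgueRn.

(** * Change of variables *)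

Section Substitution.
Local Open Scope ereal_scope.

Lemma integral_layer (R : realType) (c : \bar R) : 0 <= c ->
  \int[@lebesgue_measure R]_s (\1_[set s : R | (0 < s)%R /\ (s%:E < c)%E] s)%:E = c.
Proof.
move=> c0; rewrite integral_indic ?setIT //=.
- case: c c0 => [r r0|_|//].
  + have -> : [set s : R | (0 < s)%R /\ (s%:E < r%:E)%E] = `]0%R, r[%classic.
      by apply/seteqP; split => s /=; rewrite in_itv/= lte_fin; [case=> -> ->|case/andP].
    rewrite lebesgue_measure_itv /= lte_fin; case: ltP; rewrite ?sube0 // => h.
    by apply/eqP; rewrite eq_le r0 lee_fin.
  + have -> : [set s : R | (0 < s)%R /\ (s%:E < +oo)%E] = `]0%R, +oo[%classic.
      by apply/seteqP; split => s /=; rewrite in_itv/= andbT ltry; [case|].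
    by rewrite lebesgue_measure_itv /= ltry.
- have -> : [set s : R | (0 < s)%R /\ (s%:E < c)%E] =
     `]0%R, +oo[%classic `&` EFin @^-1` `]-oo, c[%classic.
    by apply/seteqP; split => s /=; rewrite !in_itv/= andbT.
  apply: measurableI => //; rewrite -[X in measurable X]setTI.
  by apply: EFin_measurable => //; exact: emeasurable_itv.
Qed.

(* Layer cake: h(y) is the measure of the set of s with 0 < s < h(y), which
   reduces the claim to indicators. *)
Lemma ge0_integral_density d1 d2 (T1 : measurableType d1) (T2 : measurableType d2)
    (R : realType) (mu : {sigma_finite_measure set T1 -> \bar R})
    (nu : {sigma_finite_measure set T2 -> \bar R}) (phi : T1 -> T2) (w : T1 -> R)
    (h : T2 -> \bar R) :
  measurable_fun setT phi -> measurable_fun setT w -> (forall x, (0 <= w x)%R) ->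
  (forall A, measurable A -> nu A = \int[mu]_x (w x * \1_A (phi x))%:E) ->
  measurable_fun setT h -> (forall y, 0 <= h y) ->
  \int[nu]_y h y = \int[mu]_x ((w x)%:E * h (phi x)).
Proof.
move=> mphi mw w0 nuE mh h0.
pose L (z : T2 * measurableTypeR R) : R := \1_[set s : R | (0 < s)%R /\ (s%:E < h z.1)%E] z.2.
have mS : measurable [set z : T2 * measurableTypeR R | (0 < z.2)%R /\ ((z.2)%:E < h z.1)%E].
  have -> : [set z : T2 * measurableTypeR R | (0 < z.2)%R /\ ((z.2)%:E < h z.1)%E] =
    (snd @^-1` `]0%R, +oo[%classic) `&` [set z | ((z.2)%:E < h z.1)%E].
    by apply/seteqP; split => s /=; rewrite in_itv/= andbT.
  apply: measurableI.
    by rewrite -[X in measurable X]setTI; exact: measurable_snd.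
  rewrite -[X in measurable X]setTI; apply: emeasurable_fun_lt => //.
    by apply/measurable_EFinP; exact: measurable_snd.
  exact: (measurableT_comp mh).
have mL : measurable_fun [set: T2 * measurableTypeR R] (EFin \o L).
  apply/measurable_EFinP.
  apply: (eq_measurable_fun (\1_[set z : T2 * measurableTypeR R | (0 < z.2)%R /\ ((z.2)%:E < h z.1)%E] : _ -> R)).
    by move=> z _; rewrite /L !indicE; congr (_%:R).
  exact: measurable_indic.
transitivity (\int[nu]_y \int[@lebesgue_measure R]_s (L (y, s))%:E).
  by apply: eq_integral => y _; rewrite -{1}(integral_layer (h0 y)).
etransitivity.
  by apply: (fubini_tonelli (m1 := nu) (m2 := lebesgue_measure) (EFin \o L)) => // z; rewrite lee_fin.
transitivity (\int[@lebesgue_measure R]_s \int[mu]_x (w x * L (phi x, s))%:E).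
  apply: eq_integral => s _.
  have mA : measurable [set y | (0 < s)%R /\ (s%:E < h y)%E].
    have := measurable_ysection s mS; rewrite /ysection/=.
    by under eq_set do rewrite inE/=.
  transitivity (nu [set y | (0 < s)%R /\ (s%:E < h y)%E]).
    by rewrite -[X in nu X]setIT -integral_indic.
  exact: nuE.
pose F (z : T1 * measurableTypeR R) := (w z.1 * L (phi z.1, z.2))%:E.
have mF : measurable_fun [set: T1 * measurableTypeR R] F.
  apply/measurable_EFinP; apply: measurable_funM.
    exact: (measurableT_comp mw).
  apply: (measurableT_comp (f := L) (g := fun z : T1 * measurableTypeR R => (phi z.1, z.2))).
    exact/measurable_EFinP.
  by apply: measurable_fun_pair; [exact: (measurableT_comp mphi)|exact: measurable_snd].
etransitivity.
  by apply/esym/(fubini_tonelli (m1 := mu) (m2 := lebesgue_measure) F) => // z; rewrite lee_fin mulr_ge0.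
apply: eq_integral => x _.
rewrite -(integral_layer (h0 (phi x))).
transitivity (\int[lebesgue_measure]_s ((w x)%:E * (L (phi x, s))%:E)) => //.
rewrite ge0_integralZl ?lee_fin//; last by move=> s _; rewrite lee_fin.
have /(measurable_fun_pair2 (phi x)) mLx : measurable_fun setT L by exact/measurable_EFinP.
exact/measurable_EFinP.
Qed.

End Substitution.

Section PushDensity.
Local Open Scope ereal_scope.
Context d1 d2 (T1 : measurableType d1) (T2 : measurableType d2) (R : realType).
Variables (mu : {measure set T1 -> \bar R}) (phi : T1 -> T2) (w : T1 -> R).

(* The hypotheses are arguments so that the measure structure can be inferred. *)
Definition push_density of measurable_fun setT phi & measurable_fun setT w &
    (forall x, (0 <= w x)%R) := fun A : set T2 =>
  \int[mu]_(x in phi @^-1` A) (w x)%:E.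

Hypotheses (mphi : measurable_fun setT phi) (mw : measurable_fun setT w).
Hypothesis w0 : forall x, (0 <= w x)%R.

Local Notation nu := (push_density mphi mw w0).

Let push_density0 : nu set0 = 0.
Proof. by rewrite /push_density preimage_set0 integral_set0. Qed.

Let push_density_ge0 A : 0 <= nu A.
Proof. by apply: integral_ge0 => x _; rewrite lee_fin. Qed.

Let push_density_sigma_additive : semi_sigma_additive nu.
Proof.
move=> F mF tF mUF; rewrite /push_density preimage_bigcup.
rewrite ge0_integral_bigcup.
- by apply: is_cvg_ereal_nneg_natsum => n _; exact: push_density_ge0.
- by move=> n; rewrite -[X in measurable X]setTI; exact: mphi.
- by apply/measurable_EFinP; exact: measurable_funTS.
- by move=> x _; rewrite lee_fin.
- by move=> i j _ _ [x [/= Fi Fj]]; apply: tF => //; exists (phi x).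
Qed.

HB.instance Definition _ := isMeasure.Build _ _ _ nu
  push_density0 push_density_ge0 push_density_sigma_additive.

End PushDensity.

Section ChangeOfVariables.
Local Open Scope ereal_scope.
Context {R : realType}.

Local Notation leb := (@lebesgue_measure R).

(** A measure that agrees with Lebesgue measure on half-open intervals is Lebesgue measure. Applied
    to the image under [phi] of the density [w], this reduces a change of variables to a computation
    on intervals. *)
Lemma lebesgue_change (phi : measurableTypeR R -> measurableTypeR R)
    (w : measurableTypeR R -> R) (h : measurableTypeR R -> \bar R) :
  measurable_fun setT phi -> measurable_fun setT w -> (forall x, (0 <= w x)%R) ->
  (forall a b, (a <= b)%R ->
    \int[leb]_(x in phi @^-1` `]a, b]) (w x)%:E = (b - a)%:E) ->
  measurable_fun setT h -> (forall y, 0 <= h y) ->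
  \int[leb]_y h y = \int[leb]_x ((w x)%:E * h (phi x)).
Proof.
move=> mphi mw w0 itvE mh h0; apply: ge0_integral_density => // A mA.
pose nu := [the {measure set (measurableTypeR R) -> \bar R} of
  push_density leb mphi mw w0].
rewrite [LHS](lebesgue_measure_unique (mu := nu)) => [|_ [[a b]] _ <-|//] /=.
  rewrite /nu/= /push_density integral_mkcond; apply: eq_integral => x _; rewrite indicE.
  have <- : (x \in phi @^-1` A) = (phi x \in A) by apply/idP/idP; rewrite !inE.
  by rewrite /patch; case: ifP => _; rewrite ?mulr1 ?mulr0.
have [ab|/ltW ba] := leP a b.
  rewrite lebesgue_measure_itv/= lte_fin [RHS]itvE//.
  by move: ab; rewrite le_eqVlt => /orP[/eqP ->|->]; rewrite ?ltxx ?subrr.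
by rewrite set_itv_ge ?measure0// bnd_simp -leNgt.
Qed.

Lemma integral_reflect (c : R) (h : R -> \bar R) :
  measurable_fun setT h -> (forall y, 0 <= h y) ->
  \int[leb]_x h (c - x)%R = \int[leb]_x h x.
Proof.
move=> mh h0; rewrite [RHS](@lebesgue_change (fun x => c - x)%R (cst 1%R)) //.
- by apply: eq_integral => x _; rewrite mul1e.
- exact: measurable_funB.
- move=> a b ab.
  have -> : (fun x : measurableTypeR R => c - x)%R @^-1` `]a, b] =
      `[(c - b)%R, (c - a)%R[%classic.
    by apply/seteqP; split=> x /=; rewrite !in_itv/=; lra.
  rewrite (integral_cst leb _ 1) //= mul1e lebesgue_measure_itv/= lte_fin.
  case: ltP => [|] h1; rewrite -?EFinB; congr EFin; lra.
Qed.

Lemma integral_translate (c : R) (h : R -> \bar R) :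
  measurable_fun setT h -> (forall y, 0 <= h y) ->
  \int[leb]_x h (x + c)%R = \int[leb]_x h x.
Proof.
move=> mh h0; rewrite -(@integral_reflect 0 h)//.
rewrite -(@integral_reflect (- c)%R (fun x => h (0 - x)%R))//.
  by apply: eq_integral => x _; rewrite sub0r opprB opprK.
by apply: (measurableT_comp mh); exact: measurable_funB.
Qed.

Lemma integral_scale (c : R) (h : R -> \bar R) : (0 < c)%R ->
  measurable_fun setT h -> (forall y, 0 <= h y) ->
  \int[leb]_x h x = c%:E * \int[leb]_x h (c * x)%R.
Proof.
move=> c0 mh h0.
rewrite (@lebesgue_change (fun x => c * x)%R (cst c)) ?ltW//.
- rewrite -ge0_integralZl ?lee_fin ?ltW//; apply: (measurableT_comp mh).
  exact: measurable_funM.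
- exact: measurable_funM.
- by move=> x; rewrite ltW.
- move=> a b ab.
  have -> : (fun x : measurableTypeR R => c * x)%R @^-1` `]a, b] =
      `](a / c)%R, (b / c)%R]%classic.
    by apply/seteqP; split=> x /=; rewrite !in_itv/= ltr_pdivrMr// ler_pdivlMr// mulrC.
  rewrite (integral_cst leb _ c%:E) //= lebesgue_measure_itv/= lte_fin ltr_pM2r ?invr_gt0//.
  case: ltP => h1; rewrite -?EFinB -?EFinM; congr EFin; last lra.
  by field; rewrite gt_eqF.
Qed.

End ChangeOfVariables.

Ltac meas_step := match goal with
  | H : measurable_fun _ ?f |- measurable_fun _ ?g => constr_eq f g; exact: H
  | |- measurable_fun _ fst => exact: measurable_fst
  | |- measurable_fun _ snd => exact: measurable_snd
  | |- measurable_fun _ (fun x => x) => exact: measurable_id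
  | |- measurable_fun _ id => exact: measurable_id
  | |- measurable_fun _ (fun x => x.1) => exact: measurable_fst
  | |- measurable_fun _ (fun x => x.2) => exact: measurable_snd
  | |- measurable_fun _ (cst _) => exact: measurable_cst
  | |- measurable_fun _ (fun _ => ?c) => exact: measurable_cst
  | |- measurable_fun _ (EFin \o _) => apply/measurable_EFinP
  | |- measurable_fun _ (fun x => EFin _) => apply/measurable_EFinP
  | |- measurable_fun _ (fun x => if _ then _ else _) => apply: measurable_fun_ifT
  | |- measurable_fun _ (fun x => (_ < _)%R) => apply: measurable_fun_ltr
  | |- measurable_fun _ (@sqnorm _ _) => apply: measurable_sqnorm
  | |- measurable_fun _ (@subv _ _ _) => apply: measurable_subv
  | |- measurable_fun _ (Order.lt _) => apply: measurable_fun_ltr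
  | |- measurable_fun _ (GRing.mul _) => apply: measurable_funM
  | |- measurable_fun _ (GRing.add _) => apply: measurable_funD
  | |- measurable_fun _ (pair _) => apply: measurable_fun_pair
  | |- measurable_fun _ (fun x => tpow _ _) => apply: measurable_tpow
  | |- measurable_fun _ (fun x => sqnorm _) => apply: measurable_sqnorm
  | |- measurable_fun _ (fun x => subv _ _) => apply: measurable_subv
  | |- measurable_fun _ (fun x => (_ - _)%R) => apply: measurable_funB
  | |- measurable_fun _ (fun x => (_ + _)%R) => apply: measurable_funD
  | |- measurable_fun _ (fun x => (_ * _)%R) => apply: measurable_funM
  | |- measurable_fun _ (fun x => (_ * _)%E) => apply: emeasurable_funM
  | |- measurable_fun _ (fun x => (_ ^+ _)%R) => apply: measurable_funX
  | |- measurable_fun _ (fun x => (- _)%R) => apply: measurable_funN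
  | |- measurable_fun _ (fun x => `|_|%R) => apply: (measurableT_comp (@normr_measurable _ setT))
  | |- measurable_fun _ (fun x => expR _) => apply: (measurableT_comp (@measurable_expR _))
  | |- measurable_fun _ (fun x => (_, _)) => apply: measurable_fun_pair
  | |- measurable_fun _ (fun x => (_).1) => apply: measurable_fst_comp
  | |- measurable_fun _ (fun x => (_).2) => apply: measurable_snd_comp
  end.
Ltac meas_comp := match goal with
  | H : measurable_fun setT ?p |- measurable_fun _ (fun x => ?p (@?q x)) =>
      apply: (measurableT_comp H)
  end.
Ltac meas := repeat (meas_step || meas_comp).

(** * The substitution of the square *)

Section SquareSubstitution.
Local Open Scope ereal_scope.
Context {R : realType}.

Local Notation leb := (@lebesgue_measure R).

Lemma integral_double_id (a b : R) : (0 <= a)%R -> (a <= b)%R ->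
  \int[leb]_(x in `]a, b]) (2 * x)%:E = (b ^+ 2 - a ^+ 2)%:E.
Proof.
move=> a0; rewrite le_eqVlt => /orP[/eqP ->|ab].
  by rewrite set_itvoc0 integral_set0 subrr.
have cf : continuous (fun x : R => 2 * x)%R by move=> x; apply: cvgM; [exact: cvg_cst|exact: cvg_id].
have dF (x : R) : derivable (fun x : R => x ^+ 2)%R x 1 by exact: exprn_derivable.
have cF : continuous (fun x : R => x ^+ 2)%R by exact: exprn_continuous.
rewrite integral_itv_obnd_cbnd; last first.
  by apply/measurable_EFinP; apply: measurable_funTS; exact: continuous_measurable_fun.
rewrite (@continuous_FTC2 _ _ (fun x => x ^+ 2)%R) ?EFinB//.
- exact: continuous_subspaceT.
- split=> //; first exact/cvg_at_right_filter/cF.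
  exact/cvg_at_left_filter/cF.
- by move=> x _; rewrite exp_derive1 expr1.
Qed.

Lemma integral_square (h : R -> \bar R) :
  measurable_fun setT h -> (forall y, 0 <= h y) ->
  \int[leb]_x h (x ^+ 2)%R = \int[leb]_x (h x * (tpow x (- 2^-1))%:E).
Proof.
move=> mh h0.
(* The square is not injective. With the identity in its place on the negative half-line, it becomes
   a bijection of the whole line; the function to be transported vanishes on that half because of
   [tpow]. *)
pose phi (x : measurableTypeR R) : measurableTypeR R := (if 0 < x then x ^+ 2 else x)%R.
pose w (x : measurableTypeR R) : R := (if 0 < x then 2 * x else 1)%R.
have mphi : measurable_fun setT phi.
  by rewrite /phi; meas.
have mw : measurable_fun setT w.
  by rewrite /w; meas.
have w0 x : (0 <= w x)%R by rewrite /w; case: ifPn => // x0; rewrite mulr_ge0 // ltW.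
have posE (a b : R) : (0 <= a)%R -> (a <= b)%R ->
    \int[leb]_(x in phi @^-1` `]a, b]) (w x)%:E = (b - a)%:E.
  move=> a0 ab; have b0 := le_trans a0 ab.
  have -> : phi @^-1` `]a, b] = `](Num.sqrt a), (Num.sqrt b)]%classic.
    apply/seteqP; suff E x : (phi x \in `]a, b]) = (x \in `](Num.sqrt a), (Num.sqrt b)]).
      by split=> x /=; rewrite E.
    rewrite /phi !in_itv/=; case: (ltP 0%R x) => x0; last first.
      have sa := sqrtr_ge0 a.
      by rewrite (le_gtF (le_trans x0 a0)) (le_gtF (le_trans x0 sa)).
    have e : Num.sqrt (x ^+ 2) = x by rewrite sqrtr_sqr gtr0_norm.
    by rewrite -{3 4}e ltr_sqrt ?exprn_gt0// ler_sqrt.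
  rewrite (eq_integral (fun x : measurableTypeR R => (2 * x)%:E)); last first.
    move=> x; rewrite inE/= in_itv/= => /andP[+ _] => /(le_lt_trans (sqrtr_ge0 a)) x0.
    by rewrite /w x0.
  by rewrite integral_double_id ?sqrtr_ge0 ?ler_wsqrtr// !sqr_sqrtr.
have negE (a b : R) : (b <= 0)%R -> (a <= b)%R ->
    \int[leb]_(x in phi @^-1` `]a, b]) (w x)%:E = (b - a)%:E.
  move=> b0 ab.
  have -> : phi @^-1` `]a, b] = `]a, b]%classic.
    apply/seteqP; suff E x : (phi x \in `]a, b]) = (x \in `]a, b]).
      by split=> x /=; rewrite E.
    rewrite /phi !in_itv/=; case: (ltP 0%R x) => x0 //.
    have x20 : (0 < x ^+ 2)%R by rewrite exprn_gt0.
    by rewrite (lt_geF (le_lt_trans b0 x0)) (lt_geF (le_lt_trans b0 x20)) !andbF.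
  rewrite (eq_integral (cst 1)); last first.
    move=> x; rewrite inE/= in_itv/= => /andP[_ /le_trans] /(_ _ b0) x0.
    by rewrite /w ltNge x0.
  rewrite integral_cst//= mul1e lebesgue_measure_itv/= lte_fin.
  by move: ab; rewrite le_eqVlt => /orP[/eqP ->|->]; rewrite ?ltxx ?subrr.
have mfpre (a b : R) : measurable (phi @^-1` `]a, b]).
  by rewrite -[X in measurable X]setTI; exact: mphi.
have itvE (a b : R) : (a <= b)%R ->
    \int[leb]_(x in phi @^-1` `]a, b]) (w x)%:E = (b - a)%:E.
  move=> ab; have [a0|a0] := leP 0%R a; first exact: posE.
  have [b0|b0] := leP b 0%R; first exact: negE.
  have -> : `]a, b]%classic = `]a, 0%R] `|` `]0%R, b].
    apply/seteqP; split=> x /=; rewrite !in_itv/=.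
      by move=> /andP[-> ->]; rewrite andbT/=; case: leP; [left|right].
    move=> [/andP[-> x0]|/andP[x0 ->]]; rewrite ?andbT/=.
      exact: le_trans x0 (ltW b0).
    exact: lt_trans a0 x0.
  rewrite preimage_setU ge0_integral_setU//.
  - transitivity ((0 - a)%:E + (b - 0)%:E); last by rewrite -EFinD; congr EFin; ring.
    by congr (_ + _); [exact: negE (lexx _) (ltW a0)|exact: posE (lexx _) (ltW b0)].
  - by apply/measurable_EFinP; exact: measurable_funTS.
  - by move=> x _; rewrite lee_fin.
  - apply/eqP/seteqP; split=> // x; rewrite /= !in_itv/= => -[/andP[_ x0] /andP[]].
    by rewrite ltNge x0.
pose H x := h x * (tpow x (- 2^-1))%:E.
have mH : measurable_fun setT H by rewrite /H; meas.
have H0 x : 0 <= H x.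
  by rewrite mule_ge0// lee_fin /tpow; case: ifP => // _; exact: powR_ge0.
rewrite (lebesgue_change mphi mw w0 itvE mH H0).
have mh2 : measurable_fun setT (fun x : R => h (x ^+ 2)%R).
  by apply: (measurableT_comp mh); meas.
have split_half (f : R -> \bar R) : measurable_fun setT f -> (forall x, 0 <= f x) ->
    \int[leb]_x f x = \int[leb]_(x in `]-oo, 0%R]) f x + \int[leb]_(x in `]0%R, +oo[) f x.
  move=> mf f0; rewrite -[X in integral _ X _](_ : `]-oo, 0%R] `|` `]0%R, +oo[ = setT).
    rewrite ge0_integral_setU//; first exact: measurable_funTS.
    apply/eqP/seteqP; split=> // x; rewrite /= !in_itv/= andbT => -[].
    by rewrite leNgt => /negP.
  by apply/seteqP; split=> // x _; rewrite /= !in_itv/= andbT; case: leP; [left|right].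
have mwH : measurable_fun setT (fun x => (w x)%:E * H (phi x)).
  by apply: emeasurable_funM; [exact/measurable_EFinP|exact: (measurableT_comp mH)].
rewrite [LHS]split_half// [RHS]split_half//; last first.
  by move=> x; rewrite mule_ge0// lee_fin.
rewrite [X in _ = X + _](_ : _ = 0) ?add0e; last first.
  apply: integral0_eq => x; rewrite /= in_itv/= /H /phi /tpow => x0.
  by rewrite ltNge x0/= ltNge x0/= mule0 mule0.
(* Evenness folds the left half-line onto the right one. The factor 2 obtained is matched by 2 x
   times 1 / x, the value of [tpow] at x^2. *)
have -> : \int[leb]_(x in `]-oo, 0%R]) h (x ^+ 2)%R = \int[leb]_(x in `]0%R, +oo[) h (x ^+ 2)%R.
  rewrite integral_itv_obnd_cbnd; last exact: measurable_funTS.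
  rewrite [RHS](@ge0_integration_by_substitution0 R (fun x => h (x ^+ 2)%R))//.
  by apply: eq_integral => x _; rewrite sqrrN.
rewrite -ge0_integralD//; [|exact: measurable_funTS..].
apply: eq_integral => x; rewrite inE/= in_itv/= andbT => x0.
rewrite /H /phi /w x0 /tpow exprn_gt0//.
rewrite -powR_mulrn ?ltW// -powRrM (_ : 2%:R * - 2^-1 = -1)%R; last by field.
rewrite powRN powRr1 ?ltW// muleC -muleA -EFinM.
rewrite mulrC -mulrA mulfV ?gt_eqF// mulr1.
by rewrite -[in LHS](mule1 (h _)) -ge0_muleDr ?lee_fin// -EFinD.
Qed.

End SquareSubstitution.

(** * Beta and Gamma integrals *)

Section GammaBeta.
Local Open Scope ereal_scope.
Context {R : realType}.

Local Notation leb := (@lebesgue_measure R).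

Lemma tpow_ge0 (x a : R) : (0 <= tpow x a)%R.
Proof. by rewrite /tpow; case: ifP => // _; exact: powR_ge0. Qed.

(** The Beta value B(1/2, a + 1), in the form in which slices of the unit ball produce it. *)
Definition betaI (a : R) : \bar R := \int[leb]_s (tpow (1 - s ^+ 2) a)%:E.

Definition gammaI (s : R) : \bar R := \int[leb]_x (tpow x (s - 1) * expR (- x))%:E.

Lemma fine_gammaI (s : R) : Gamma s = fine (gammaI s).
Proof.
rewrite /Gamma /gammaI integral_mkcond; congr fine; apply: eq_integral => x _.
rewrite /patch /tpow; case: (boolP (0 < x)%R) => x0; first by rewrite mem_set.
by rewrite memNset ?mul0r//=; exact/negP.
Qed.

(** Scaling [s] by sqrt u pulls out u^(a + 1/2). Each coordinate integrated out thus raises the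
    exponent by one half, which drives all the dimension recursions below. *)
Lemma integral_tpow_sub_square (u a : R) :
  \int[leb]_s (tpow (u - s ^+ 2) a)%:E = (tpow u (a + 2^-1))%:E * betaI a.
Proof.
have [u0|u0] := ltP 0%R u; last first.
  rewrite /tpow ltNge u0/= mul0e integral0_eq// => s _.
  by rewrite ltNge (_ : (_ <= _)%R)//= subr_le0 (le_trans u0)// sqr_ge0.
have su0 : (0 < Num.sqrt u)%R by rewrite sqrtr_gt0.
have mt (c : R) : measurable_fun setT (fun s : R => (tpow (c - s ^+ 2) a)%:E) by meas.
rewrite (integral_scale su0 (mt u)); last by move=> s; rewrite lee_fin tpow_ge0.
have e : (tpow u (a + 2^-1) = Num.sqrt u * u `^ a)%R.
  rewrite /tpow u0 powRD; last by rewrite (gt_eqF u0) implybT.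
  by rewrite mulrC -powR12_sqrt// ltW.
rewrite e EFinM -muleA; congr (_ * _).
rewrite /betaI -ge0_integralZl; [|by []|exact: mt| |]; last 2 first.
- by move=> s _; rewrite lee_fin tpow_ge0.
- by rewrite lee_fin powR_ge0.
apply: eq_integral => s _; rewrite -EFinM; congr EFin.
rewrite exprMn sqr_sqrtr ?ltW// -[X in (X - _)%R]mulr1 -mulrBr /tpow pmulr_rgt0//.
by case: ltP => h; rewrite ?mulr0// powRM ?ltW.
Qed.

(** The integral of (v - s^2)_+^a exp(-v) is computed in both orders. Over s first, it gives a power
    of v times [betaI a]; over v first, shifted by s^2, it splits off a Gaussian factor. *)
Lemma gammaI_betaI (a : R) :
  gammaI (a + 3 / 2) * betaI a = (Num.sqrt pi)%:E * gammaI (a + 1).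
Proof.
pose F (z : measurableTypeR R * measurableTypeR R) :=
  (tpow (z.2 - z.1 ^+ 2) a * expR (- z.2))%:E.
have mF : measurable_fun setT F by rewrite /F; meas.
have F0 z : 0 <= F z by rewrite lee_fin mulr_ge0 ?tpow_ge0 ?expR_ge0.
have := fubini_tonelli (m1 := leb) (m2 := leb) F mF F0.
rewrite [X in _ = X -> _](_ : _ = gammaI (a + 3 / 2) * betaI a); last first.
  rewrite muleC /gammaI -ge0_integralZl//; last 3 first.
  - by meas.
  - by move=> x _; rewrite lee_fin mulr_ge0 ?tpow_ge0 ?expR_ge0.
  - by apply: integral_ge0 => s _; rewrite lee_fin tpow_ge0.
  apply: eq_integral => u _; rewrite muleC EFinM -muleA muleCA.
  rewrite (_ : a + 3 / 2 - 1 = a + 2^-1)%R; last lra.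
  rewrite -integral_tpow_sub_square -ge0_integralZl ?lee_fin ?expR_ge0//.
  - by apply: eq_integral => s _; rewrite /F/= mulrC EFinM.
  - by meas.
  - by move=> s _; rewrite lee_fin tpow_ge0.
move=> <-; rewrite -integralT_gauss muleC -ge0_integralZl//; last 3 first.
- by apply/measurable_EFinP; exact: measurable_gauss_fun.
- by move=> x _; rewrite lee_fin gauss_fun_ge0.
- by apply: integral_ge0 => x _; rewrite lee_fin mulr_ge0 ?tpow_ge0 ?expR_ge0.
apply: eq_integral => s _.
rewrite /gammaI addrK -(integral_translate (- s ^+ 2)); last 2 first.
- by meas.
- by move=> x; rewrite lee_fin mulr_ge0 ?tpow_ge0 ?expR_ge0.
rewrite muleC -ge0_integralZl ?lee_fin ?gauss_fun_ge0//; last 2 first.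
- by meas.
- by move=> x _; rewrite lee_fin mulr_ge0 ?tpow_ge0 ?expR_ge0.
apply: eq_integral => v _; rewrite /F/= /gauss_fun -EFinM; congr EFin.
by rewrite [RHS]mulrCA -expRD; congr (_ * expR _)%R; rewrite opprD opprK addrCA addNr addr0.
Qed.

Lemma gammaI_half : gammaI 2^-1 = (Num.sqrt pi)%:E.
Proof.
rewrite -integralT_gauss /gammaI.
rewrite [RHS](integral_square (h := fun v => (expR (- v))%:E)).
- apply: eq_integral => x _; rewrite -EFinM mulrC (_ : 2^-1 - 1 = - 2^-1)%R //; lra.
- by meas.
- by move=> y; rewrite lee_fin expR_ge0.
Qed.

Lemma gammaI_one : gammaI 1 = 1.
Proof.
rewrite -(@integral_exponential_pdf R 1 ltr01) /gammaI.
pose f x := (exponential_pdf (1 : R) x)%:E.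
have mf : measurable_fun setT f.
  by apply/measurable_EFinP; exact: measurable_exponential_pdf.
have f0 x : 0 <= f x by rewrite lee_fin exponential_pdf_ge0.
(* [tpow] is 0 at the origin while the exponential density is 1 there, so this point is removed
   first. *)
rewrite -[RHS](@integral_setD1 _ _ 0%R) //; last 2 first.
- exact: measurableD.
- exact: measurable_funTS.
rewrite [RHS]integral_mkcond; apply: eq_integral => x _.
rewrite /patch subrr; case: ifPn => [|].
  rewrite inE => -[_ /eqP x0].
  rewrite /tpow; case: ltP => h.
    by rewrite powRr0 mul1r exponential_pdfE ?ltW// mul1r mulN1r.
  by rewrite lt0_exponential_pdf ?mul0r// lt_neqAle x0.
rewrite notin_setE/= => /not_andP[//|/contrapT ->].
by rewrite /tpow ltxx mul0r.
Qed.

Lemma betaI_minus_half : betaI (- 2^-1) = pi%:E.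
Proof.
have := gammaI_betaI (- 2^-1).
rewrite (_ : - 2^-1 + 3 / 2 = 1)%R; last lra.
rewrite (_ : - 2^-1 + 1 = 2^-1)%R; last lra.
by rewrite gammaI_one mul1e gammaI_half => ->; rewrite -EFinM -expr2 sqr_sqrtr// pi_ge0.
Qed.

(** No angle appears: with v = y^2 and then w = x^2 + v, the inner integral over x of (w -
    x^2)_+^(-1/2) equals [betaI (- 2^-1)], that is pi, for every w > 0. *)
Lemma integral_polar (h : R -> \bar R) :
  measurable_fun setT h -> (forall y, 0 <= h y) ->
  \int[leb]_x \int[leb]_y h (x ^+ 2 + y ^+ 2)%R =
  pi%:E * \int[leb]_(w in `]0%R, +oo[) h w.
Proof.
move=> mh h0.
pose F (z : measurableTypeR R * measurableTypeR R) :=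
  h z.2 * (tpow (z.2 - z.1 ^+ 2) (- 2^-1))%:E.
have mF : measurable_fun setT F.
  rewrite /F; apply: emeasurable_funM; last by meas.
  by apply: (measurableT_comp mh); meas.
have F0 z : 0 <= F z by rewrite mule_ge0// lee_fin tpow_ge0.
transitivity (\int[leb]_x \int[leb]_w F (x, w)).
  apply: eq_integral => x _.
  rewrite (integral_square (h := fun v => h (x ^+ 2 + v)%R)); last 2 first.
  - by apply: (measurableT_comp mh); meas.
  - by move=> y.
  rewrite -[RHS](integral_translate (x ^+ 2)); last 2 first.
  - exact: (measurable_fun_pair2 x mF).
  - by move=> y.
  by apply: eq_integral => v _; rewrite /F/= addrC addrK.
rewrite (fubini_tonelli (m1 := leb) (m2 := leb) F mF F0).
rewrite [in RHS]integral_mkcond -ge0_integralZl//; last 3 first.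
- by apply/(measurable_restrictT _ _).1 => //; exact: measurable_funTS.
- by move=> x _; rewrite /patch; case: ifP.
- by rewrite lee_fin pi_ge0.
apply: eq_integral => w _; rewrite /F/= ge0_integralZl//; last 2 first.
- by meas.
- by move=> x _; rewrite lee_fin tpow_ge0.
rewrite integral_tpow_sub_square betaI_minus_half addNr /tpow powRr0 /patch.
case: ltP => w0; first by rewrite mem_set /= ?in_itv/= ?w0// mul1e muleC.
by rewrite memNset ?mul0e ?mule0//= in_itv/= ltNge w0.
Qed.

End GammaBeta.

(** * Finiteness and positivity of the Gamma integral *)

Section GammaFinite.
Local Open Scope ereal_scope.
Context {R : realType}.

Local Notation leb := (@lebesgue_measure R).

(** From ln y < y at y = x / (2 (p + 1)); this scale makes the coefficient p / (2 (p + 1)) of x at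
    most 1/2. *)
Lemma powR_le_expR (p x : R) : (0 <= p)%R -> (0 < x)%R ->
  (x `^ p <= expR (p * ln (2 * (p + 1))) * expR (x / 2))%R.
Proof.
move=> p0 x0; have c0 : (0 < 2 * (p + 1))%R by lra.
rewrite /powR gt_eqF// -expRD ler_expR.
have := ln_sublinear (divr_gt0 x0 c0); rewrite ln_div// => /ltW h.
have h1 : (ln x <= x / (2 * (p + 1)) + ln (2 * (p + 1)))%R by lra.
rewrite (le_trans (ler_wpM2l p0 h1))// mulrDr addrC lerD2l mulrA.
rewrite ler_pdivrMr// mulrAC ler_pdivlMr//.
have := ltW x0; nra.
Qed.

(** Half of the exponential absorbs x^(s - 1/2); what remains, x^(-1/2) exp(-x/2), is a Gaussian
    integral after the square substitution. The range s >= 1/2 is the one that exponents a >= -1/2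
    lead to in [betaIE]. *)
Lemma gammaI_lty (s : R) : (2^-1 <= s)%R -> gammaI s < +oo.
Proof.
move=> hs; set C := expR ((s - 2^-1) * ln (2 * ((s - 2^-1) + 1)))%R.
have gaussE : \int[leb]_x (expR (- (x ^+ 2 / 2)))%:E = (Num.sqrt 2 * Num.sqrt pi)%:E.
  have s20 : (0 < Num.sqrt (2 : R))%R by rewrite sqrtr_gt0.
  rewrite (integral_scale s20); last 2 first.
  - by meas.
  - by move=> y; rewrite lee_fin expR_ge0.
  rewrite [RHS]EFinM; congr (_ * _); rewrite -integralT_gauss; apply: eq_integral => x _.
  rewrite /gauss_fun exprMn sqr_sqrtr//; congr (expR (- _))%:E.
  by rewrite mulrC mulKf.
rewrite /gammaI (@le_lt_trans _ _ (\int[leb]_x (C%:E * ((expR (- (x / 2)))%:E * (tpow x (- 2^-1))%:E))))//.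
  apply: ge0_le_integral => //.
  - by move=> x _; rewrite lee_fin mulr_ge0 ?tpow_ge0 ?expR_ge0.
  - by meas.
  - by meas.
  - move=> x _; rewrite lee_fin.
    rewrite /tpow; case: ltP => x0; last by rewrite mul0r !mulr0.
    rewrite (_ : s - 1 = - 2^-1 + (s - 2^-1))%R; last by lra.
    rewrite powRD ?(gt_eqF x0) ?implybT// -mulrA.
    rewrite [leRHS]mulrA [leRHS]mulrC ler_wpM2l ?powR_ge0//.
    rewrite (_ : C * _ = C * expR (x / 2) * expR (- x))%R.
      by rewrite ler_wpM2r ?expR_ge0// /C powR_le_expR// subr_ge0.
    by rewrite -mulrA -expRD; congr (_ * expR _)%R; lra.
rewrite ge0_integralZl; last 4 first.
- by [].
- by meas.
- by move=> x _; rewrite lee_fin mulr_ge0 ?tpow_ge0 ?expR_ge0.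
- by rewrite lee_fin expR_ge0.
rewrite -(integral_square (h := fun v => (expR (- (v / 2)))%:E)); last 2 first.
- by meas.
- by move=> y; rewrite lee_fin expR_ge0.
by rewrite gaussE -EFinM ltry.
Qed.

Lemma gammaI_gt0 (s : R) : (2^-1 <= s)%R -> 0 < gammaI s.
Proof.
move=> hs; rewrite (@lt_le_trans _ _ (\int[leb]_(x in `[1%R, 2%R]) cst (2^-1 * expR (- 2))%:E x))//.
  rewrite integral_cst//= lebesgue_measure_itv/= lte_fin ltr1n -EFinB -EFinM lte_fin.
  rewrite !mulr_gt0 ?expR_gt0//; lra.
apply: (@le_trans _ _ (\int[leb]_(x in `[1%R, 2%R]) (tpow x (s - 1) * expR (- x))%:E)).
  apply: ge0_le_integral => //.
  - by move=> x _; rewrite lee_fin mulr_ge0 ?expR_ge0.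
  - by apply: measurable_funTS; meas.
  - move=> x; rewrite /= in_itv/= => /andP[x1 x2]; rewrite lee_fin.
    apply: ler_pM; rewrite ?expR_ge0 ?ler_expR ?lerN2//.
    have x0 : (0 < x)%R by lra.
    rewrite /tpow x0 (@le_trans _ _ (x `^ (- 1)))%R//.
      by rewrite powRN powRr1 ?(ltW x0)// lef_pV2 ?posrE.
    by rewrite ler_powR//; lra.
rewrite /gammaI; apply: ge0_subset_integral => //.
- by meas.
- by move=> x _; rewrite lee_fin mulr_ge0 ?tpow_ge0 ?expR_ge0.
Qed.

Lemma gammaIE (s : R) : (2^-1 <= s)%R -> gammaI s = (Gamma s)%:E.
Proof.
move=> hs; rewrite fine_gammaI fineK// ge0_fin_numE ?gammaI_lty//.
by rewrite ltW// gammaI_gt0.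
Qed.

Lemma Gamma_gt0 (s : R) : (2^-1 <= s)%R -> (0 < Gamma s)%R.
Proof. by move=> hs; rewrite -lte_fin -gammaIE// gammaI_gt0. Qed.

Lemma Gamma_half : Gamma (2^-1 : R) = Num.sqrt pi.
Proof. by rewrite fine_gammaI gammaI_half. Qed.

Lemma betaIE (a : R) : (- 2^-1 <= a)%R ->
  betaI a = (Num.sqrt pi * Gamma (a + 1) / Gamma (a + 3 / 2))%:E.
Proof.
move=> ha; have := gammaI_betaI a.
have g0 : (0 < Gamma (a + 3 / 2))%R by apply: Gamma_gt0; lra.
rewrite !gammaIE; [|lra..].
have b0 : 0 <= betaI a by apply: integral_ge0 => x _; rewrite lee_fin tpow_ge0.
move: b0; case: (betaI a) => [b _| _|//].
  by rewrite -!EFinM => -[<-]; congr EFin; rewrite mulrAC mulfV ?mul1r ?gt_eqF.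
by rewrite gt0_muley ?lte_fin.
Qed.

End GammaFinite.

(** * Radial functions *)

Section Radial.
Local Open Scope ereal_scope.
Context {R : realType}.

Local Notation leb := (@lebesgue_measure R).
Local Notation RR := (measurableTypeR R).

Lemma integral_lebMS n (f : Rn R n.+1 -> \bar R) :
  measurable_fun setT f -> (forall z, 0 <= f z) ->
  \int[lebM n.+1]_z f z = \int[leb]_x \int[lebM n]_y f (x, y).
Proof. by move=> mf f0; rewrite -(fubini_tonelli1 (m1 := leb) (m2 := lebM n) f). Qed.

Lemma integral_subv n (c : Rn R n) (h : Rn R n -> \bar R) :
  measurable_fun setT h -> (forall z, 0 <= h z) ->
  \int[lebM n]_x h (subv c x) = \int[lebM n]_x h x.
Proof.
elim: n c h => [|n IH] c h mh h0; first exact: integral_reflect.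
have mhc : measurable_fun setT (fun x => h (subv c x)).
  by apply: (measurableT_comp mh); apply: measurable_subv; meas.
rewrite (integral_lebMS mh h0) (integral_lebMS mhc (fun x => h0 (subv c x))).
transitivity (\int[leb]_x \int[lebM n]_y h ((c.1 - x)%R, y)).
  apply: eq_integral => x _; apply: (IH c.2 (fun y => h ((c.1 - x)%R, y))) => //.
  exact: (measurable_fun_pair2 _ mh).
apply: (@integral_reflect R c.1 (fun x => \int[lebM n]_y h (x, y))).
- exact: (measurable_fun_fubini_tonelli_F h).
- by move=> y; exact: integral_ge0.
Qed.

Lemma integral_shear2 (t : R) (h : RR * RR -> \bar R) :
  measurable_fun setT h -> (forall z, 0 <= h z) ->
  \int[leb]_x \int[leb]_y h (x, (y + t * x)%R) = \int[leb]_x \int[leb]_y h (x, y).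
Proof.
move=> mh h0; apply: eq_integral => x _.
apply: (@integral_translate R (t * x)%R (fun y => h (x, y))) => //.
exact: (measurable_fun_pair2 _ mh).
Qed.

Lemma integral_shear1 (t : R) (h : RR * RR -> \bar R) :
  measurable_fun setT h -> (forall z, 0 <= h z) ->
  \int[leb]_x \int[leb]_y h ((x + t * y)%R, y) = \int[leb]_x \int[leb]_y h (x, y).
Proof.
move=> mh h0; rewrite [RHS](fubini_tonelli (m1 := leb) (m2 := leb) h mh h0).
pose g (z : RR * RR) := h ((z.1 + t * z.2)%R, z.2).
have mg : measurable_fun setT g by apply: (measurableT_comp mh); meas.
rewrite (fubini_tonelli (m1 := leb) (m2 := leb) g mg (fun z => h0 _)).
apply: eq_integral => y _.
apply: (@integral_translate R (t * y)%R (fun x => h (x, y))) => //.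
exact: (measurable_fun_pair1 _ mh).
Qed.

(* A rotation is a product of three shears, each of which preserves the measure
   by translation invariance in one coordinate. *)
Lemma integral_rotate (c s : R) (h : RR * RR -> \bar R) : (c ^+ 2 + s ^+ 2 = 1)%R ->
  measurable_fun setT h -> (forall z, 0 <= h z) ->
  \int[leb]_x \int[leb]_y h ((c * x - s * y)%R, (s * x + c * y)%R) =
  \int[leb]_x \int[leb]_y h (x, y).
Proof.
move=> cs mh h0.
have [s0|s0] := eqVneq s 0%R.
  have : ((c - 1) * (c + 1) == 0)%R by apply/eqP; move: cs; rewrite s0; nra.
  rewrite mulf_eq0 subr_eq0 addr_eq0 => /orP[/eqP c1|/eqP c1].
    apply: eq_integral => x _; apply: eq_integral => y _.
    by rewrite c1 s0 !mul0r !mul1r subr0 add0r.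
  have mG : measurable_fun setT (fun x => \int[leb]_y h (x, y)).
    exact: (measurable_fun_fubini_tonelli_F (m2 := leb) h).
  rewrite -(@integral_reflect R 0%R _ mG (fun x => integral_ge0 _ (fun y _ => h0 _))).
  apply: eq_integral => x _.
  rewrite -(@integral_reflect R 0%R _ (measurable_fun_pair2 (0 - x)%R mh) (fun y => h0 _)).
  by apply: eq_integral => y _; rewrite c1 s0 !mul0r !mulN1r !sub0r subr0.
(* For c = cos x and s = sin x this is tan (x/2), up to sign the coefficient of the two outer
   shears. The case s = 0, where the rotation is the identity or the central reflection, was treated
   apart. *)
pose t : R := ((1 - c) / s)%R.
have ts : (t * s = 1 - c)%R by rewrite /t mulfVK.
have tc : (t * (1 + c) = s)%R.
  by rewrite /t mulrAC (_ : ((1 - c) * (1 + c) = s ^+ 2)%R); [rewrite expr2 mulfK|lra].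
have E1 (x y : R) : (c * x - s * y = x + - t * y + - t * (y + s * (x + - t * y)))%R.
  transitivity ((1 - t * s) * x - t * (1 + (1 - t * s)) * y)%R; last by ring.
  by rewrite ts subKr tc.
have E2 (x y : R) : (s * x + c * y = y + s * (x + - t * y))%R.
  transitivity (s * x + (1 - t * s) * y)%R; last by ring.
  by rewrite ts subKr.
pose h1 (z : RR * RR) := h ((z.1 + (- t) * z.2)%R, z.2).
pose h2 (z : RR * RR) := h1 (z.1, (z.2 + s * z.1)%R).
have mh1 : measurable_fun setT h1 by apply: (measurableT_comp mh); meas.
have mh2 : measurable_fun setT h2 by apply: (measurableT_comp mh1); meas.
rewrite -[RHS](integral_shear1 (- t)%R mh h0).
rewrite -[RHS](integral_shear2 s mh1 (fun z => h0 _)).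
rewrite -[RHS](integral_shear1 (- t)%R mh2 (fun z => h0 _)).
apply: eq_integral => x _; apply: eq_integral => y _.
by rewrite /h2 /h1/= E1 E2.
Qed.

Lemma integral_planar (x1 x2 : R) (Psi : RR * RR -> \bar R) :
  measurable_fun setT Psi -> (forall z, 0 <= Psi z) ->
  \int[leb]_y1 \int[leb]_y2
    Psi (((x1 - y1) ^+ 2 + (x2 - y2) ^+ 2)%R, (y1 ^+ 2 + y2 ^+ 2)%R) =
  \int[leb]_y1 \int[leb]_y2
    Psi (((Num.sqrt (x1 ^+ 2 + x2 ^+ 2) - y1) ^+ 2 + (0 - y2) ^+ 2)%R,
         (y1 ^+ 2 + y2 ^+ 2)%R).
Proof.
move=> mPsi Psi0.
have : (Num.sqrt (x1 ^+ 2 + x2 ^+ 2) ^+ 2 = x1 ^+ 2 + x2 ^+ 2)%R.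
  by rewrite sqr_sqrtr ?addr_ge0 ?sqr_ge0.
move: (Num.sqrt (x1 ^+ 2 + x2 ^+ 2)) => r r2.
have [r0|r0] := eqVneq r 0%R.
  have /andP[/eqP -> /eqP ->] : ((x1 == 0) && (x2 == 0))%R.
    have := r2; rewrite r0 expr0n/= => /esym/eqP.
    by rewrite paddr_eq0 ?sqr_ge0// !sqrf_eq0.
  by rewrite r0.
set c := (x1 / r)%R; set s := (x2 / r)%R.
have x1E : x1 = (c * r)%R by rewrite mulfVK.
have x2E : x2 = (s * r)%R by rewrite mulfVK.
have cs : (c ^+ 2 + s ^+ 2 = 1)%R.
  by rewrite /c /s !expr_div_n -mulrDl -r2 divff// expf_neq0.
pose h (z : RR * RR) := Psi (((x1 - z.1) ^+ 2 + (x2 - z.2) ^+ 2)%R, (z.1 ^+ 2 + z.2 ^+ 2)%R).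
have mh : measurable_fun setT h by apply: (measurableT_comp mPsi); meas.
rewrite -[LHS](integral_rotate cs mh (fun z => Psi0 _)).
apply: eq_integral => y1 _; apply: eq_integral => y2 _.
have E1 (u v : R) : ((x1 - (c * u - s * v)) ^+ 2 + (x2 - (s * u + c * v)) ^+ 2 =
    (r - u) ^+ 2 + (0 - v) ^+ 2)%R.
  rewrite {}x1E {}x2E.
  transitivity ((c ^+ 2 + s ^+ 2) * ((r - u) ^+ 2 + v ^+ 2))%R; first by ring.
  by rewrite cs mul1r sub0r sqrrN.
have E2 (u v : R) : ((c * u - s * v) ^+ 2 + (s * u + c * v) ^+ 2 = u ^+ 2 + v ^+ 2)%R.
  transitivity ((c ^+ 2 + s ^+ 2) * (u ^+ 2 + v ^+ 2))%R; first by ring.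
  by rewrite cs mul1r.
by rewrite /h/= E1 E2.
Qed.

Fixpoint zerov (n : nat) : Rn R n :=
  match n return Rn R n with 0 => 0%R | n.+1 => (0%R, zerov n) end.

Definition axisv (n : nat) (r : R) : Rn R n :=
  match n return Rn R n with 0 => r | n.+1 => (r, zerov n) end.

Lemma sqnorm_ge0 n (x : Rn R n) : (0 <= sqnorm x)%R.
Proof.
elim: n x => [|n IH] x /=; first exact: sqr_ge0.
by rewrite addr_ge0 ?sqr_ge0.
Qed.

Lemma sqr_enorm n (x : Rn R n) : (enorm x ^+ 2 = sqnorm x)%R.
Proof. by rewrite sqr_sqrtr// sqnorm_ge0. Qed.

Lemma sqnorm_zerov n : sqnorm (zerov n) = 0%R.
Proof. by elim: n => [|n IH] /=; rewrite ?IH ?expr0n ?addr0. Qed.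

Lemma sqnorm_axisv n r : sqnorm (axisv n r) = (r ^+ 2)%R.
Proof. by case: n => [|n] //=; rewrite sqnorm_zerov addr0. Qed.

(** The induction hypothesis turns [x.2] onto its first axis while the first coordinate stays fixed;
    a rotation in the plane of the first two axes then brings the whole vector onto the first
    one. *)
Lemma integral_radial n (x : Rn R n) (Phi : RR * RR -> \bar R) :
  measurable_fun setT Phi -> (forall z, 0 <= Phi z) ->
  \int[lebM n]_y Phi (sqnorm (subv x y), sqnorm y) =
  \int[lebM n]_y Phi (sqnorm (subv (axisv n (enorm x)) y), sqnorm y).
Proof.
have mPhi2 k (z : Rn R k) (Psi : RR * RR -> \bar R) : measurable_fun setT Psi ->
    measurable_fun setT (fun y : Rn R k => Psi (sqnorm (subv z y), sqnorm y)).
  by move=> mPsi; apply: (measurableT_comp mPsi); meas.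
elim: n x Phi => [|n IH] x Phi mPhi Phi0.
  rewrite /= /enorm/= sqrtr_sqr; case: (leP 0%R x) => x0; first by rewrite ger0_norm.
  rewrite -(@integral_reflect R 0%R (fun y => Phi ((x - y) ^+ 2, y ^+ 2)%R))//; last first.
    exact: (mPhi2 0%N).
  apply: eq_integral => y _; congr (Phi (_, _)); last by rewrite sub0r sqrrN.
  by rewrite ltr0_norm// sub0r opprK -sqrrN opprD.
rewrite (integral_lebMS (mPhi2 n.+1 _ _ mPhi) (fun z => Phi0 _)).
rewrite (integral_lebMS (mPhi2 n.+1 _ _ mPhi) (fun z => Phi0 _)).
transitivity (\int[leb]_y1 \int[lebM n]_y
    Phi (((x.1 - y1) ^+ 2 + sqnorm (subv (axisv n (enorm x.2)) y))%R,
         (y1 ^+ 2 + sqnorm y)%R)).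
  apply: eq_integral => y1 _.
  apply: (IH x.2 (fun z => Phi (((x.1 - y1) ^+ 2 + z.1)%R, (y1 ^+ 2 + z.2)%R))) => //.
  by apply: (measurableT_comp mPhi); meas.
have -> : enorm x = Num.sqrt (x.1 ^+ 2 + enorm x.2 ^+ 2)%R by rewrite sqr_enorm.
case: n IH x => [|n] IH x; first exact: integral_planar.
(* The coordinates after the second enter only through squared norms relative to [zerov], so they
   are integrated out and the planar case applies to what is left. *)
pose Psi (z : RR * RR) := \int[lebM n]_y
  Phi ((z.1 + sqnorm (subv (zerov n) y))%R, (z.2 + sqnorm y)%R).
have mPsi : measurable_fun setT Psi.
  apply: (measurable_fun_fubini_tonelli_F (m2 := lebM n)
    (fun w : (RR * RR) * Rn R n => Phi ((w.1.1 + sqnorm (subv (zerov n) w.2))%R,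
      (w.1.2 + sqnorm w.2)%R))) => //.
  by apply: (measurableT_comp mPhi); meas.
have Psi0 z : 0 <= Psi z by exact: integral_ge0.
have step (a b : R) : \int[leb]_y1 \int[lebM n.+1]_y
    Phi (((a - y1) ^+ 2 + sqnorm (subv (axisv n.+1 b) y))%R, (y1 ^+ 2 + sqnorm y)%R) =
    \int[leb]_y1 \int[leb]_y2
    Psi (((a - y1) ^+ 2 + (b - y2) ^+ 2)%R, (y1 ^+ 2 + y2 ^+ 2)%R).
  apply: eq_integral => y1 _.
  pose g (y : Rn R n.+1) :=
    Phi (((a - y1) ^+ 2 + sqnorm (subv (axisv n.+1 b) y))%R, (y1 ^+ 2 + sqnorm y)%R).
  have mg : measurable_fun setT g by apply: (measurableT_comp mPhi); meas.
  rewrite (integral_lebMS mg (fun z => Phi0 _)).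
  apply: eq_integral => y2 _; apply: eq_integral => y _.
  by rewrite /g/= !addrA.
rewrite [LHS]step (integral_planar _ _ mPsi Psi0).
exact/esym/(step _ 0%R).
Qed.

End Radial.

(** * Self-convolution of the truncated power *)

Section BallConvolution.
Local Open Scope ereal_scope.
Context {R : realType}.

Local Notation leb := (@lebesgue_measure R).
Local Notation RR := (measurableTypeR R).

Definition ballconv (n : nat) (a : R) (x : Rn R n) : \bar R :=
  \int[lebM n]_y (tpow (1 - sqnorm (subv x y)) a * tpow (1 - sqnorm y) a)%:E.

(** The argument is the f-form variable t = r^2 / 2. For t < 0 the square root is 0, so the profile
    is constant there, which makes it continuous on the whole line when a >= 0. *)
Definition ballconv_profile (n : nat) (a t : R) : \bar R :=
  ballconv a (axisv n (Num.sqrt (2 * t))).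

Lemma ballconv_ge0 n a (x : Rn R n) : 0 <= ballconv a x.
Proof. by apply: integral_ge0 => y _; rewrite lee_fin mulr_ge0 ?tpow_ge0. Qed.

Lemma ballconvE n a (x : Rn R n) : ballconv a x = ballconv_profile n a (sqnorm x / 2).
Proof.
have mPhi : measurable_fun setT (fun z : RR * RR => (tpow (1 - z.1) a * tpow (1 - z.2) a)%:E).
  by meas.
have Phi0 (z : RR * RR) : 0 <= (tpow (1 - z.1) a * tpow (1 - z.2) a)%:E.
  by rewrite lee_fin mulr_ge0 ?tpow_ge0.
rewrite /ballconv_profile (_ : 2 * (sqnorm x / 2) = sqnorm x)%R; last by rewrite mulrC divfK.
exact: (integral_radial x mPhi Phi0).
Qed.

Lemma measurable_ballconv n a : measurable_fun setT (@ballconv n a).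
Proof.
apply: (measurable_fun_fubini_tonelli_F (m2 := lebM n) (fun z : Rn R n * Rn R n =>
  (tpow (1 - sqnorm (subv z.1 z.2)) a * tpow (1 - sqnorm z.2) a)%:E)).
- by meas.
- by move=> z; rewrite lee_fin mulr_ge0 ?tpow_ge0.
Qed.

Lemma measurable_axisv n : measurable_fun setT (fun r : RR => axisv n r).
Proof. by case: n => [|n] /=; meas. Qed.

Lemma measurable_ballconv_profile n a :
  measurable_fun setT (fun t : RR => ballconv_profile n a t).
Proof.
apply: (measurableT_comp (@measurable_ballconv n a)).
apply: (measurableT_comp (@measurable_axisv n)).
have : measurable_fun setT (@Num.sqrt R).
  by apply: continuous_measurable_fun; exact: sqrt_continuous.
move=> ms; apply: (measurableT_comp ms); meas.
Qed.

Lemma ballconv_profile_ge0 n a t : 0 <= ballconv_profile n a t.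
Proof. exact: ballconv_ge0. Qed.

Lemma betaI_ge0 (a : R) : 0 <= betaI a.
Proof. by apply: integral_ge0 => x _; rewrite lee_fin tpow_ge0. Qed.

(** Integrating out first x1 and then the first coordinate of y applies [integral_tpow_sub_square]
    to each of the two factors, whence [betaI a] twice. *)
Lemma integral_ballconv_slice n a (x' : Rn R n) :
  \int[leb]_x1 @ballconv n.+1 a (x1, x') =
  betaI a * (betaI a * ballconv (a + 2^-1) x').
Proof.
pose F (z : RR * Rn R n.+1) :=
  (tpow (1 - sqnorm (subv ((z.1, x') : Rn R n.+1) z.2)) a * tpow (1 - sqnorm z.2) a)%:E.
have mF : measurable_fun setT F.
  rewrite /F; apply/measurable_EFinP; apply: measurable_funM; last by meas.
  apply: measurable_tpow; apply: measurable_funB; first by meas.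
  by apply: measurable_sqnorm; apply: measurable_subv; meas.
have F0 z : 0 <= F z by rewrite lee_fin mulr_ge0 ?tpow_ge0.
transitivity (\int[leb]_x1 \int[lebM n.+1]_y F (x1, y)) => //.
rewrite (fubini_tonelli (m1 := leb) (m2 := lebM n.+1) F mF F0).
pose G (y : RR * Rn R n) :=
  (tpow (1 - sqnorm (subv x' y.2)) (a + 2^-1))%:E * betaI a *
  (tpow (1 - sqnorm y.2 - y.1 ^+ 2) a)%:E.
have mG : measurable_fun setT G by rewrite /G; meas.
have G0 z : 0 <= G z by rewrite !mule_ge0 ?betaI_ge0// lee_fin tpow_ge0.
transitivity (\int[lebM n.+1]_y G y).
  apply: eq_integral => y _; rewrite /F/=.
  under eq_integral do rewrite EFinM.
  rewrite ge0_integralZr; [|by []| | |]; last 3 first.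
  - apply/measurable_EFinP; apply: measurable_tpow; by meas.
  - by move=> x1 _; rewrite lee_fin tpow_ge0.
  - by rewrite lee_fin tpow_ge0.
  rewrite (_ : 1 - (y.1 ^+ 2 + sqnorm y.2) = 1 - sqnorm y.2 - y.1 ^+ 2)%R; last first.
    by rewrite opprD addrA addrAC.
  rewrite /G -integral_tpow_sub_square; congr (_ * _).
  rewrite -[RHS](@integral_translate R (- y.1)%R (fun s => (tpow (1 - sqnorm (subv x' y.2) - s ^+ 2) a)%:E)).
  - apply: eq_integral => x1 _; congr ((tpow _ _)%:E).
    by rewrite /= opprD addrA addrAC.
  - by meas.
  - by move=> s; rewrite lee_fin tpow_ge0.
rewrite (integral_lebMS mG G0) (fubini_tonelli (m1 := leb) (m2 := lebM n) G mG G0).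
have mK : measurable_fun setT (fun y : Rn R n =>
    (tpow (1 - sqnorm (subv x' y)) (a + 2^-1) * tpow (1 - sqnorm y) (a + 2^-1))%:E).
  by meas.
have K0 (y : Rn R n) : 0 <=
    (tpow (1 - sqnorm (subv x' y)) (a + 2^-1) * tpow (1 - sqnorm y) (a + 2^-1))%:E.
  by rewrite lee_fin mulr_ge0 ?tpow_ge0.
rewrite /ballconv -ge0_integralZl//; last exact: betaI_ge0.
rewrite -ge0_integralZl//; last 3 first.
- exact: measurable_funeM.
- by move=> y _; rewrite mule_ge0 ?betaI_ge0.
- exact: betaI_ge0.
apply: eq_integral => y _; rewrite /G/= ge0_integralZl; [|by []| | |]; last 3 first.
- by meas.
- by move=> s _; rewrite lee_fin tpow_ge0.
- by rewrite mule_ge0 ?betaI_ge0// lee_fin tpow_ge0.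
rewrite integral_tpow_sub_square EFinM -!muleA muleC -!muleA; congr (_ * _).
by rewrite muleC muleA [X in X * _]muleC.
Qed.

Lemma ballconv_profile_half n a t : (0 <= t)%R ->
  \int[leb]_x ballconv_profile n.+1 a (t + x ^+ 2 / 2) =
  betaI a * (betaI a * ballconv_profile n (a + 2^-1) t).
Proof.
move=> t0; rewrite -integral_ballconv_slice; apply: eq_integral => x _.
rewrite ballconvE; congr (ballconv_profile _ _ _).
rewrite /= sqnorm_axisv sqr_sqrtr ?mulr_ge0//.
by rewrite mulrDl addrC [(2 * t)%R]mulrC mulfK.
Qed.

End BallConvolution.

Lemma ge0_integralZlT d (T : measurableType d) (R : realType)
    (mu : {measure set T -> \bar R}) (f : T -> \bar R) (k : R) :
  measurable_fun setT f -> (forall x, (0 <= f x)%E) -> 0 <= k ->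
  (\int[mu]_x (k%:E * f x) = k%:E * \int[mu]_x f x)%E.
Proof. by move=> mf f0 k0; apply: ge0_integralZl => //; rewrite lee_fin. Qed.

Lemma mule_eqVl (R : realType) (c : R) (u v : \bar R) : c != 0 ->
  (c%:E * u = v)%E -> (u = (c^-1)%:E * v)%E.
Proof. by move=> c0 <-; rewrite muleA -EFinM mulVf// mul1e. Qed.

Section ProfileIntegrals.
Local Open Scope ereal_scope.
Context {R : realType}.

Local Notation leb := (@lebesgue_measure R).
Local Notation RR := (measurableTypeR R).

Variables (B : RR -> \bar R) (t : R).
Hypotheses (mB : measurable_fun setT B) (B0 : forall s, 0 <= B s).

Lemma integral_half_square :
  \int[leb]_x B (t + x ^+ 2 / 2)%R =
  (Num.sqrt 2)%:E * \int[leb]_s ((tpow s (- 2^-1))%:E * B (t + s)%R).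
Proof.
have mB2 : measurable_fun setT (fun s : RR => B (t + s / 2)%R).
  by apply: (measurableT_comp mB); meas.
have mB1 : measurable_fun setT (fun s : RR => B (t + s)%R).
  by apply: (measurableT_comp mB); meas.
have mK : measurable_fun setT (fun s : RR => B (t + s / 2)%R * (tpow s (- 2^-1))%:E).
  by meas.
have K0 (s : R) : 0 <= B (t + s / 2)%R * (tpow s (- 2^-1))%:E.
  by rewrite mule_ge0// lee_fin tpow_ge0.
have s2 : (0 < Num.sqrt (2 : R))%R by rewrite sqrtr_gt0.
rewrite (integral_square mB2 (fun s => B0 _)) (integral_scale (ltr0n R 2) mK K0).
have mL : measurable_fun setT (fun s : RR => (tpow s (- 2^-1))%:E * B (t + s)%R) by meas.
have L0 (s : RR) : 0 <= (tpow s (- 2^-1))%:E * B (t + s)%R.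
  by rewrite mule_ge0// lee_fin tpow_ge0.
have mK2 : measurable_fun setT (fun s : RR => B (t + 2 * s / 2)%R * (tpow (2 * s) (- 2^-1))%:E).
  by apply: (measurableT_comp mK); meas.
rewrite -(ge0_integralZlT _ mL L0 (ltW s2)) -(ge0_integralZlT _ mK2 (fun s => K0 _) (ler0n R 2)).
apply: eq_integral => s _; rewrite [(2 * s / 2)%R]mulrC mulKf//.
rewrite [B _ * _]muleC !muleA; congr (_ * _); rewrite -!EFinM; congr EFin.
rewrite /tpow pmulr_rgt0//; case: ltP => s0; last by rewrite !mulr0.
rewrite powRM// ?(ltW s0)// mulrA; congr (_ * _)%R.
rewrite powRN powR12_sqrt// -[X in (X / _)%R](sqr_sqrtr (ler0n R 2)) expr2.
by rewrite mulfK ?gt_eqF.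
Qed.

Lemma integral_half_square2 :
  \int[leb]_x \int[leb]_y B (t + (x ^+ 2 + y ^+ 2) / 2)%R =
  (2 * pi)%:E * \int[leb]_(s in `]0%R, +oo[) B (t + s)%R.
Proof.
have mB2 : measurable_fun setT (fun s : RR => B (t + s / 2)%R).
  by apply: (measurableT_comp mB); meas.
have mB1 : measurable_fun setT (fun s : RR => B (t + s)%R).
  by apply: (measurableT_comp mB); meas.
have mK : measurable_fun setT ((fun s : RR => B (t + s / 2)%R) \_ `]0%R, +oo[).
  by apply/(measurable_restrictT _ _).1 => //; exact: measurable_funTS.
have K0 (s : R) : 0 <= ((fun s : RR => B (t + s / 2)%R) \_ `]0%R, +oo[) s.
  by rewrite /patch; case: ifP.
rewrite (integral_polar mB2 (fun s => B0 _)) [in LHS]integral_mkcond.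
rewrite (integral_scale (ltr0n R 2) mK K0) muleA -EFinM [(pi * 2)%R]mulrC.
rewrite [in RHS]integral_mkcond; congr (_ * _); apply: eq_integral => s _.
rewrite /patch !mem_setE !in_itv/= !andbT pmulr_rgt0//.
by rewrite [(2 * s / 2)%R]mulrC mulKf.
Qed.

End ProfileIntegrals.

(** * Normalized profiles and their integral relations *)

Section Normalization.
Local Open Scope ereal_scope.
Context {R : realType}.
Variable l : R.

Local Notation leb := (@lebesgue_measure R).
Local Notation RR := (measurableTypeR R).

Definition wu_exp (j : nat) : R := l - j%:R / 2.

(** The square of the constant of [P] for k = j / 2, see [root_cst_sqr]. By [wu_cstS] it cancels the
    two Beta factors of a slice up to sqrt (2 pi). *)
Definition wu_cst (j : nat) : R :=
  ((2 / pi) `^ (j%:R / 2) * (Gamma (l + 1) / Gamma (wu_exp j + 1)) ^+ 2)%R.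

(* The f-form of the generalized Wu function for k = j/2, see [wuE]. *)
Definition wu_profile (j : nat) (t : R) : \bar R :=
  (wu_cst j)%:E * ballconv_profile j (wu_exp j) t.

Lemma wu_expS j : (wu_exp j.+1 + 2^-1 = wu_exp j)%R.
Proof. by rewrite /wu_exp -natr1; lra. Qed.

Lemma wu_cst_ge0 j : (0 <= wu_cst j)%R.
Proof. by rewrite mulr_ge0 ?powR_ge0 ?sqr_ge0. Qed.

Lemma wu_profile_ge0 j t : 0 <= wu_profile j t.
Proof. by rewrite mule_ge0 ?ballconv_profile_ge0// lee_fin wu_cst_ge0. Qed.

Lemma measurable_wu_profile j : measurable_fun setT (fun t : RR => wu_profile j t).
Proof. by apply: measurable_funeM; exact: measurable_ballconv_profile. Qed.

Lemma wu_cstS j : (- 2^-1 <= wu_exp j.+1)%R ->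
  (wu_cst j.+1 * (Num.sqrt pi * Gamma (wu_exp j.+1 + 1) / Gamma (wu_exp j.+1 + 3 / 2)) ^+ 2 =
   Num.sqrt 2 * Num.sqrt pi * wu_cst j)%R.
Proof.
move=> h; have g1 : (0 < Gamma (wu_exp j.+1 + 1))%R by apply: Gamma_gt0; lra.
have g0 : (0 < Gamma (wu_exp j + 1))%R by apply: Gamma_gt0; rewrite -(wu_expS j); lra.
have p0 := pi_gt0 R.
rewrite /wu_cst (_ : wu_exp j.+1 + 3 / 2 = wu_exp j + 1)%R; last by rewrite -(wu_expS j); lra.
have -> : ((2 / pi : R) `^ (j.+1%:R / 2) = (2 / pi) `^ (j%:R / 2) * (Num.sqrt 2 / Num.sqrt pi))%R.
  rewrite (_ : j.+1%:R / 2 = j%:R / 2 + 2^-1 :> R)%R; last by rewrite -natr1; lra.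
  have r0 : (0 < 2 / pi :> R)%R by rewrite divr_gt0.
  rewrite powRD ?(gt_eqF r0) ?implybT// powR12_sqrt ?(ltW r0)//.
  by rewrite sqrtrM// sqrtrV// ltW.
have : (0 < Num.sqrt (pi : R))%R by rewrite sqrtr_gt0.
move: g0 g1 (Gamma (l + 1)); move: (Gamma (wu_exp j + 1)) (Gamma (wu_exp j.+1 + 1)).
move: (Num.sqrt pi) (Num.sqrt 2) (powR (2 / pi) (j%:R / 2)).
move=> sp s2 P g g' g0 g1 G sp0; field.
by rewrite (gt_eqF g0) (gt_eqF g1) (gt_eqF sp0).
Qed.

Lemma betaI_wu j : (- 2^-1 <= wu_exp j.+1)%R ->
  (wu_cst j.+1)%:E * (betaI (wu_exp j.+1) * betaI (wu_exp j.+1)) =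
  (Num.sqrt 2 * Num.sqrt pi * wu_cst j)%:E.
Proof. by move=> h; rewrite -wu_cstS// betaIE// -!EFinM -expr2. Qed.

Lemma wu_profile_slice j t : (0 <= t)%R -> (- 2^-1 <= wu_exp j.+1)%R ->
  \int[leb]_x wu_profile j.+1 (t + x ^+ 2 / 2) =
  (Num.sqrt 2 * Num.sqrt pi)%:E * wu_profile j t.
Proof.
move=> t0 h; have mX : measurable_fun setT (fun x : RR =>
    ballconv_profile j.+1 (wu_exp j.+1) (t + x ^+ 2 / 2)).
  by apply: (measurableT_comp (@measurable_ballconv_profile R j.+1 _)); meas.
rewrite /wu_profile (ge0_integralZlT _ mX (fun x => ballconv_profile_ge0 _ _ _)) ?wu_cst_ge0//.
rewrite (ballconv_profile_half _ _ t0) wu_expS [in RHS]muleA -EFinM -(betaI_wu h).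
by rewrite !muleA.
Qed.

(** Of the slice factor sqrt (2 pi), the substitution s = x^2 / 2 accounts for sqrt 2; the remaining
    sqrt pi is the Gamma (1/2) in the kernel of I_(1/2). *)
Lemma wu_profile_half j t : (0 <= t)%R -> (- 2^-1 <= wu_exp j.+1)%R ->
  wu_profile j t =
  \int[leb]_s ((tpow s (- 2^-1) / Num.sqrt pi)%:E * wu_profile j.+1 (t + s)).
Proof.
move=> t0 h; have := wu_profile_slice t0 h.
have := @measurable_wu_profile j.+1; have := wu_profile_ge0 j.+1.
move: (wu_profile j.+1) => B B0 mB.
have mB1 : measurable_fun setT (fun s : RR => B (t + s)%R).
  by apply: (measurableT_comp mB); meas.
rewrite (integral_half_square t mB B0).
have s2 : (0 < Num.sqrt (2 : R))%R by rewrite sqrtr_gt0.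
have sp0 : (0 < Num.sqrt (pi : R))%R by rewrite sqrtr_gt0 pi_gt0.
have c0 : (Num.sqrt 2 * Num.sqrt pi != 0 :> R)%R by rewrite mulf_neq0// gt_eqF.
move=> /esym /(mule_eqVl c0) ->; rewrite muleA -EFinM.
rewrite invfM mulrAC mulVf ?gt_eqF// mul1r.
have mL : measurable_fun setT (fun s : RR => (tpow s (- 2^-1))%:E * B (t + s)%R) by meas.
have L0 (s : RR) : 0 <= (tpow s (- 2^-1))%:E * B (t + s)%R.
  by rewrite mule_ge0// lee_fin tpow_ge0.
have spV0 : (0 <= (Num.sqrt pi)^-1 :> R)%R by rewrite invr_ge0 ltW.
rewrite -(ge0_integralZlT _ mL L0 spV0).
by apply: eq_integral => s _; rewrite muleA -EFinM mulrC.
Qed.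

(** Two successive slices give a double integral that is radial in the two removed coordinates. Its
    polar factor 2 pi is the square of the slice factor sqrt (2 pi), so no constant is left. *)
Lemma wu_profile_tail j t : (0 <= t)%R -> (- 2^-1 <= wu_exp j.+2)%R ->
  wu_profile j t = \int[leb]_(s in `]0%R, +oo[) wu_profile j.+2 (t + s).
Proof.
move=> t0 h2; have h1 : (- 2^-1 <= wu_exp j.+1)%R by rewrite -(wu_expS j.+1); lra.
have c0 : (0 < Num.sqrt 2 * Num.sqrt pi :> R)%R by rewrite mulr_gt0 ?sqrtr_gt0 ?pi_gt0.
have cc : (Num.sqrt 2 * Num.sqrt pi * (Num.sqrt 2 * Num.sqrt pi) = 2 * pi :> R)%R.
  by rewrite mulrACA -!expr2 !sqr_sqrtr// pi_ge0.
have E : (2 * pi)%:E * wu_profile j t =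
    \int[leb]_x \int[leb]_y wu_profile j.+2 (t + (x ^+ 2 + y ^+ 2) / 2).
  rewrite -cc EFinM -muleA -(wu_profile_slice t0 h1).
  have mX : measurable_fun setT (fun x : RR => wu_profile j.+1 (t + x ^+ 2 / 2)).
    by apply: (measurableT_comp (measurable_wu_profile j.+1)); meas.
  rewrite -(ge0_integralZlT _ mX (fun x => wu_profile_ge0 _ _) (ltW c0)).
  apply: eq_integral => x _.
  have tx : (0 <= t + x ^+ 2 / 2)%R by rewrite addr_ge0// divr_ge0// sqr_ge0.
  rewrite -(wu_profile_slice tx h2).
  by apply: eq_integral => y _; rewrite mulrDl addrA.
move: E; have := @measurable_wu_profile j.+2; have := wu_profile_ge0 j.+2.
move: (wu_profile j.+2) => B B0 mB.
rewrite (integral_half_square2 t mB B0).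
have pi2 : (2 * pi != 0 :> R)%R by rewrite mulf_neq0// gt_eqF// pi_gt0.
by move=> /(mule_eqVl pi2) ->; rewrite muleA -EFinM mulVf// mul1e.
Qed.

End Normalization.

(** * Integrals over the ball, and continuity of the self-convolution *)

Section BallConvolutionRegularity.
Local Open Scope ereal_scope.
Context {R : realType}.

Local Notation leb := (@lebesgue_measure R).
Local Notation RR := (measurableTypeR R).

Lemma betaI_gt0 (a : R) : (- 2^-1 <= a)%R -> (0 < Num.sqrt pi * Gamma (a + 1) / Gamma (a + 3 / 2))%R.
Proof.
by move=> ha; rewrite divr_gt0 ?mulr_gt0 ?sqrtr_gt0 ?pi_gt0 ?Gamma_gt0//; lra.
Qed.

Lemma ball_integralS n (a : R) : (- 2^-1 <= a)%R ->
  (\int[lebM n.+1]_y (tpow (1 - sqnorm y) a)%:E =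
   (Num.sqrt pi * Gamma (a + 1) / Gamma (a + 3 / 2))%:E *
   \int[lebM n]_y (tpow (1 - sqnorm y) (a + 2^-1))%:E)%E.
Proof.
move=> ha; pose F (y : RR * Rn R n) := (tpow (1 - sqnorm y.2 - y.1 ^+ 2) a)%:E.
have mF : measurable_fun setT F by rewrite /F; meas.
have F0 y : (0 <= F y)%E by rewrite lee_fin tpow_ge0.
rewrite (eq_integral F); last first.
  by move=> y _; rewrite /F/= opprD addrA addrAC.
rewrite (integral_lebMS mF F0) (fubini_tonelli (m1 := leb) (m2 := lebM n) F mF F0).
under eq_integral => y _ do rewrite /F/= integral_tpow_sub_square (betaIE ha) muleC.
have mG : measurable_fun setT (fun y : Rn R n => (tpow (1 - sqnorm y) (a + 2^-1))%:E).
  by meas.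
have b0 := ltW (betaI_gt0 ha).
by rewrite (ge0_integralZlT _ mG _ b0)// => y; rewrite lee_fin tpow_ge0.
Qed.

Lemma ball_integral_gt0 n (a : R) : (- 2^-1 <= a)%R ->
  (0 < \int[lebM n]_y (tpow (1 - sqnorm y) a)%:E)%E.
Proof.
elim: n a => [|n IH] a ha.
  by rewrite -[X in (_ < X)%E]/(betaI a) betaIE// lte_fin betaI_gt0.
by rewrite ball_integralS// mule_gt0 ?lte_fin ?betaI_gt0//; apply: IH; lra.
Qed.

Lemma ball_integral_lty n (a : R) : (- 2^-1 <= a)%R ->
  \int[lebM n]_y (tpow (1 - sqnorm y) a)%:E < +oo.
Proof.
elim: n a => [|n IH] a ha; first by rewrite -[X in X < _]/(betaI a) betaIE// ltry.
rewrite ball_integralS//; apply: lte_mul_pinfty; rewrite ?lee_fin ?(ltW (betaI_gt0 ha))//.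
by apply: IH; lra.
Qed.

Lemma tpow_le1 (u a : R) : (0 <= a)%R -> (u <= 1)%R -> (tpow u a <= 1)%R.
Proof.
move=> a0 u1; rewrite /tpow; case: ifP => // u0.
have -> : (1 = 1 `^ a :> R)%R by rewrite powR1.
by apply: ge0_ler_powR; rewrite ?nnegrE ?(ltW u0).
Qed.

Lemma tpow_sqnorm_le1 n (x : Rn R n) a : (0 <= a)%R -> (tpow (1 - sqnorm x) a <= 1)%R.
Proof. by move=> a0; apply: tpow_le1 => //; rewrite gerBl sqnorm_ge0. Qed.

Lemma integrable_ball n (a : R) : (- 2^-1 <= a)%R ->
  (lebM n).-integrable setT (fun y : Rn R n => (tpow (1 - sqnorm y) a)%:E).
Proof.
move=> ha; apply/integrableP; split; first by meas.
rewrite (eq_integral (fun y => (tpow (1 - sqnorm y) a)%:E)); first exact: ball_integral_lty.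
by move=> y _; rewrite gee0_abs// lee_fin tpow_ge0.
Qed.

Lemma ballconv_lty n (a : R) (x : Rn R n) : (0 <= a)%R -> ballconv a x < +oo.
Proof.
move=> a0; apply: (@le_lt_trans _ _ (\int[lebM n]_y (tpow (1 - sqnorm y) a)%:E)); last first.
  by apply: ball_integral_lty; lra.
apply: ge0_le_integral => //.
- by move=> y _; rewrite lee_fin mulr_ge0 ?tpow_ge0.
- by meas.
- by meas.
- move=> y _; rewrite lee_fin ler_piMl ?tpow_ge0//; exact: tpow_sqnorm_le1.
Qed.

Lemma tpow_continuous (a u : R) : u != 0%R -> {for u, continuous (fun v : R => tpow v a)}.
Proof.
rewrite neq_lt => /orP[u0|u0].
  have h0 : tpow u a = 0%R by rewrite /tpow ltNge ltW.
  rewrite /prop_for /continuous_at h0.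
  have c0 : (fun=> 0%R : R) v @[v --> u] --> (0%R : R) by exact: cvg_cst.
  apply: cvg_trans c0; apply: near_eq_cvg; near=> v; rewrite /tpow ltNge ltW//.
  by near: v; exact: lt_nbhsl.
rewrite /prop_for /continuous_at.
have cE : (fun v : R => expR (a * ln v))%R v @[v --> u] --> expR (a * ln u)%R.
  apply: (@continuous_comp _ _ _ (fun v => a * ln v)%R expR); last exact: continuous_expR.
  by apply: cvgM; [exact: cvg_cst|exact: continuous_ln].
have -> : tpow u a = expR (a * ln u)%R by rewrite /tpow u0 /powR gt_eqF.
apply: cvg_trans cE; apply: near_eq_cvg; near=> v.
have v0 : (0 < v)%R by near: v; exact: lt_nbhsr.
by rewrite /tpow v0 /powR gt_eqF.
Unshelve. all: by end_near. Qed.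

Lemma measurable_sphere n (x : Rn R n) (c : R) :
  measurable [set y | sqnorm (subv x y) = c].
Proof.
rewrite -[X in measurable X]setTI.
have mf : measurable_fun setT (fun y : Rn R n => sqnorm (subv x y)) by meas.
exact: (mf measurableT _ (measurable_set1 c)).
Qed.

(** For exponent 0 [tpow] jumps at 0, so in the dominated convergence below the integrands may fail
    to converge on a sphere. A slice of such a level set is a level set of the same kind in one
    dimension less. *)
Lemma sphere_null n (x : Rn R n) (c : R) :
  lebM n [set y | sqnorm (subv x y) = c] = 0.
Proof.
elim: n x c => [|n IH] x c.
  apply: countable_lebesgue_measure0.
  apply: (@sub_countable _ _ _ [set x - Num.sqrt c; x + Num.sqrt c]%R); last first.
    by apply: finite_set_countable; exact: finite_set2.
  apply: subset_card_le => y /= xy.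
  have c0 : (0 <= c)%R by rewrite -xy sqr_ge0.
  have /eqP : ((x - y) ^+ 2 == Num.sqrt c ^+ 2)%R by rewrite sqr_sqrtr// xy.
  move=> /eqP; rewrite eqf_sqr => /orP[/eqP h|/eqP h]; [left|right].
    by rewrite -h; ring.
  by rewrite -[X in (x + X)%R]opprK -h; ring.
rewrite -[LHS]/(\int[leb]_x1 ((lebM n \o xsection [set y : RR * Rn R n | sqnorm (subv (x : Rn R n.+1) y) = c]) x1)).
apply: integral0_eq => x1 _ /=.
rewrite -[RHS](IH x.2 (c - (x.1 - x1) ^+ 2)%R); congr (lebM n _).
apply/seteqP; split => y; rewrite /xsection/= inE/=.
  by move=> <-; rewrite addrAC subrr add0r.
by move=> ->; rewrite addrCA subrr addr0.
Qed.

Lemma ballconv_profile_continuous n (a : R) : (0 <= a)%R ->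
  continuous (fun t : R => fine (ballconv_profile n a t)).
Proof.
move=> a0 t; apply/(@cvg_nbhsP _ R^o) => u ut.
pose s k := Num.sqrt (2 * u k)%R; pose s0 := Num.sqrt (2 * t)%R.
have ss0 : s k @[k --> \oo] --> s0.
  apply: (@cvg_comp _ _ _ (fun k => 2 * u k)%R Num.sqrt _ (nbhs (2 * t)%R)).
    by apply: cvgM => //; exact: cvg_cst.
  exact: sqrt_continuous.
apply: fine_cvg; rewrite fineK; last first.
  by rewrite ge0_fin_numE ?ballconv_profile_ge0// ballconv_lty.
pose f_ k (y : Rn R n) := (tpow (1 - sqnorm (subv (axisv n (s k)) y)) a * tpow (1 - sqnorm y) a)%:E.
have ha : (- 2^-1 <= a)%R by lra.
have [] := @dominated_convergence _ _ _ (lebM n) setT measurableT f_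
  (fun y => (tpow (1 - sqnorm (subv (axisv n s0) y)) a * tpow (1 - sqnorm y) a)%:E)
  (fun y => (tpow (1 - sqnorm y) a)%:E).
- by move=> k; rewrite /f_; meas.
- by meas.
- exists [set y | sqnorm (subv (axisv n s0) y) = 1%R]; split.
  + exact: measurable_sphere.
  + exact: sphere_null.
  + move=> y /= /not_implyP[_]; apply: contra_notP => /eqP y1.
    apply: cvg_EFin; first by near=> k.
    apply: cvgM; last exact: cvg_cst.
    apply: (@cvg_comp _ _ _ (fun k => 1 - sqnorm (subv (axisv n (s k)) y))%R
      (fun v => tpow v a) _ (nbhs (1 - sqnorm (subv (axisv n s0) y))%R)); last first.
      by apply: tpow_continuous; rewrite subr_eq0 eq_sym.
    apply: cvgB; first exact: cvg_cst.
    case: n y @f_ y1 => [|k] y f_ y1 /=.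
      by apply: (cvgM (cvgB ss0 (cvg_cst _)) (cvgB ss0 (cvg_cst _))).
    apply: cvgD; last exact: cvg_cst.
    by apply: (cvgM (cvgB ss0 (cvg_cst _)) (cvgB ss0 (cvg_cst _))).
- exact: integrable_ball.
- apply: aeW => y k _; rewrite gee0_abs ?lee_fin ?mulr_ge0 ?tpow_ge0//.
  by rewrite ler_piMl ?tpow_ge0//; exact: tpow_sqnorm_le1.
move=> _ _; exact.
Unshelve. all: by end_near. Qed.

End BallConvolutionRegularity.

(** * Derivatives of the profiles *)

Section NonmeasurableIntegral.
Local Open Scope ereal_scope.
Context d (T : measurableType d) (R : realType) (mu : {measure set T -> \bar R}).
Import HBNNSimple.

(* The functions need not be measurable: a simple function below [f] stays
   below [g] once it is cut off on the null set [N]. *)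
Lemma ge0_le_integral_null (f g : T -> \bar R) (N : set T) :
  measurable N -> mu N = 0 -> (forall x, 0 <= f x) -> (forall x, 0 <= g x) ->
  (forall x, ~ N x -> f x <= g x) -> \int[mu]_x f x <= \int[mu]_x g x.
Proof.
move=> mN N0 f0 g0 fg; rewrite !ge0_integralTE//.
apply: ge_ereal_sup => _ [h hf <-].
pose k := proj_nnsfun h (measurableC mN).
have -> : sintegral mu h = sintegral mu k.
  rewrite -!integralT_nnsfun; apply: ge0_ae_eq_integral => //.
  - exact/measurable_EFinP/measurable_funP.
  - exact/measurable_EFinP/measurable_funP.
  - by move=> x _; rewrite lee_fin fun_ge0.
  - by move=> x _; rewrite lee_fin fun_ge0.
  exists N; split=> // x /=; apply: contra_notP => Nx _.
  by rewrite mindicE mem_set// mulr1.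
apply: ereal_sup_ubound; exists k => // x.
rewrite /k/= mindicE; have [Nx|Nx] := pselect (N x).
  by rewrite memNset ?mulr0//; apply.
by rewrite mem_set// mulr1; apply: le_trans (hf x) (fg x Nx).
Qed.

Lemma ge0_eq_integral_null (f g : T -> \bar R) (N : set T) :
  measurable N -> mu N = 0 -> (forall x, 0 <= f x) -> (forall x, 0 <= g x) ->
  (forall x, ~ N x -> f x = g x) -> \int[mu]_x f x = \int[mu]_x g x.
Proof.
move=> mN N0 f0 g0 fg; apply/eqP; rewrite eq_le; apply/andP; split;
  by apply: (ge0_le_integral_null mN N0) => // x Nx; rewrite fg.
Qed.

End NonmeasurableIntegral.

Section RightDerivative.
Context {R : realType}.

(** The right difference quotient at [t >= 0] evaluates [G] only at points u >= 0, the range in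
    which the formula for [G] holds. *)
Lemma rderiv_primitive (F G : R -> R) (c s v t : R) :
  (forall u, 0 <= u -> G u = c - s * F u) -> 0 <= t ->
  derivable F t 1 -> F^`()%classic t = v -> rderiv G t = - (s * v).
Proof.
move=> GF t0 dF Fv; apply/cvg_lim; first exact: Rhausdorff.
have dv : (fun h : R => h^-1 *: (F (h *: 1 + t) - F t)) h @[h --> 0^'] --> v.
  by rewrite -Fv derive1E; exact: dF.
have := cvg_dnbhs_at_right dv => {}dv.
have : (fun h : R => - (s * (h^-1 *: (F (h *: 1 + t) - F t)))) h @[h --> 0^'+] --> - (s * v).
  by apply: cvgN; apply: cvgM => //; exact: cvg_cst.
apply: cvg_trans; apply: near_eq_cvg; near=> h.
have th : 0 <= t + h by rewrite addr_ge0// ltW.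
rewrite !GF// /GRing.scale/= mulr1 [h + t]addrC.
by ring.
Unshelve. all: by end_near. Qed.

End RightDerivative.

Section WuProfileDerivative.
Context {R : realType}.
Variable l : R.

Local Notation leb := (@lebesgue_measure R).
Local Notation RR := (measurableTypeR R).
Local Notation W := (wu_profile l).

Lemma wu_profile_lty j t : 0 <= wu_exp l j -> (W j t < +oo)%E.
Proof.
move=> h; rewrite /wu_profile lte_mul_pinfty ?lee_fin ?wu_cst_ge0//.
exact: ballconv_lty.
Qed.

Lemma fin_num_wu_profile j t : 0 <= wu_exp l j -> W j t \is a fin_num.
Proof. by move=> h; rewrite ge0_fin_numE ?wu_profile_ge0// wu_profile_lty. Qed.

Lemma wu_profile_continuous j : 0 <= wu_exp l j -> continuous (fun t => fine (W j t)).
Proof.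
move=> h.
have -> : (fun t => fine (W j t)) =
    (fun t => wu_cst l j * fine (ballconv_profile j (wu_exp l j) t)).
  apply/funext => t; rewrite /wu_profile fineM//.
  by rewrite ge0_fin_numE ?ballconv_profile_ge0// ballconv_lty.
by move=> t; apply: cvgM; [exact: cvg_cst|exact: ballconv_profile_continuous].
Qed.

Lemma wu_profile_split j t : 0 <= t -> - 2^-1 <= wu_exp l j.+2 ->
  (W j 0 = \int[leb]_(s in `]0%R, t]) W j.+2 s + W j t)%E.
Proof.
move=> t0 h2.
have := wu_profile_tail (lexx 0) h2; have := wu_profile_tail t0 h2.
have := @measurable_wu_profile _ l j.+2; have := wu_profile_ge0 l j.+2.
move: (W j.+2) => B B0 mB Ht H0.
rewrite {}H0 {}Ht.
have -> : (\int[leb]_(s in `]0%R, +oo[) B (0 + s)%R = \int[leb]_(s in `]0%R, +oo[) B s)%E.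
  by apply: eq_integral => s _; rewrite add0r.
have -> : (\int[leb]_(s in `]0%R, +oo[) B (t + s)%R = \int[leb]_(s in `]t, +oo[) B s)%E.
  have mBt : measurable_fun setT (B \_ `]t, +oo[).
    by apply/(measurable_restrictT _ _).1 => //; exact: measurable_funTS.
  have Bt0 s : (0 <= (B \_ `]t, +oo[) s)%E by rewrite /patch; case: ifP.
  rewrite integral_mkcond [RHS]integral_mkcond -(integral_translate t mBt Bt0).
  apply: eq_integral => s _; rewrite /patch !mem_setE !in_itv/= !andbT.
  by rewrite ltrDr [t + s]addrC.
rewrite -ge0_integral_setU//; last 2 first.
- exact: measurable_funTS.
- apply/eqP/seteqP; split=> // x; rewrite /= !in_itv/= andbT => -[/andP[_ x0]].
  by rewrite ltNge x0.
congr (integral _ _ _); apply/seteqP; split=> x; rewrite /= !in_itv/= !andbT.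
  by move=> ->/=; case: leP; [left|right].
by move=> [/andP[]//|]; apply: le_lt_trans.
Qed.

Lemma rderiv_wu_profile j t s (G : R -> R) :
  (forall u, 0 <= u -> G u = s * fine (W j u)) ->
  0 <= wu_exp l j.+2 -> 0 <= t -> rderiv G t = - (s * fine (W j.+2 t)).
Proof.
move=> GW h2 t0; set f := fun u => fine (W j.+2 u).
have h0 : 0 <= wu_exp l j by rewrite -(wu_expS l j) -(wu_expS l j.+1); lra.
have cf : continuous f by exact: wu_profile_continuous.
have itf (a b : R) : leb.-integrable `[a, b] (EFin \o f).
  by apply: continuous_compact_integrable; [exact: segment_compact|exact: continuous_subspaceT].
(* Starting at -1 makes every [t >= 0], and 0 in particular, an interior point, so that the
   two-sided fundamental theorem of calculus applies; [f] is continuous to the left of 0 as well. *)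
pose F (y : R) := (\int[leb]_(u in `](-1)%R, y]) f u)%R.
have itF (y : R) : leb.-integrable `](-1)%R, y] (EFin \o f).
  by apply: integrableS (itf (-1) y) => //; apply: subset_itv; rewrite bnd_simp.
have t1 : t < t + 1 by rewrite ltrDl.
have [dF F'] : derivable F t 1 /\ F^`()%classic t = f t.
  apply: (@continuous_FTC1 R f (BRight (-1)) t (t + 1) t1 (itF _)).
    by rewrite lte_fin (lt_le_trans _ t0)// ltrN10.
  exact: cf.
have GF u : 0 <= u -> G u = s * (fine (W j 0) + F 0) - s * F u.
  move=> u0; rewrite GW// -mulrBr; congr (_ * _).
  have ha2 : - 2^-1 <= wu_exp l j.+2 by lra.
  have := wu_profile_split u0 ha2.
  have -> : (\int[leb]_(x in `]0%R, u]) W j.+2 x = \int[leb]_(x in `]0%R, u]) (f x)%:E)%E.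
    by apply: eq_integral => x _; rewrite fineK ?fin_num_wu_profile.
  have itu : leb.-integrable `]0%R, u] (EFin \o f).
    by apply: integrableS (itf 0 u) => //; apply: subset_itv; rewrite bnd_simp.
  have <- : (F u - F 0)%:E = (\int[leb]_(x in `]0%R, u]) (f x)%:E)%E.
    rewrite /F (Rintegral_itvB (itF u)) ?bnd_simp ?lerN10//.
    by rewrite /Rintegral fineK// integrable_fin_num.
  rewrite -(fineK (fin_num_wu_profile 0 h0)) -(fineK (fin_num_wu_profile u h0)) -EFinD.
  have key (a b c d : R) : a%:E = (b - c + d)%:E -> d = a + c - b by move=> [->]; ring.
  by move=> /key.
exact: rderiv_primitive GF t0 dF F'.
Qed.

(* The exponent of [W j.+2] may be negative here, in which case only Lebesgue's
   differentiation theorem applies. *)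
Lemma rderiv_wu_profile_ae j s (G : R -> R) :
  (forall u, 0 <= u -> G u = s * fine (W j u)) ->
  0 <= wu_exp l j -> - 2^-1 <= wu_exp l j.+2 ->
  exists N : set RR, [/\ measurable N, leb N = 0%E &
    forall t, 0 <= t -> ~ N t -> (rderiv G t)%:E = ((- s)%:E * W j.+2 t)%E].
Proof.
move=> GW h0 h2.
have mW := @measurable_wu_profile _ l j.+2; have W0 := wu_profile_ge0 l j.+2.
(* The restriction to u > 0 has integral [W j 0], finite since the exponent of [W j] is at least 0.
   Left of 0 the profile is constant and may be infinite. *)
have itW : leb.-integrable setT (W j.+2 \_ `]0%R, +oo[).
  apply/integrableP; split.
    by apply/(measurable_restrictT _ _).1 => //; exact: measurable_funTS.
  have -> : (\int[leb]_x `|(W j.+2 \_ `]0%R, +oo[) x| =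
      \int[leb]_(x in `]0%R, +oo[) W j.+2 x)%E.
    rewrite [RHS]integral_mkcond; apply: eq_integral => x _.
    by rewrite gee0_abs// /patch; case: ifP.
  apply: le_lt_trans (wu_profile_lty 0 h0).
  rewrite (wu_profile_tail (lexx 0) h2) le_eqVlt; apply/orP; left; apply/eqP.
  by apply: eq_integral => x _; rewrite add0r.
pose f (u : RR) : R := fine ((W j.+2 \_ `]0%R, +oo[) u).
have [N1 [mN1 N10 N1P]] := integrable_ae measurableT itW.
have mf : measurable_fun setT f.
  apply: (measurableT_comp (f := fine)); last exact: measurable_int itW.
  exact: fine_measurable.
have fW u : ~ N1 u -> (f u)%:E = (W j.+2 \_ `]0%R, +oo[) u.
  move=> Nu; rewrite /f fineK//; apply: contrapT => h.
  by apply/Nu/N1P => /(_ I).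
have itf : leb.-integrable setT (EFin \o f).
  apply: (le_integrable measurableT _ _ itW); first exact/measurable_EFinP.
  move=> x _; rewrite /= /f; have := W0 x.
  by rewrite /patch; case: ifP => // _; case: (W j.+2 x) => //= *; rewrite ?leey ?normr0 ?lee_fin.
have itfy (y : R) : leb.-integrable `]-oo, y] (EFin \o f).
  by apply: integrableS itf.
have locf : locally_integrable [set: R] f by apply: open_integrable_locally; [exact: openT|exact: itf].
have [N2 [mN2 N20 N2P]] := FTC1Ny itfy locf.
pose F (y : R) := (\int[leb]_(u in `]-oo, y]) f u)%R.
have GF u : 0 <= u -> G u = s * (fine (W j 0) + F 0) - s * F u.
  move=> u0; rewrite GW// -mulrBr; congr (_ * _).
  have := wu_profile_split u0 h2.
  have -> : (\int[leb]_(x in `]0%R, u]) W j.+2 x = \int[leb]_(x in `]0%R, u]) (f x)%:E)%E.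
    apply: ae_eq_integral => //.
    - exact: measurable_funTS.
    - by apply/measurable_EFinP; exact: measurable_funTS.
    - exists N1; split=> // x; apply: contra_notP => Nx; rewrite /= in_itv/= => /andP[x0 _].
      by rewrite fW// /patch mem_set//= in_itv/= x0.
  have <- : (F u - F 0)%:E = (\int[leb]_(x in `]0%R, u]) (f x)%:E)%E.
    rewrite /F (Rintegral_itvB (itfy u)) ?bnd_simp//.
    by rewrite /Rintegral fineK// integrable_fin_num//; exact: integrableS itf.
  rewrite -(fineK (fin_num_wu_profile 0 h0)) -(fineK (fin_num_wu_profile u h0)) -EFinD.
  have key (a b c d : R) : a%:E = (b - c + d)%:E -> d = a + c - b by move=> [->]; ring.
  by move=> /key.
(* Excluded are the points where the cut-off profile is infinite, those where Lebesgue
   differentiation fails, and 0, where the cut-off may change the profile. *)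
exists (N1 `|` N2 `|` [set 0%R]); split.
- by apply: measurableU => //; exact: measurableU.
- have mN12 : measurable (N1 `|` N2) by exact: measurableU.
  rewrite (measureU0 (mu := leb) mN12 (measurable_set1 0) (lebesgue_measure_set1 0)).
  by rewrite (measureU0 (mu := leb) mN1 mN2 N20).
- move=> t t0 /not_orP[/not_orP[Nt1 Nt2] t1].
  have {}t0' : 0 < t by rewrite lt_neqAle t0 andbT eq_sym; exact/eqP.
  have [dF F'] : derivable F t 1 /\ F^`()%classic t = f t.
    by apply: contrapT => h; exact/Nt2/N2P.
  rewrite (rderiv_primitive GF t0 dF F').
  have e : (W j.+2 \_ `]0%R, +oo[) t = W j.+2 t by rewrite /patch mem_set//= in_itv/= t0'.
  by rewrite -mulNr EFinM fW// e.
Qed.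

End WuProfileDerivative.

(** Meant for an [f] built from an iterated [rderiv], about which nothing is known on [N]. Its
    negative part vanishes off [N] and hence integrates to 0. *)
Lemma eq_integral_null d (T : measurableType d) (R : realType)
  (mu : {measure set T -> \bar R}) (f g : T -> \bar R) (N : set T) :
  measurable N -> mu N = 0%E -> (forall x, 0 <= g x)%E ->
  (forall x, ~ N x -> f x = g x) -> (\int[mu]_x f x = \int[mu]_x g x)%E.
Proof.
move=> mN N0 g0 fg; rewrite integralE.
have -> : (\int[mu]_x f^\- x = 0)%E.
  rewrite -(integral0 mu setT); apply: (ge0_eq_integral_null mN N0) => // x Nx.
  by rewrite funenegE (fg x Nx); apply: max_r; rewrite leeNl oppe0.
rewrite sube0; apply: (ge0_eq_integral_null mN N0) => // x Nx.
by rewrite funeposE (fg x Nx); apply: max_l.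
Qed.

(** * The generalized Wu function as a self-convolution *)

Section WuIdentity.
Context {R : realType}.
Variable l : R.

Local Notation leb := (@lebesgue_measure R).
Local Notation RR := (measurableTypeR R).
Local Notation W := (wu_profile l).

Lemma Fform_fl_conv t : 0 <= l -> Fform (fl_conv l) t = fine (W 0 t).
Proof.
move=> l0; rewrite /Fform /fl_conv /wu_profile /wu_cst /wu_exp mul0r subr0 powRr0 mul1r.
have g : Gamma (l + 1) != 0 by rewrite gt_eqF// Gamma_gt0//; lra.
rewrite divff// expr1n mul1e; apply: f_equal; apply: eq_integral => y _.
by rewrite /fl /= !real_normK ?num_real// mulrC.
Qed.

Lemma iter_rderiv_fl_conv n : 0 <= wu_exp l (n.*2) -> forall t : R, 0 <= t ->
  iter n (@rderiv R) (Fform (fl_conv l)) t = (-1) ^+ n * fine (W n.*2 t).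
Proof.
elim: n => [|n IH] h t t0.
  by rewrite /= mul1r Fform_fl_conv//; move: h; rewrite /wu_exp mul0r subr0.
have h' : 0 <= wu_exp l n.*2.
  by rewrite -(wu_expS l n.*2) -(wu_expS l n.*2.+1); rewrite doubleS in h; lra.
rewrite iterS (rderiv_wu_profile (j := n.*2) (s := (-1) ^+ n) (IH h') h t0).
by rewrite doubleS exprS mulN1r mulNr.
Qed.

Lemma Ineg_even n t : 0 <= wu_exp l n.*2 -> 0 <= t ->
  Ineg (n.*2%:R / 2) (Fform (fl_conv l)) t = fine (W n.*2 t).
Proof.
move=> h t0; have e : n.*2%:R / 2 = n%:~R :> R by rewrite -muln2 natrM mulfK.
rewrite /Ineg e intrKceil /Ipos absz_nat subrr eqxx /Ineg_nat.
by rewrite iter_rderiv_fl_conv// mulrA -exprMn mulrNN mulr1 expr1n mul1r.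
Qed.

(** Since the ceiling of n + 1/2 is n + 1, the definition differentiates past the target, to the
    index 2 n + 2, and the half-order integral of [wu_profile_half] comes back to 2 n + 1. *)
Lemma Ineg_odd n t : 0 <= wu_exp l n.*2.+1 -> 0 <= t ->
  Ineg (n.*2.+1%:R / 2) (Fform (fl_conv l)) t = fine (W n.*2.+1 t).
Proof.
move=> h t0.
have h0 : 0 <= wu_exp l n.*2 by rewrite -(wu_expS l n.*2); lra.
have h2 : - 2^-1 <= wu_exp l n.*2.+2 by have := wu_expS l n.*2.+1; lra.
have e : n.*2.+1%:R / 2 = n%:R + 2^-1 :> R.
  by rewrite -natr1 -muln2 natrM mulrDl mulfK// mul1r.
have ce : Num.ceil (n.*2.+1%:R / 2 : R) = n.+1%:Z.
  have nE : n.+1%:~R = n%:R + 1 :> R by rewrite -pmulrn natr1.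
  apply: ceil_def; rewrite rmorphB/= nE e.
  by apply/andP; split; lra.
rewrite /Ineg ce absz_nat /Ipos e -natr1.
have -> : n%:R + 1 - (n%:R + 2^-1) = 2^-1 :> R by lra.
rewrite gt_eqF ?invr_gt0// Gamma_half.
have [N [mN N0 NP]] := rderiv_wu_profile_ae (iter_rderiv_fl_conv h0) h0 h2.
congr fine; rewrite (wu_profile_half t0 h2).
have := @measurable_wu_profile _ l n.*2.+2; have := wu_profile_ge0 l n.*2.+2.
move: NP; move: (W n.*2.+2) => B NP B0 mB.
pose H (s : RR) : \bar R := ((tpow (s - t) (- 2^-1) / Num.sqrt pi)%:E * B s)%E.
have H0 s : (0 <= H s)%E by rewrite mule_ge0// lee_fin divr_ge0 ?sqrtr_ge0 ?tpow_ge0.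
have mH : measurable_fun setT H.
  by apply: emeasurable_funM => //; apply/measurable_EFinP; meas.
transitivity (\int[leb]_x H x)%E; last first.
  have <- := integral_translate t mH H0; apply: eq_integral => s _.
  by rewrite /H addrK addrC.
rewrite integral_mkcond; apply: (eq_integral_null mN N0 H0) => x Nx.
rewrite /patch /H /tpow subr_gt0; case: ifPn => tx; last first.
  rewrite ifF ?mul0r ?mul0e//; apply/negbTE.
  by apply: contraNN tx => tx; rewrite mem_set.
move: tx; rewrite inE/= => tx; rewrite tx EFinM; congr (_ * _)%E.
  by have -> : 2^-1 - 1 = - 2^-1 :> R by lra.
rewrite /Ineg_nat EFinM iterS NP ?(le_trans t0 (ltW tx))// muleA -EFinM.
by rewrite exprS mulN1r mulrNN -exprMn mulrNN mulr1 expr1n mul1e.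
Qed.

Lemma wuE m (x : Rn R m) : 0 <= wu_exp l m ->
  wu l (m%:R / 2) (enorm x) = wu_cst l m * fine (ballconv (wu_exp l m) x).
Proof.
move=> h; have t0 : 0 <= sqnorm x / 2 by rewrite divr_ge0 ?sqnorm_ge0.
rewrite /wu /Dk /Finv sqr_enorm ballconvE.
transitivity (fine (W m (sqnorm x / 2))); last first.
  by rewrite /wu_profile fineM// ge0_fin_numE ?ballconv_profile_ge0// ballconv_lty.
have := odd_double_half m; case: (odd m) => /= e; move: h t0;
  move: (sqnorm x / 2) => t.
  by rewrite -e add1n; exact: Ineg_odd.
by rewrite -e add0n; exact: Ineg_even.
Qed.

End WuIdentity.

(** * Reproducing kernel Hilbert spaces *)

Lemma natSinv_lt (R : realType) (e : R) : 0 < e ->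
  exists N, forall n, (N <= n)%N -> n.+1%:R^-1 < e.
Proof.
by move=> e0; have [N _ h] := near_infty_natSinv_lt (PosNum e0); exists N => n; exact: h.
Qed.

Section ReproducingKernel.
Context {R : realType} {T : Type}.
Implicit Types (H : set (T -> R)) (ip : (T -> R) -> (T -> R) -> R) (K : T -> T -> R).

Section InnerProduct.
Variables (H : set (T -> R)) (ip : (T -> R) -> (T -> R) -> R).
Hypothesis hH : is_inner_product_space H ip.

Lemma ips_sub f g : H f -> H g -> H (fun x => f x - g x).
Proof.
case: hH => _ hD hZ _ _ Hf Hg.
have -> : (fun x => f x - g x) = (fun x => f x + (-1) * g x).
  by apply/funext => x; rewrite mulN1r.
exact: hD Hf (hZ _ _ Hg).
Qed.

Lemma ips_lin a f g h : H f -> H g -> H h ->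
  ip (fun x => a * f x + g x) h = a * ip f h + ip g h.
Proof. by case: hH => _ _ _ _ [hl _ _]; exact: hl. Qed.

Lemma ips_sym f g : H f -> H g -> ip f g = ip g f.
Proof. by case: hH => _ _ _ hs _; exact: hs. Qed.

Lemma ips_ge0 f : H f -> 0 <= ip f f.
Proof. by case: hH => _ _ _ _ [_ hp _]; exact: hp. Qed.

Lemma ips_lin2 a f g : H f -> H g ->
  ip (fun x => a * f x + g x) (fun x => a * f x + g x) =
  a ^+ 2 * ip f f + a * 2 * ip f g + ip g g.
Proof.
case: (hH) => _ hD hZ _ _ Hf Hg; have Hh := hD _ _ (hZ a _ Hf) Hg.
rewrite ips_lin// (ips_sym Hf)// (ips_sym Hg)// !ips_lin// (ips_sym Hg Hf).
by ring.
Qed.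

Lemma ips_sqr_sub f g : H f -> H g ->
  ip (fun x => f x - g x) (fun x => f x - g x) = ip f f - 2 * ip f g + ip g g.
Proof.
move=> Hf Hg.
have -> : (fun x => f x - g x) = (fun x => (-1) * g x + f x).
  by apply/funext => x; rewrite mulN1r addrC.
by rewrite ips_lin2// (ips_sym Hf Hg); ring.
Qed.

Lemma ips_cauchy_schwarz f g : H f -> H g -> (ip f g) ^+ 2 <= ip f f * ip g g.
Proof.
move=> Hf Hg; have [f0|f0] := eqVneq (ip f f) 0.
  have E t : 0 <= t * 2 * ip f g + ip g g.
    case: (hH) => _ hD hZ _ _.
    by have := ips_ge0 (hD _ _ (hZ t _ Hf) Hg); rewrite ips_lin2// f0 mulr0 add0r.
  rewrite f0 mul0r; have [->|n0] := eqVneq (ip f g) 0; first by rewrite expr0n.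
  (* With this multiple the nonnegative expression in [E] would equal -1. *)
  have := E (- (ip g g + 1) / (2 * ip f g)).
  have -> : - (ip g g + 1) / (2 * ip f g) * 2 * ip f g = - (ip g g + 1) by field.
  by lra.
have fp : 0 < ip f f by rewrite lt_neqAle eq_sym f0 ips_ge0.
case: (hH) => _ hD hZ _ _.
have := ips_ge0 (hD _ _ (hZ (- (ip f g / ip f f)) _ Hf) Hg); rewrite ips_lin2//.
have -> : (- (ip f g / ip f f)) ^+ 2 * ip f f + - (ip f g / ip f f) * 2 * ip f g + ip g g =
  ip g g - (ip f g) ^+ 2 / ip f f by field.
by rewrite subr_ge0 ler_pdivrMr// mulrC.
Qed.

(** The parallelogram law for f - h and g - h with the midpoint of [f] and [g] spelled out: in
    [kcomb_dense] this midpoint is again a kernel combination, so its squared distance to [h] is at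
    least the infimum. *)
Lemma ips_parallelogram f g h : H f -> H g -> H h ->
  ip (fun x => f x - g x) (fun x => f x - g x) =
  2 * ip (fun x => f x - h x) (fun x => f x - h x) +
  2 * ip (fun x => g x - h x) (fun x => g x - h x) -
  4 * ip (fun x => h x - (2^-1 * f x + 2^-1 * g x)) (fun x => h x - (2^-1 * f x + 2^-1 * g x)).
Proof.
move=> Hf Hg Hh; case: (hH) => _ hD hZ _ _.
rewrite (ips_sqr_sub Hf Hg) (ips_sqr_sub Hf Hh) (ips_sqr_sub Hg Hh).
rewrite (ips_sqr_sub Hh (hD _ _ (hZ _ _ Hf) (hZ _ _ Hg))) ips_lin2//; last exact: hZ.
rewrite (ips_sym Hh (hD _ _ (hZ _ _ Hf) (hZ _ _ Hg))) ips_lin//; last exact: hZ.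
have e : (fun x => 2^-1 * g x) = (fun x => 2^-1 * g x + 0).
  by apply/funext => x; rewrite addr0.
have z : H (fun=> 0) by case: hH.
have z0 k : H k -> ip (fun=> 0) k = 0.
  move=> Hk; have := ips_lin 1 z z Hk.
  have -> : (fun x : T => 1 * 0 + 0 : R) = (fun=> 0) by apply/funext => x; rewrite mulr0 addr0.
  by lra.
have Z k a w : H k -> H w -> ip (fun x => a * k x) w = a * ip k w.
  move=> Hk Hw; have -> : (fun x => a * k x) = (fun x => a * k x + 0).
    by apply/funext => x; rewrite addr0.
  by rewrite ips_lin// z0// addr0.
rewrite (ips_sym Hf (hZ _ _ Hg)) !Z//; last exact: hZ.
rewrite (ips_sym Hg (hZ _ _ Hg)) Z// (ips_sym Hg Hf).
by field.
Qed.

Lemma hnorm_sqr f : H f -> hnorm ip f ^+ 2 = ip f f.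
Proof. by move=> Hf; rewrite sqr_sqrtr// ips_ge0. Qed.

Lemma hnorm_subC f g : H f -> H g ->
  hnorm ip (fun x => f x - g x) = hnorm ip (fun x => g x - f x).
Proof.
by move=> Hf Hg; rewrite /hnorm !ips_sqr_sub// (ips_sym Hf Hg); congr Num.sqrt; ring.
Qed.

Lemma hnorm_triangle f g h : H f -> H g -> H h ->
  hnorm ip (fun x => f x - h x) <=
  hnorm ip (fun x => f x - g x) + hnorm ip (fun x => g x - h x).
Proof.
move=> Hf Hg Hh; set a := hnorm ip (fun x => f x - g x).
have Hfg := ips_sub Hf Hg; have Hgh := ips_sub Hg Hh; have Hfh := ips_sub Hf Hh.
set b := hnorm ip (fun x => g x - h x).
have a0 : 0 <= a by exact: sqrtr_ge0.
have b0 : 0 <= b by exact: sqrtr_ge0.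
rewrite -(ler_pXn2r (ltn0Sn 1)) ?nnegrE ?sqrtr_ge0 ?addr_ge0//.
rewrite hnorm_sqr//.
have -> : (fun x => f x - h x) = (fun x => 1 * (f x - g x) + (g x - h x)).
  by apply/funext => x; ring.
rewrite ips_lin2// -!hnorm_sqr// -/a -/b.
have := ips_cauchy_schwarz Hfg Hgh; rewrite -!hnorm_sqr// -/a -/b.
move: (ip _ _) => c hc.
have {hc} : c <= a * b.
  have [c0|c0] := leP c 0; first by rewrite (le_trans c0)// mulr_ge0.
  by rewrite -(ler_pXn2r (ltn0Sn 1)) ?nnegrE ?mulr_ge0 ?(ltW c0)// exprMn.
by nra.
Qed.

Lemma hnorm_triangle0 f g : H f -> H g ->
  hnorm ip f <= hnorm ip g + hnorm ip (fun x => f x - g x).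
Proof.
move=> Hf Hg; have H0 : H (fun=> 0) by case: hH.
have := hnorm_triangle Hf Hg H0.
have e (k : T -> R) : (fun x => k x - 0) = k by apply/funext => x; rewrite subr0.
by rewrite !e addrC.
Qed.

End InnerProduct.

Definition kcomb K (s : seq (R * T)) : T -> R :=
  fun x => \sum_(c <- s) c.1 * K x c.2.

Section Kernel.
Variables (H : set (T -> R)) (ip : (T -> R) -> (T -> R) -> R) (K : T -> T -> R).
Hypothesis hK : is_RKHS H ip K.

Let hH : is_inner_product_space H ip. Proof. by case: hK. Qed.

Lemma kcomb_cons c s : kcomb K (c :: s) = (fun x => c.1 * K x c.2 + kcomb K s x).
Proof. by apply/funext => x; rewrite /kcomb big_cons. Qed.

Lemma kernel_in y : H (fun x => K x y).
Proof. by case: hK => _ _ [h _]; exact: h. Qed.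

Lemma kernel_ip f y : H f -> ip f (fun x => K x y) = f y.
Proof. by case: hK => _ _ [_ h]; exact: h. Qed.

Lemma kcomb_in s : H (kcomb K s).
Proof.
elim: s => [|c s IH].
  have -> : kcomb K [::] = (fun=> 0) by apply/funext => x; rewrite /kcomb big_nil.
  by case: hH.
rewrite kcomb_cons; case: hH => _ hD hZ _ _; apply: hD => //; apply: hZ.
exact: kernel_in.
Qed.

Lemma ip_kcomb s f : H f -> ip (kcomb K s) f = \sum_(c <- s) c.1 * f c.2.
Proof.
move=> Hf; elim: s => [|c s IH].
  have z : H (fun=> 0) by case: hH.
  have -> : kcomb K [::] = (fun=> 0) by apply/funext => x; rewrite /kcomb big_nil.
  rewrite big_nil; have := ips_lin hH 1 z z Hf.
  have -> : (fun x : T => 1 * 0 + 0 : R) = (fun=> 0).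
    by apply/funext => x; rewrite mulr0 addr0.
  by lra.
rewrite kcomb_cons (ips_lin hH _ (kernel_in _) (kcomb_in s) Hf) big_cons IH.
by rewrite (ips_sym hH (kernel_in _) Hf) kernel_ip.
Qed.

Lemma kernel_diag_ge0 y : 0 <= K y y.
Proof.
by rewrite -(kernel_ip y (kernel_in y)) (ips_ge0 hH)//; exact: kernel_in.
Qed.

Lemma rkhs_eval f y : H f -> `|f y| <= hnorm ip f * Num.sqrt (K y y).
Proof.
move=> Hf; have := ips_cauchy_schwarz hH Hf (kernel_in y).
rewrite (kernel_ip _ (kernel_in y)) kernel_ip// => h.
rewrite -sqrtr_sqr /hnorm -sqrtrM ?(ips_ge0 hH)//.
by rewrite ler_wsqrtr.
Qed.

(* A minimizing sequence for the distance to [f] converges by the parallelogram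
   law; minimality makes [f] minus the limit orthogonal to the kernel sections. *)
Lemma kcomb_dense f : H f -> forall e, 0 < e ->
  exists s, hnorm ip (fun x => kcomb K s x - f x) < e.
Proof.
move=> Hf; pose q s := ip (fun x => kcomb K s x - f x) (fun x => kcomb K s x - f x).
have q0 s : 0 <= q s by apply: (ips_ge0 hH); apply: (ips_sub hH) => //; exact: kcomb_in.
pose Q := range q.
have infD : has_inf Q by split; [exists (q [::]), [::]|exists 0 => _ [s _ <-]].
have qd s : inf Q <= q s by apply: ge_inf; [exact: infD.2|exists s].
have [v vP] : {v : nat -> seq (R * T) & forall n, q (v n) < inf Q + n.+1%:R^-1}.
  apply: (@choice _ _ (fun n s => q s < inf Q + n.+1%:R^-1)) => n.
  have n0 : 0 < n.+1%:R^-1 :> R by rewrite invr_gt0.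
  by have [_ [s _ <-] h] := inf_adherent n0 infD; exists s.
have Hv n := kcomb_in (v n).
have par m n : ip (fun x => kcomb K (v m) x - kcomb K (v n) x)
    (fun x => kcomb K (v m) x - kcomb K (v n) x) <= 2 * m.+1%:R^-1 + 2 * n.+1%:R^-1.
  rewrite (ips_parallelogram hH (Hv m) (Hv n) Hf).
  (* Concatenating two combinations with halved coefficients represents their midpoint. *)
  have := qd (map (fun c => (2^-1 * c.1, c.2)) (v m ++ v n)).
  have qE : kcomb K (map (fun c => (2^-1 * c.1, c.2)) (v m ++ v n)) =
      (fun x => 2^-1 * kcomb K (v m) x + 2^-1 * kcomb K (v n) x).
    apply/funext => x; rewrite /kcomb big_map -mulrDr -big_cat mulr_sumr.
    by apply: eq_bigr => c _; rewrite mulrA.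
  have Hm : H (fun x => 2^-1 * kcomb K (v m) x + 2^-1 * kcomb K (v n) x).
    by rewrite -qE; exact: kcomb_in.
  rewrite {1}/q qE (ips_sqr_sub hH Hm Hf).
  rewrite (ips_sqr_sub hH Hf Hm) (ips_sym hH Hm Hf).
  have key (d A B C D E r s : R) : A < d + r -> B < d + s -> d <= C - 2 * D + E ->
    2 * A + 2 * B - 4 * (E - 2 * D + C) <= 2 * r + 2 * s by lra.
  exact: key (vP m) (vP n).
have cau (e : R) : 0 < e -> exists N, forall m n, (N <= m)%N -> (N <= n)%N ->
    hnorm ip (fun x => kcomb K (v m) x - kcomb K (v n) x) < e.
  move=> e0; have [N hN] : exists N, forall n, (N <= n)%N -> n.+1%:R^-1 < e ^+ 2 / 4.
    by apply: natSinv_lt; rewrite divr_gt0 ?exprn_gt0.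
  exists N => m n /hN hm /hN hn.
  rewrite -(ltr_pXn2r (ltn0Sn 1)) ?nnegrE ?sqrtr_ge0 ?(ltW e0)//.
  rewrite (hnorm_sqr hH); last exact: (ips_sub hH).
  have key (r t w : R) : r < w / 4 -> t < w / 4 -> 2 * r + 2 * t < w by lra.
  exact: le_lt_trans (par m n) (key _ _ _ hm hn).
have [g Hg gP] : exists2 g, H g & forall e : R, 0 < e -> exists N, forall p, (N <= p)%N ->
    hnorm ip (fun x => kcomb K (v p) x - g x) < e.
  by case: hK => _ cH _; apply: cH cau.
(* Adding t K(., y) cannot lower the squared distance by more than 1 / (n + 1), which bounds the
   residual [b] at y. The optimal t would be - b / [K y y]; the denominator [K y y + 1] also covers
   [K y y = 0]. *)
have ev n y : (kcomb K (v n) y - f y) ^+ 2 <= n.+1%:R^-1 * (K y y + 1).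
  have Kp : 0 < K y y + 1 by rewrite ltr_wpDl// kernel_diag_ge0.
  have Hd := ips_sub hH (Hv n) Hf.
  set b := kcomb K (v n) y - f y; pose t := - b / (K y y + 1).
  have := qd ((t, y) :: v n); rewrite /q.
  have -> : (fun x => kcomb K ((t, y) :: v n) x - f x) =
      (fun x => t * K x y + (kcomb K (v n) x - f x)).
    by apply/funext => x; rewrite kcomb_cons addrA.
  rewrite (ips_lin2 hH _ (kernel_in y) Hd) (kernel_ip _ (kernel_in y)).
  rewrite (ips_sym hH (kernel_in y) Hd) (kernel_ip _ Hd) -/b -/(q (v n)).
  have := vP n; move: (q (v n)) (inf Q) (n.+1%:R^-1) => A d r h1 h2.
  have h3 : 0 < r + (t ^+ 2 * K y y + t * 2 * b) by lra.
  have e1 : t ^+ 2 * (K y y + 1) + t * b = 0.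
    by rewrite /t; field; rewrite gt_eqF.
  have e2 : t * (K y y + 1) = - b by rewrite /t divfK// gt_eqF.
  have h4 : 0 < r + t * b by have := sqr_ge0 t; lra.
  have : 0 < (r + t * b) * (K y y + 1) by rewrite mulr_gt0.
  by rewrite mulrDl mulrAC e2; lra.
(* Both are pointwise limits of the combinations: [f] by [ev], and [g] because evaluation is
   continuous for the norm. *)
have fg : f = g.
  apply/funext => y; apply/eqP; rewrite -subr_eq0 -normr_le0.
  apply/ler_addgt0Pl => e e0; rewrite addr0.
  have Kp : 0 < K y y + 1 by rewrite ltr_wpDl// kernel_diag_ge0.
  have [N1 h1] := gP (e / 2 / (K y y + 1)) ltac:(by rewrite !divr_gt0).
  have [N2 h2] := @natSinv_lt R (e ^+ 2 / 4 / (K y y + 1)) ltac:(by rewrite !divr_gt0 ?exprn_gt0).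
  pose n := maxn N1 N2.
  have {}h1 := h1 n (leq_maxl _ _); have {}h2 := h2 n (leq_maxr _ _).
  have -> : f y - g y = - (kcomb K (v n) y - f y) + (kcomb K (v n) y - g y) by ring.
  apply: le_trans (ler_normD _ _) _; rewrite normrN (splitr e); apply: lerD.
    rewrite -(ler_pXn2r (ltn0Sn 1)) ?nnegrE//; last by rewrite divr_ge0 ?ltW.
    rewrite real_normK ?num_real//; apply: le_trans (ev n y) _.
    rewrite -ler_pdivlMr//; apply: le_trans (ltW h2) _.
    by rewrite expr_div_n; have -> : 2 ^+ 2 = 4 :> R by ring.
  have := rkhs_eval y (ips_sub hH (Hv n) Hg); move=> /le_trans; apply.
  have sK : Num.sqrt (K y y) <= K y y + 1.
    rewrite -(ler_pXn2r (ltn0Sn 1)) ?nnegrE ?sqrtr_ge0 ?(ltW Kp)//.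
    by rewrite sqr_sqrtr ?kernel_diag_ge0//; have := kernel_diag_ge0 y; nra.
  apply: (@le_trans _ _ (e / 2 / (K y y + 1) * (K y y + 1))); last by rewrite divfK// gt_eqF.
  by apply: ler_pM => //; rewrite ?sqrtr_ge0// ltW.
by move=> e e0; have [N h] := gP e e0; exists (v N); rewrite fg; exact: h.
Qed.

End Kernel.

Lemma rkhs_unique (H1 H2 : set (T -> R)) ip1 ip2 K f :
  is_RKHS H1 ip1 K -> is_RKHS H2 ip2 K -> H1 f ->
  H2 f /\ hnorm ip2 f = hnorm ip1 f.
Proof.
move=> h1 h2 H1f.
have i1 : is_inner_product_space H1 ip1 by case: h1.
have i2 : is_inner_product_space H2 ip2 by case: h2.
have [v vP] : {v : nat -> seq (R * T) &
    forall n, hnorm ip1 (fun x => kcomb K (v n) x - f x) < n.+1%:R^-1}.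
  apply: (@choice _ _ (fun n s => hnorm ip1 (fun x => kcomb K s x - f x) < n.+1%:R^-1)) => n.
  by apply: (kcomb_dense h1 H1f); rewrite invr_gt0.
have Hv1 n := kcomb_in h1 (v n); have Hv2 n := kcomb_in h2 (v n).
(* The inner product of two combinations is a finite sum of kernel values, the same in both spaces;
   a sequence of combinations that is Cauchy for [ip1] is therefore Cauchy for [ip2]. *)
have agree m n : hnorm ip2 (fun x => kcomb K (v m) x - kcomb K (v n) x) =
    hnorm ip1 (fun x => kcomb K (v m) x - kcomb K (v n) x).
  by rewrite /hnorm (ips_sqr_sub i1)// (ips_sqr_sub i2)// !(ip_kcomb h1)// !(ip_kcomb h2).
have cau (e : R) : 0 < e -> exists N, forall m n, (N <= m)%N -> (N <= n)%N ->
    hnorm ip2 (fun x => kcomb K (v m) x - kcomb K (v n) x) < e.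
  move=> e0; have [N hN] := @natSinv_lt R (e / 2) ltac:(by rewrite divr_gt0).
  exists N => m n /hN hm /hN hn; rewrite agree.
  apply: le_lt_trans (hnorm_triangle i1 (Hv1 m) H1f (Hv1 n)) _.
  rewrite (hnorm_subC i1 H1f (Hv1 n)).
  have key (r t a b w : R) : r < w / 2 -> t < w / 2 -> a < r -> b < t -> a + b < w by lra.
  exact: key hm hn (vP m) (vP n).
have [g Hg gP] : exists2 g, H2 g & forall e : R, 0 < e -> exists N, forall p, (N <= p)%N ->
    hnorm ip2 (fun x => kcomb K (v p) x - g x) < e.
  by case: h2 => _ cH _; apply: cH cau.
have both (e : R) : 0 < e -> exists n, hnorm ip1 (fun x => kcomb K (v n) x - f x) < e /\
    hnorm ip2 (fun x => kcomb K (v n) x - g x) < e.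
  move=> e0; have [N1 hN1] := gP e e0; have [N2 hN2] := natSinv_lt e0.
  exists (maxn N1 N2); split; last exact/hN1/leq_maxl.
  by apply: lt_trans (vP _) _; exact/hN2/leq_maxr.
have fg : f = g.
  apply/funext => y; apply/eqP; rewrite -subr_eq0 -normr_le0.
  apply/ler_addgt0Pl => e e0; rewrite addr0.
  have Kp : 0 < 2 * Num.sqrt (K y y) + 1 by rewrite ltr_wpDl// mulr_ge0 ?sqrtr_ge0.
  have [n [p1 p2]] := both (e / (2 * Num.sqrt (K y y) + 1)) ltac:(by rewrite divr_gt0).
  have -> : f y - g y = - (kcomb K (v n) y - f y) + (kcomb K (v n) y - g y) by ring.
  apply: le_trans (ler_normD _ _) _; rewrite normrN.
  apply: le_trans (lerD (rkhs_eval h1 y (ips_sub i1 (Hv1 n) H1f))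
    (rkhs_eval h2 y (ips_sub i2 (Hv2 n) Hg))) _.
  have k0 : 0 <= Num.sqrt (K y y) by exact: sqrtr_ge0.
  apply: le_trans (lerD (ler_wpM2r k0 (ltW p1)) (ler_wpM2r k0 (ltW p2))) _.
  have -> : forall d k : R, d * k + d * k = d * (2 * k) by move=> *; ring.
  by rewrite mulrAC ler_pdivrMr// ler_wpM2l ?(ltW e0)// lerDl.
rewrite -fg in Hg gP both; split=> //.
have E n : hnorm ip2 (kcomb K (v n)) = hnorm ip1 (kcomb K (v n)).
  by rewrite /hnorm (ip_kcomb h1)// (ip_kcomb h2).
have Q (e : R) : 0 < e -> `|hnorm ip2 f - hnorm ip1 f| <= e.
  move=> e0; have [n [p1 p2]] := both (e / 2) ltac:(by rewrite divr_gt0).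
  have a1 := hnorm_triangle0 i1 (Hv1 n) H1f; have a2 := hnorm_triangle0 i1 H1f (Hv1 n).
  have b1 := hnorm_triangle0 i2 (Hv2 n) Hg; have b2 := hnorm_triangle0 i2 Hg (Hv2 n).
  rewrite (hnorm_subC i1 H1f) // in a2; rewrite (hnorm_subC i2 Hg) // in b2.
  rewrite E in b1 b2; move: a1 a2 b1 b2 p1 p2.
  move: (hnorm _ _) (hnorm _ _) (hnorm _ _) (hnorm _ _) (hnorm _ _) => a b c d w *.
  rewrite ler_norml; apply/andP; split; lra.
apply/eqP; rewrite -subr_eq0 -normr_le0; apply/ler_addgt0Pl => e e0.
by rewrite addr0 Q.
Qed.

End ReproducingKernel.

(** * Convolution operators on L^2 *)

Lemma fubini_lty d1 d2 (T1 : measurableType d1) (T2 : measurableType d2) (R : realType)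
  (m1 : {sigma_finite_measure set T1 -> \bar R})
  (m2 : {sigma_finite_measure set T2 -> \bar R}) (f : T1 * T2 -> \bar R) :
  measurable_fun setT f -> (\int[m1]_x \int[m2]_y `|f (x, y)| < +oo)%E ->
  (\int[m1]_x \int[m2]_y f (x, y) = \int[m2]_y \int[m1]_x f (x, y))%E.
Proof.
move=> mf fy; apply: (Fubini (m1 := m1) (m2 := m2)).
by move: fy => /(integrable12ltyP m1 m2 mf).
Qed.

Section VectorOperations.
Context {R : realType}.

Lemma subvK n (x y : Rn R n) : subv x (subv x y) = y.
Proof. by elim: n x y => [x y|n IH [a x] [b y]] /=; rewrite ?IH ?subKr. Qed.

Lemma subvAC n (x y z : Rn R n) : subv (subv x y) z = subv (subv x z) y.
Proof.
by elim: n x y z => [x y z|n IH [a x] [b y] [c z]] /=; rewrite 1?IH [_ - _ - _]addrAC.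
Qed.

Lemma subvv n (x : Rn R n) : subv x x = zerov n.
Proof. by elim: n x => [x|n IH [a x]] /=; rewrite ?IH subrr. Qed.

Lemma subvN n (x y : Rn R n) : subv (zerov n) (subv x y) = subv y x.
Proof. by elim: n x y => [x y|n IH [a x] [b y]] /=; rewrite 1?IH sub0r opprB. Qed.

Lemma sqnormN n (x : Rn R n) : sqnorm (subv (zerov n) x) = sqnorm x.
Proof. by elim: n x => [x|n IH [a x]] /=; rewrite ?IH sub0r sqrrN. Qed.

(* [c - y] for [c = x + w], the reflection exchanging [x - y] and [y - w]. *)
Definition swapv n (x w y : Rn R n) : Rn R n := subv (subv x (subv (zerov n) w)) y.

Lemma subv_swapv n (x w y : Rn R n) : subv x (swapv x w y) = subv y w.
Proof.
elim: n x w y => [x w y|n IH [a x] [c w] [b y]]; rewrite /swapv/=.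
  by rewrite /= sub0r opprK; ring.
by congr (_, _); [ring|exact: IH].
Qed.

Lemma swapv_subv n (x w y : Rn R n) : subv (swapv x w y) w = subv x y.
Proof.
elim: n x w y => [x w y|n IH [a x] [c w] [b y]]; rewrite /swapv/=.
  by rewrite /= sub0r opprK; ring.
by congr (_, _); [ring|exact: IH].
Qed.

Lemma integral_subv_signed n (c : Rn R n) (h : Rn R n -> \bar R) :
  measurable_fun setT h ->
  (\int[lebM n]_x h (subv c x) = \int[lebM n]_x h x)%E.
Proof.
move=> mh; rewrite integralE [RHS]integralE.
rewrite -(integral_subv c (measurable_funepos mh) (funepos_ge0 _)).
rewrite -(integral_subv c (measurable_funeneg mh) (funeneg_ge0 _)).
by congr (_ - _)%E; apply: eq_integral => x _; rewrite ?funeposE ?funenegE.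
Qed.

Lemma integral_subvl n (y : Rn R n) (h : Rn R n -> \bar R) :
  measurable_fun setT h ->
  (\int[lebM n]_x h (subv x y) = \int[lebM n]_x h x)%E.
Proof.
move=> mh; rewrite -(integral_subv_signed y (h := fun x => h (subv x y))); last first.
  by apply: (measurableT_comp mh); meas.
rewrite -(integral_subv_signed (zerov n) mh).
by apply: eq_integral => x _; rewrite subvAC subvv.
Qed.

End VectorOperations.

Section SquareIntegrable.
Context {R : realType} {n : nat}.
Local Notation mu := (@lebM R n).
Implicit Types f g h : Rn R n -> R.

Definition ipL2 f g : R := (\int[mu]_x (f x * g x))%R.

Lemma L2P g : L2 g <-> measurable_fun setT g /\ (\int[mu]_x ((g x) ^+ 2)%:E < +oo)%E.
Proof. by rewrite /L2 -lebME. Qed.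

Lemma L2_meas g : L2 g -> measurable_fun setT g.
Proof. by case. Qed.

Lemma L2_integrable_sqr g : L2 g -> mu.-integrable setT (EFin \o (fun x => g x ^+ 2)).
Proof.
move=> /L2P[mg hg]; apply/integrableP; split; first by meas.
apply: le_lt_trans hg; rewrite le_eqVlt; apply/orP; left; apply/eqP.
by apply: eq_integral => x _; rewrite gee0_abs// lee_fin sqr_ge0.
Qed.

Lemma L2_integrableM f g : L2 f -> L2 g ->
  mu.-integrable setT (EFin \o (fun x => f x * g x)).
Proof.
move=> hf hg; have mf := L2_meas hf; have mg := L2_meas hg.
apply: (le_integrable measurableT _ _
  (integrableD measurableT (L2_integrable_sqr hf) (L2_integrable_sqr hg))); first by meas.
move=> x _; rewrite /= lee_fin normrM [leRHS]ger0_norm ?addr_ge0 ?sqr_ge0//.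
rewrite -(@real_normK _ (f x)) ?num_real// -(@real_normK _ (g x)) ?num_real//.
have := normr_ge0 (f x); have := normr_ge0 (g x).
by move: `|f x| `|g x| => a b a0 b0; nra.
Qed.

Lemma L2_dominated f g : measurable_fun setT f -> L2 g ->
  (forall x, `|f x| <= `|g x|) -> L2 f.
Proof.
move=> mf /L2P[mg hg] fg; apply/L2P; split=> //; apply: le_lt_trans hg.
apply: ge0_le_integral => //; [by move=> x _; rewrite lee_fin sqr_ge0|by meas|by meas|].
move=> x _; rewrite lee_fin -(@real_normK _ (f x)) ?num_real//.
by rewrite -(@real_normK _ (g x)) ?num_real// ler_pXn2r ?nnegrE.
Qed.

Lemma L2_0 : L2 ((fun=> 0) : Rn R n -> R).
Proof.
apply/L2P; split; first exact: measurable_cst.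
by rewrite expr0n integral0_eq.
Qed.

Lemma L2_normr g : L2 g -> L2 (fun x => `|g x|).
Proof.
move=> hg; have mg := L2_meas hg; apply: (L2_dominated _ hg); first by meas.
by move=> x; rewrite normr_id.
Qed.

Lemma L2Z a g : L2 g -> L2 (fun x => a * g x).
Proof.
move=> hg; have /L2P[mg _] := hg; apply/L2P; split; first by meas.
have := integrableZl measurableT (a ^+ 2) (L2_integrable_sqr hg).
move=> /integrableP[_]; apply: le_lt_trans; rewrite le_eqVlt; apply/orP; left; apply/eqP.
by apply: eq_integral => x _; rewrite -EFinM gee0_abs ?lee_fin -?exprMn ?sqr_ge0.
Qed.

Lemma L2D f g : L2 f -> L2 g -> L2 (fun x => f x + g x).
Proof.
move=> hf hg; have /L2P[mf _] := hf; have /L2P[mg _] := hg.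
apply/L2P; split; first by meas.
have := integrableD measurableT (integrableD measurableT (L2_integrable_sqr hf)
  (L2_integrable_sqr hg)) (integrableZl measurableT 2 (L2_integrableM hf hg)).
move=> /integrableP[_]; apply: le_lt_trans; rewrite le_eqVlt; apply/orP; left; apply/eqP.
apply: eq_integral => x _.
rewrite -[RHS]/(`|f x ^+ 2 + g x ^+ 2 + 2 * (f x * g x)|)%:E.
have -> : f x ^+ 2 + g x ^+ 2 + 2 * (f x * g x) = (f x + g x) ^+ 2.
  by move: (f x) (g x) => a b; ring.
by rewrite ger0_norm ?sqr_ge0.
Qed.

Lemma L2B f g : L2 f -> L2 g -> L2 (fun x => f x - g x).
Proof.
move=> hf /(L2Z (-1)) hg; have := L2D hf hg.
by congr L2; apply/funext => x; rewrite mulN1r.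
Qed.

Lemma ipL2C f g : ipL2 f g = ipL2 g f.
Proof. by apply: eq_Rintegral => x _; rewrite mulrC. Qed.

Lemma ipL2_lin a f g h : L2 f -> L2 g -> L2 h ->
  ipL2 (fun x => a * f x + g x) h = a * ipL2 f h + ipL2 g h.
Proof.
move=> hf hg hh.
have e : (fun x => (a * f x + g x) * h x) = (fun x => a * (f x * h x) + g x * h x).
  by apply/funext => x; ring.
rewrite /ipL2 e RintegralD//; [|exact: integrableZl (L2_integrableM hf hh)
  |exact: L2_integrableM].
by rewrite RintegralZl//; exact: L2_integrableM.
Qed.

Lemma ipL2_ge0 f : 0 <= ipL2 f f.
Proof. by apply: Rintegral_ge0 => x _; rewrite -expr2 sqr_ge0. Qed.

Lemma L2normE g : L2norm g = Num.sqrt (ipL2 g g).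
Proof. by rewrite /L2norm -lebME. Qed.

Lemma ipL2_eq0 f : L2 f -> ipL2 f f = 0 -> {ae mu, forall x, f x = 0}.
Proof.
move=> hf f0; have i := L2_integrable_sqr hf.
have : (\int[mu]_x `|(f x ^+ 2)%:E| = 0)%E.
  have -> : (\int[mu]_x `|(f x ^+ 2)%:E| = \int[mu]_x (f x * f x)%:E)%E.
    by apply: eq_integral => x _; rewrite gee0_abs ?lee_fin ?sqr_ge0.
  rewrite -(fineK (integrable_fin_num measurableT (L2_integrableM hf hf))).
  by move: f0; rewrite /ipL2 /Rintegral => ->.
move=> /(ae_eq_integral_abs mu measurableT (measurable_int _ i)) [N [mN N0 NP]].
exists N; split=> // x /= h; apply: NP => /(_ I) /= [] /eqP.
by rewrite sqrf_eq0 => /eqP.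
Qed.

End SquareIntegrable.

Section BallKernelConvolution.
Context {R : realType} {n : nat}.
Local Notation mu := (@lebM R n).
Implicit Types p q f g h : Rn R n -> R.

(** A class inside both L^1 and L^2 that is stable under absolute values and under multiplication by
    coordinates, which are bounded by 1 on the unit ball. The virial step can thus be iterated
    within it. *)
Definition ball_kernel p : Prop :=
  [/\ measurable_fun setT p, exists M, forall z, `|p z| <= M &
      forall z, 1 <= sqnorm z -> p z = 0].

Lemma ball_kernel_meas p : ball_kernel p -> measurable_fun setT p.
Proof. by case. Qed.

Lemma convRnE p g x : convRn p g x = (\int[mu]_y (p (subv x y) * g y))%R.
Proof. by rewrite /convRn -lebME. Qed.

Lemma ball_kernel_normr p : ball_kernel p -> ball_kernel (fun z => `|p z|).
Proof.
move=> [mp [M pM] p0]; split; [by meas|exists M => z|by move=> z /p0 ->; rewrite normr0].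
by rewrite normr_id.
Qed.

(* [tpow (1 - sqnorm z) 0] is the indicator function of the open unit ball. *)
Lemma ball_kernel_bound p : ball_kernel p ->
  exists2 M, 0 < M & forall z, `|p z| <= M * tpow (1 - sqnorm z) 0.
Proof.
move=> [mp [M pM] p0]; exists (`|M| + 1) => [|z]; first by rewrite ltr_wpDl.
rewrite /tpow subr_gt0; case: ltP => z1; last by rewrite p0// normr0 mulr0.
rewrite powRr0 mulr1; apply: le_trans (pM z) _.
by apply: le_trans (ler_norm _) _; rewrite lerDl.
Qed.

Lemma ball_kernel_integrable p : ball_kernel p -> mu.-integrable setT (EFin \o p).
Proof.
move=> kp; have [M M0 pM] := ball_kernel_bound kp.
have a0 : - 2^-1 <= 0 :> R by lra.
apply: (le_integrable measurableT _ _ (integrableZl measurableT M (integrable_ball n a0))).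
  by case: kp => mp _ _; meas.
move=> x _; rewrite /= lee_fin (le_trans (pM x))// ler_norm//.
Qed.

Lemma ball_kernel_L2 p : ball_kernel p -> L2 p.
Proof.
move=> kp; have [M M0 pM] := ball_kernel_bound kp.
have [mp _ _] := kp; apply/L2P; split=> //.
have kpp : ball_kernel (fun z => p z ^+ 2).
  split; [by meas|exists (M ^+ 2) => z|by case: kp => _ _ h z /h ->; rewrite expr0n].
  rewrite normrX ler_pXn2r ?nnegrE ?(ltW M0)//; apply: le_trans (pM z) _.
  by rewrite ler_piMr ?(ltW M0)// tpow_sqnorm_le1.
have /integrableP[_] := ball_kernel_integrable kpp.
apply: le_lt_trans; rewrite le_eqVlt; apply/orP; left; apply/eqP.
by apply: eq_integral => x _; rewrite /= ger0_norm ?sqr_ge0.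
Qed.

Lemma L2_subv f x : L2 f -> L2 (fun y => f (subv x y)).
Proof.
move=> /L2P[mf hf]; apply/L2P; split.
  by apply: (measurableT_comp mf); meas.
rewrite (integral_subv_signed x (h := fun y => (f y ^+ 2)%:E))//.
by meas.
Qed.

Lemma conv_integrable p g x : L2 p -> L2 g ->
  mu.-integrable setT (EFin \o (fun y => p (subv x y) * g y)).
Proof. by move=> hp hg; apply: L2_integrableM => //; exact: L2_subv. Qed.

Lemma convRn_EFin p g x : L2 p -> L2 g ->
  (convRn p g x)%:E = (\int[mu]_y (p (subv x y) * g y)%:E)%E.
Proof.
move=> hp hg; rewrite convRnE /Rintegral fineK//.
exact: integrable_fin_num (conv_integrable x hp hg).
Qed.

Lemma measurable_convRn p g : measurable_fun setT p -> measurable_fun setT g ->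
  measurable_fun setT (convRn p g).
Proof.
move=> mp mg; pose F (z : Rn R n * Rn R n) := (p (subv z.1 z.2) * g z.2)%:E.
have mF : measurable_fun setT F.
  by rewrite /F; meas.
have -> : convRn p g = (fun x => fine (\int[mu]_y F^\+ (x, y) - \int[mu]_y F^\- (x, y))%E).
  apply/funext => x; rewrite convRnE /Rintegral integralE.
  by congr (fine (_ - _)%E); apply: eq_integral => y _; rewrite ?funeposE ?funenegE.
apply: (measurableT_comp (f := fine)); first exact: fine_measurable.
apply: emeasurable_funB.
  exact: (measurable_fun_fubini_tonelli_F (m2 := mu) _ (measurable_funepos mF) (funepos_ge0 F)).
exact: (measurable_fun_fubini_tonelli_F (m2 := mu) _ (measurable_funeneg mF) (funeneg_ge0 F)).
Qed.

Lemma ball_kernel_mass p : ball_kernel p -> exists2 A, 0 < A &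
  (\int[mu]_z (`|p z|)%:E <= A%:E)%E.
Proof.
move=> kp; have i := ball_kernel_integrable (ball_kernel_normr kp).
exists (fine (\int[mu]_z (`|p z|)%:E)%E + 1).
  by rewrite ltr_wpDl// fine_ge0// integral_ge0.
by rewrite EFinD (fineK (integrable_fin_num measurableT i)) leeDl// lee_fin.
Qed.

(* Cauchy-Schwarz for the weight [|p (x - y)|], from AM-GM with the optimal
   parameter. *)
Lemma convRn_sqr_le p g x A : ball_kernel p -> L2 g -> 0 < A ->
  (\int[mu]_z (`|p z|)%:E <= A%:E)%E ->
  (((convRn (fun z => `|p z|) (fun y => `|g y|) x) ^+ 2)%:E <=
   A%:E * \int[mu]_y (`|p (subv x y)| * (g y) ^+ 2)%:E)%E.
Proof.
move=> kp hg A0 hA; have kp' := ball_kernel_normr kp.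
have [mp _ _] := kp; have mg := L2_meas hg.
have mpx : measurable_fun setT (fun y => p (subv x y)) by apply: (measurableT_comp mp); meas.
have XE := convRn_EFin x (ball_kernel_L2 kp') (L2_normr hg).
set X := convRn _ _ x in XE *.
have X0 : 0 <= X by rewrite -lee_fin XE integral_ge0// => y _; rewrite lee_fin mulr_ge0.
set B := (\int[mu]_y _)%E.
have hA' : (\int[mu]_y (`|p (subv x y)|)%:E <= A%:E)%E.
  rewrite (integral_subv_signed x (h := fun y => (`|p y|)%:E))//; by meas.
pose t := X / A; have t0 : 0 <= t by rewrite divr_ge0 ?(ltW A0).
have key : ((2 * t * X)%:E <= (t ^+ 2 * A)%:E + B)%E.
  have t20 : 0 <= t ^+ 2 by exact: sqr_ge0.
  apply: (@le_trans _ _ ((t ^+ 2)%:E * \int[mu]_y (`|p (subv x y)|)%:E + B)%E); last first.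
    by apply: leeD2r; rewrite (EFinM (t ^+ 2)); apply: lee_wpmul2l.
  rewrite (EFinM (2 * t)) XE -ge0_integralZl_EFin//; [|by meas|by rewrite mulr_ge0].
  rewrite -ge0_integralZl_EFin//; last by meas.
  rewrite /B -ge0_integralD//; [|by move=> y _; rewrite -EFinM lee_fin mulr_ge0
    |by meas|by move=> y _; rewrite lee_fin mulr_ge0// sqr_ge0|by meas].
  apply: ge0_le_integral => //.
  - by move=> y _; rewrite mule_ge0// lee_fin mulr_ge0.
  - by meas.
  - by apply: emeasurable_funD; meas.
  - move=> y _; rewrite -!EFinM -EFinD lee_fin -(@real_normK _ (g y)) ?num_real//.
    have amgm (a b s : R) : 0 <= a -> 2 * s * (a * b) <= s ^+ 2 * a + a * b ^+ 2.
      move=> a0; rewrite -subr_ge0.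
      have -> : s ^+ 2 * a + a * b ^+ 2 - 2 * s * (a * b) = a * (s - b) ^+ 2 by ring.
      by rewrite mulr_ge0// sqr_ge0.
    exact: amgm.
have tA : t * A = X by rewrite /t divfK// gt_eqF.
have B0 : (0 <= B)%E by apply: integral_ge0 => y _; rewrite lee_fin mulr_ge0// sqr_ge0.
move: key B0; case: B => [b| |] //; last by move=> _ _; rewrite gt0_muley ?lte_fin// leey.
rewrite -EFinD -EFinM !lee_fin => key b0; rewrite -tA.
have fin (a s : R) : 0 < a -> 2 * s * (s * a) <= s ^+ 2 * a + b -> (s * a) ^+ 2 <= a * b.
  move=> a0 h; have h' : s ^+ 2 * a <= b.
    have e : 2 * s * (s * a) = s ^+ 2 * a + s ^+ 2 * a by ring.
    by move: h; rewrite e lerD2l.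
  by rewrite exprMn -[a ^+ 2]/(a * a) mulrA mulrC ler_wpM2l// ltW.
by apply: fin => //; rewrite tA.
Qed.

Lemma convRn_le_norm p g x : L2 p -> L2 g ->
  `|convRn p g x| <= convRn (fun z => `|p z|) (fun y => `|g y|) x.
Proof.
move=> hp hg; have i := conv_integrable x hp hg; rewrite !convRnE.
apply: le_trans (le_normr_Rintegral measurableT i) _.
by rewrite le_eqVlt; apply/orP; left; apply/eqP/eq_Rintegral => y _; rewrite normrM.
Qed.

(** Young's inequality for L^1 and L^2: the pointwise bound [convRn_sqr_le] is integrated by
    Tonelli. The version with absolute values also supplies the integrability that Fubini requires
    in [convRn_adjoint] and [convRn_convRn]. *)
Lemma L2_convRn_norm p g : ball_kernel p -> L2 g ->
  L2 (convRn (fun z => `|p z|) (fun y => `|g y|)).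
Proof.
move=> kp hg; have [A A0 hA] := ball_kernel_mass kp.
have mp := ball_kernel_meas kp; have /L2P[mg gy] := hg.
apply/L2P; split; first by apply: measurable_convRn; meas.
pose F (z : Rn R n * Rn R n) := (`|p (subv z.1 z.2)| * g z.2 ^+ 2)%:E.
have mF : measurable_fun setT F by rewrite /F; meas.
have F0 z : (0 <= F z)%E by rewrite lee_fin mulr_ge0 ?sqr_ge0.
have mFF := measurable_fun_fubini_tonelli_F (m2 := mu) F mF F0.
apply: (@le_lt_trans _ _ (A%:E * \int[mu]_x \int[mu]_y F (x, y))%E).
  rewrite -ge0_integralZl_EFin//; [|by move=> x _; exact: integral_ge0|exact: ltW].
  apply: ge0_le_integral => //.
  - by move=> x _; rewrite lee_fin sqr_ge0.
  - have := measurable_convRn (p := fun z => `|p z|) (g := fun y => `|g y|) ltac:(meas) ltac:(meas).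
    by move=> mc; meas.
  - by apply: measurable_funeM.
  - by move=> x _; exact: convRn_sqr_le.
rewrite (fubini_tonelli (m1 := mu) (m2 := mu) F mF F0).
apply: lte_mul_pinfty; rewrite ?lee_fin ?(ltW A0)//.
apply: (@le_lt_trans _ _ (A%:E * \int[mu]_y (g y ^+ 2)%:E)%E); last first.
  by apply: lte_mul_pinfty; rewrite ?lee_fin ?(ltW A0).
rewrite -ge0_integralZl_EFin//; [|by move=> x _; rewrite lee_fin sqr_ge0|by meas|exact: ltW].
apply: ge0_le_integral => //.
- by move=> y _; apply: integral_ge0.
- exact: (measurable_fun_fubini_tonelli_G (m1 := mu) F mF F0).
- by apply: measurable_funeM; meas.
- move=> y _; rewrite /F/=.
  under eq_integral => x _ do rewrite EFinM muleC.
  have mpp : measurable_fun setT (fun x => (`|p x|)%:E) by meas.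
  rewrite ge0_integralZl_EFin ?sqr_ge0//; last by meas.
  rewrite muleC lee_wpmul2r ?lee_fin ?sqr_ge0//.
  by rewrite (integral_subvl y mpp).
Qed.

Lemma L2_convRn p g : ball_kernel p -> L2 g -> L2 (convRn p g).
Proof.
move=> kp hg; have hp := ball_kernel_L2 kp.
apply: L2_dominated (L2_convRn_norm kp hg) _.
  by apply: measurable_convRn; [exact: ball_kernel_meas|exact: L2_meas].
by move=> x; apply: le_trans (convRn_le_norm x hp hg) (ler_norm _).
Qed.

End BallKernelConvolution.

Ltac case_if_lt := match goal with |- context [if (?a < ?b)%R then _ else _] =>
  lazymatch b with context [if _ then _ else _] => fail | _ => case: (ltP a b) => ? end end.

(** * Truncation, adjoints and commutation of convolutions *)

Section Clamp.
Context {R : realType}.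
Implicit Types r s t : R.

(** The bounded multiplier phi of the virial step. Boundedness keeps the product with g in L^2, and
    the Lipschitz constant 1 gives a domination uniform in [r]. *)
Definition clamp r t : R := Num.max (- r) (Num.min t r).

Lemma clamp_lipschitz r s t : `|clamp r s - clamp r t| <= `|s - t|.
Proof.
have h1 := ler_norm (s - t); have h2 := ler_norm (t - s); rewrite distrC in h2.
rewrite ler_norml /clamp /Num.max /Num.min.
by apply/andP; split; repeat case_if_lt; lra.
Qed.

Lemma clamp_le r t : 0 <= r -> `|clamp r t| <= r.
Proof.
move=> r0; rewrite ler_norml /clamp /Num.max /Num.min.
by apply/andP; split; repeat case_if_lt; lra.
Qed.

Lemma clamp_id r t : `|t| <= r -> clamp r t = t.
Proof.
rewrite ler_norml => /andP[h1 h2]; rewrite /clamp min_l// max_r//.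
Qed.

Lemma measurable_clamp r d (T : measurableType d) (f : T -> R) :
  measurable_fun setT f -> measurable_fun setT (fun x => clamp r (f x)).
Proof.
move=> mf; apply: measurable_maxr; first exact: measurable_cst.
by apply: measurable_minr => //; exact: measurable_cst.
Qed.

End Clamp.

Section Virial.
Context {R : realType} {n : nat}.
Local Notation mu := (@lebM R n).
Implicit Types p q f g h : Rn R n -> R.

(** The adjoint of convolution by p is convolution by z |-> p(- z), and this is [e] times p when p
    has parity [e]. *)
Lemma convRn_adjoint p f h e : ball_kernel p ->
  (forall z, p (subv (zerov n) z) = e * p z) -> L2 f -> L2 h ->
  ipL2 (convRn p f) h = e * ipL2 f (convRn p h).
Proof.
move=> kp pe hf hh; have hp := ball_kernel_L2 kp.
have [mp mf mh] := And3 (ball_kernel_meas kp) (L2_meas hf) (L2_meas hh).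
pose F (z : Rn R n * Rn R n) := (p (subv z.1 z.2) * f z.2 * h z.1)%:E.
have mF : measurable_fun setT F by rewrite /F; meas.
have Fy : (\int[mu]_x \int[mu]_y `|F (x, y)| < +oo)%E.
  have := L2_integrableM (L2_convRn_norm kp hf) (L2_normr hh) => /integrableP[_].
  apply: le_lt_trans; rewrite le_eqVlt; apply/orP; left; apply/eqP.
  apply: eq_integral => x _; rewrite /= normrM normr_id EFinM.
  have := convRn_EFin x (L2_normr hp) (L2_normr hf) => E.
  rewrite ger0_norm; last first.
    by rewrite -lee_fin E integral_ge0// => y _; rewrite lee_fin mulr_ge0.
  rewrite E muleC -ge0_integralZl_EFin//; last by meas.
  by apply: eq_integral => y _; rewrite /F /= !normrM -EFinM mulrC.
have inner u v x : L2 u -> L2 v ->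
    ((convRn p u x * v x)%:E = \int[mu]_y (p (subv x y) * u y * v x)%:E)%E.
  move=> hu hv; rewrite EFinM (convRn_EFin x hp hu) muleC.
  rewrite -(integralZl measurableT (conv_integrable x hp hu) (v x)).
  by apply: eq_integral => y _; rewrite -EFinM mulrC.
have hc := L2_convRn kp hf; have hc' := L2_convRn kp hh.
apply: (@EFin_inj R); rewrite EFinM /ipL2 /Rintegral.
rewrite !fineK; try by apply: (integrable_fin_num measurableT); exact: L2_integrableM.
transitivity (\int[mu]_x \int[mu]_y F (x, y))%E.
  by apply: eq_integral => x _; rewrite inner.
rewrite (fubini_lty mF Fy) -(integralZl measurableT (L2_integrableM hf hc') e).
apply: eq_integral => y _.
have ih := integrableZl measurableT (f y) (conv_integrable y hp hh).
rewrite /= [f y * _]mulrC inner//.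
have -> : (\int[mu]_x (p (subv y x) * h x * f y)%:E =
    \int[mu]_x ((f y)%:E * (EFin \o (fun x => p (subv y x) * h x)%R) x))%E.
  by apply: eq_integral => x _; rewrite /= -EFinM mulrC.
rewrite -(integralZl measurableT ih e).
apply: eq_integral => x _; rewrite /F/= -EFinM -(subvN y x) pe.
by move: (p _) (f y) (h x) => a b c; congr EFin; ring.
Qed.

Lemma convRn_convRn p q g x : ball_kernel p -> ball_kernel q -> L2 g ->
  ((convRn p (convRn q g) x)%:E =
   \int[mu]_w \int[mu]_y (p (subv x y) * q (subv y w) * g w)%:E)%E.
Proof.
move=> kp kq hg; have hp := ball_kernel_L2 kp; have hq := ball_kernel_L2 kq.
have [mp mq mg] := And3 (ball_kernel_meas kp) (ball_kernel_meas kq) (L2_meas hg).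
pose F (z : Rn R n * Rn R n) := (p (subv x z.1) * q (subv z.1 z.2) * g z.2)%:E.
have mF : measurable_fun setT F by rewrite /F; meas.
have Fy : (\int[mu]_y \int[mu]_w `|F (y, w)| < +oo)%E.
  have := conv_integrable x (L2_normr hp) (L2_convRn_norm kq hg) => /integrableP[_].
  apply: le_lt_trans; rewrite le_eqVlt; apply/orP; left; apply/eqP.
  apply: eq_integral => y _; rewrite /= normrM normr_id EFinM.
  have := convRn_EFin y (L2_normr hq) (L2_normr hg) => E.
  rewrite [X in (_ = _ * X%:E)%E]ger0_norm; last first.
    by rewrite -lee_fin E integral_ge0// => w _; rewrite lee_fin mulr_ge0.
  rewrite E -ge0_integralZl_EFin//; last by meas.
  by apply: eq_integral => w _; rewrite /F /= !normrM -EFinM mulrA.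
rewrite (convRn_EFin x hp (L2_convRn kq hg)) -(fubini_lty mF Fy).
apply: eq_integral => y _; rewrite EFinM (convRn_EFin y hq hg).
rewrite -(integralZl measurableT (conv_integrable y hq hg) (p (subv x y))).
by apply: eq_integral => w _; rewrite /F/= -EFinM mulrA.
Qed.

(** In the iterated integrals, the reflection [swapv] of the inner variable exchanges the arguments
    of [p] and [q]. *)
Lemma convRnC p q g x : ball_kernel p -> ball_kernel q -> L2 g ->
  convRn p (convRn q g) x = convRn q (convRn p g) x.
Proof.
move=> kp kq hg; have [mp mq] := (ball_kernel_meas kp, ball_kernel_meas kq).
apply: (@EFin_inj R); rewrite (convRn_convRn x kp kq hg).
rewrite (convRn_convRn x kq kp hg); apply: eq_integral => w _.
have mh : measurable_fun setT (fun y => (p (subv x y) * q (subv y w) * g w)%:E) by meas.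
rewrite -(integral_subv_signed (subv x (subv (zerov n) w)) mh).
apply: eq_integral => y _; rewrite -/(swapv x w y) subv_swapv swapv_subv.
by rewrite [p _ * _]mulrC.
Qed.

Lemma convRn_ae0 q f x : L2 q -> measurable_fun setT f -> {ae mu, forall y, f y = 0} ->
  convRn q f x = 0.
Proof.
move=> hq mf [N [mN N0 NP]]; have mq := L2_meas hq; rewrite convRnE /Rintegral.
rewrite (ae_eq_integral (cst 0%E)) ?integral0//; first by meas.
exists N; split=> // y h; apply: NP => fy0; apply: h => _.
by rewrite /= fy0 mulr0.
Qed.

End Virial.

(** * The virial argument *)

Section VirialStep.
Context {R : realType} {n : nat}.
Local Notation mu := (@lebM R n).
Implicit Types p q f g h : Rn R n -> R.

(* [phi (lam x) - phi (lam y)] against [p (x - y)], for bounded [phi], gives a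
   function orthogonal to [convRn (lam * p) g]; let [phi] tend to the identity. *)
Lemma convRn_virial p g (lam : Rn R n -> R) e : ball_kernel p ->
  (forall z, p (subv (zerov n) z) = e * p z) ->
  measurable_fun setT lam -> (forall x y, lam (subv x y) = lam x - lam y) ->
  (forall z, sqnorm z < 1 -> `|lam z| <= 1) ->
  L2 g -> {ae mu, forall x, convRn p g x = 0} ->
  {ae mu, forall x, convRn (fun z => lam z * p z) g x = 0}.
Proof.
move=> kp pe mlam lamB lam1 hg ae0; pose q z := lam z * p z.
have [mp [M pM] p0] := kp; have mg := L2_meas hg.
have kq : ball_kernel q.
  split; [by rewrite /q; meas|exists M => z|by move=> z /p0 h; rewrite /q h mulr0].
  have [z1|z1] := ltP (sqnorm z) 1; last by rewrite /q p0// mulr0 normr0 (le_trans _ (pM z)).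
  by rewrite normrM (le_trans _ (pM z))// ler_piMl// lam1.
have [hp hq] := (ball_kernel_L2 kp, ball_kernel_L2 kq).
have hSp := L2_convRn kp hg; have hSq := L2_convRn kq hg.
have mSq := L2_meas hSq.
pose f (k : nat) y := clamp k%:R (lam y) * g y.
have mc k : measurable_fun setT (fun y => clamp k%:R (lam y) : R) by exact: measurable_clamp.
have hf k : L2 (f k).
  have mck := mc k; apply: (L2_dominated _ (L2Z k%:R hg)); first by rewrite /f; meas.
  by move=> y; rewrite !normrM ler_wpM2r// normr_nat clamp_le.
have orth k : ipL2 (convRn p (f k)) (convRn q g) = 0.
  rewrite (convRn_adjoint kp pe (hf k) hSq) /ipL2.
  have -> : (fun y => f k y * convRn p (convRn q g) y) = (fun=> 0).
    apply/funext => y; rewrite (convRnC y kp kq hg) (convRn_ae0 y hq (L2_meas hSp) ae0).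
    by rewrite mulr0.
  by rewrite /Rintegral integral0 mulr0.
have [N [mN N0 NP]] := ae0.
pose B := convRn (fun z => `|q z|) (fun y => `|g y|).
have hB : L2 B := L2_convRn_norm kq hg.
have B0 x : 0 <= B x.
  rewrite -lee_fin (convRn_EFin x (L2_normr hq) (L2_normr hg)).
  by apply: integral_ge0 => y _; rewrite lee_fin mulr_ge0.
(* Where p * g vanishes, the term with [clamp k%:R (lam x)] integrates to 0 and - (p * f k) remains.
   The Lipschitz bound dominates [F] by |q(x - y) g(y)| for all k, and for large k [F] equals q(x -
   y) g(y). *)
pose F x k y := (clamp k%:R (lam x) - clamp k%:R (lam y)) * (p (subv x y) * g y).
have FE x k : ~ N x -> (\int[mu]_y (F x k y)%:E = (- convRn p (f k) x)%:E)%E.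
  move=> Nx; have Sx : convRn p g x = 0 by apply: contrapT => h; exact/Nx/NP.
  have i1 := integrableZl measurableT (clamp k%:R (lam x)) (conv_integrable x hp hg).
  have i2 := conv_integrable x hp (hf k).
  have -> : (fun y => (F x k y)%:E) = (fun y =>
    ((clamp k%:R (lam x))%:E * (EFin \o (fun y => p (subv x y) * g y)%R) y)%E -
      (EFin \o (fun y => p (subv x y) * f k y)%R) y)%E.
    by apply/funext => y; rewrite /= -EFinM -EFinB; congr EFin; rewrite /F /f; ring.
  rewrite (integralB measurableT i1 i2) (integralZl measurableT (conv_integrable x hp hg)).
  rewrite /= -(convRn_EFin x hp hg) -(convRn_EFin x hp (hf k)) Sx.
  by rewrite mule0 sub0e EFinN.
have FB x k y : `|F x k y| <= `|q (subv x y)| * `|g y|.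
  by rewrite !normrM mulrA ler_wpM2r// ler_wpM2r// lamB clamp_lipschitz.
have mF x k : measurable_fun setT (fun y => F x k y).
  by have mck := mc k; rewrite /F; meas.
have conv x : ~ N x -> (- convRn p (f k) x)%:E @[k --> \oo] --> (convRn q g x)%:E.
  move=> Nx; rewrite (convRn_EFin x hq hg).
  have -> : (fun k => (- convRn p (f k) x)%:E) = (fun k => \int[mu]_y (F x k y)%:E)%E.
    by apply/funext => k; rewrite FE.
  have ib := conv_integrable x (L2_normr hq) (L2_normr hg).
  have [] := @dominated_convergence _ _ _ mu setT measurableT
    (fun k y => (F x k y)%:E) (fun y => (q (subv x y) * g y)%:E) _ _ _ _ ib _ => //.
  - by move=> k; have mFk := mF x k; meas.
  - by have mq := ball_kernel_meas kq; meas.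
  - apply: aeW => y _; apply: cvg_EFin; first exact: nearW.
    apply: cvg_near_cst; near=> k.
    rewrite /= /F /q lamB !clamp_id; first by rewrite mulrA.
      by near: k; exact: nbhs_infty_ger.
    by near: k; exact: nbhs_infty_ger.
  - by apply: aeW => y k _; rewrite lee_fin FB.
have bd x k : ~ N x -> `|convRn p (f k) x| <= B x.
  move=> Nx; rewrite -normrN -lee_fin.
  rewrite (convRn_EFin x (L2_normr hq) (L2_normr hg)).
  rewrite -[leLHS]/(`|(- convRn p (f k) x)%:E|%E) -FE//.
  apply: le_trans (le_abse_integral _ _ _) _ => //.
    by have mFk := mF x k; meas.
  apply: ge0_le_integral => //.
  - by have mFk := mF x k; rewrite (_ : (fun y => _) = (fun y => `|F x k y|%:E))//; meas.
  - by have mq := ball_kernel_meas kq; meas.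
  - by move=> y _; rewrite lee_fin FB.
(* In the limit the relations [orth] say that q * g is orthogonal to itself. The square of [B]
   dominates, by [bd]. *)
apply: (ipL2_eq0 hSq).
have ib := L2_integrableM hB hB.
have [] := @dominated_convergence _ _ _ mu setT measurableT
    (fun k x => (- convRn p (f k) x * convRn q g x)%:E)
    (fun x => (convRn q g x * convRn q g x)%:E) _ _ _ _ ib _ => //.
- move=> k; have mck := measurable_convRn mp (L2_meas (hf k)); meas.
- by meas.
- exists N; split=> // x /= h; apply: contrapT => Nx; apply: h => _.
  have := conv x Nx => /fine_cvgP[_] c.
  apply: cvg_EFin; first exact: nearW.
  by apply: cvgM; [exact: c|exact: cvg_cst].
- exists N; split=> // x /= h; apply: contrapT => Nx; apply: h => k _.
  rewrite lee_fin normrM normrN; apply: ler_pM => //; first exact: bd.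
  exact: convRn_le_norm.
move=> _ _; rewrite /ipL2 /Rintegral.
have -> : [sequence (\int[mu]_x (- convRn p (f k) x * convRn q g x)%:E)%E]_k = (fun=> 0%E).
  apply/funext => k; have i := L2_integrableM (L2_convRn kp (hf k)) hSq.
  have o := orth k; rewrite /ipL2 /Rintegral in o.
  have I0 : (\int[mu]_x (EFin \o (fun x => convRn p (f k) x * convRn q g x)%R) x = 0)%E.
    exact: etrans (esym (fineK (integrable_fin_num measurableT i))) (congr1 EFin o).
  have Z := integralZl measurableT i (-1); rewrite I0 mule0 in Z.
  rewrite -[RHS]Z; apply: eq_integral => x _.
  by rewrite /= -EFinM mulN1r mulNr.
by move=> /cvg_lim <-//; rewrite lim_cst.
Unshelve. all: by end_near. Qed.

End VirialStep.

(** * Moments *)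

Section Moments.
Context {R : realType}.

(** An index past the end reads the last coordinate, so that every list of natural numbers denotes a
    monomial. *)
Fixpoint coord (n i : nat) : Rn R n -> R :=
  match n return Rn R n -> R with
  | 0 => fun z => z
  | n'.+1 => fun z => if i is i'.+1 then coord i' z.2 else z.1
  end.

(** A monomial, encoded by the list of its factors: one more virial step is one more list element,
    and lists are countable, which lets all moments be treated off a single null set. *)
Definition mom n (s : seq nat) (z : Rn R n) : R := \prod_(i <- s) coord i z.

Lemma coordB n i (x y : Rn R n) : coord i (subv x y) = coord i x - coord i y.
Proof. by elim: n i x y => [//|n IH] [|i] [a x] [b y] //=. Qed.

Lemma measurable_coord n i d (T : measurableType d) (f : T -> Rn R n) :
  measurable_fun setT f -> measurable_fun setT (fun z => coord i (f z)).
Proof.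
elim: n i f => [//|n IH] [|i] f mf /=; first exact: measurable_fst_comp.
by apply: IH; exact: measurable_snd_comp.
Qed.

Lemma coord_sqr_le n i (z : Rn R n) : coord i z ^+ 2 <= sqnorm z.
Proof.
elim: n i z => [//|n IH] [|i] [a z] /=; first by rewrite lerDl sqnorm_ge0.
by apply: le_trans (IH i z) _; rewrite lerDr sqr_ge0.
Qed.

Lemma coord_le1 n i (z : Rn R n) : sqnorm z < 1 -> `|coord i z| <= 1.
Proof.
move=> z1; rewrite -(ler_pXn2r (ltn0Sn 1)) ?nnegrE// expr1n real_normK ?num_real//.
exact: le_trans (coord_sqr_le i z) (ltW z1).
Qed.

Lemma coordN n i (z : Rn R n) : coord i (subv (zerov n) z) = - coord i z.
Proof. by rewrite coordB -(subvv z) coordB subrr sub0r. Qed.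

Lemma mom_cons n i s (z : Rn R n) : mom (i :: s) z = coord i z * mom s z.
Proof. by rewrite /mom big_cons. Qed.

Lemma mom_nil n (z : Rn R n) : mom [::] z = 1.
Proof. by rewrite /mom big_nil. Qed.

Lemma momN n s (z : Rn R n) : mom s (subv (zerov n) z) = (-1) ^+ size s * mom s z.
Proof.
elim: s => [|i s IH]; first by rewrite !mom_nil mulr1.
by rewrite !mom_cons IH coordN /= exprS !mulN1r !mulNr mulrCA.
Qed.

Lemma mom_le1 n s (z : Rn R n) : sqnorm z < 1 -> `|mom s z| <= 1.
Proof.
move=> z1; elim: s => [|i s IH]; first by rewrite mom_nil normr1.
by rewrite mom_cons normrM mulr_ile1// coord_le1.
Qed.

Lemma measurable_mom n s d (T : measurableType d) (f : T -> Rn R n) :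
  measurable_fun setT f -> measurable_fun setT (fun z => mom s (f z)).
Proof.
move=> mf; elim: s => [|i s IH].
  have -> : (fun z => mom [::] (f z)) = cst 1 by apply/funext => z; rewrite mom_nil.
  exact: measurable_cst.
have -> : (fun z => mom (i :: s) (f z)) = (fun z => coord i (f z) * mom s (f z)).
  by apply/funext => z; rewrite mom_cons.
by apply: measurable_funM => //; exact: measurable_coord.
Qed.

Lemma mom_nseq0 j (z : Rn R 0) : mom (nseq j 0%N) z = z ^+ j.
Proof. by rewrite /mom big_nseq; elim: j => [//|j IH]; rewrite iterS IH exprS. Qed.

Lemma mom_pair n j s (z : Rn R n.+1) :
  mom (nseq j 0%N ++ map S s) z = z.1 ^+ j * mom s z.2.
Proof.
rewrite /mom big_cat big_map big_nseq; congr (_ * _).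
by elim: j => [//|j IH]; rewrite iterS IH exprS.
Qed.

Lemma convRn_moments n p (g : Rn R n -> R) e : ball_kernel p ->
  (forall z, p (subv (zerov n) z) = e * p z) -> L2 g ->
  {ae lebM n, forall x, convRn p g x = 0} -> forall s,
  ball_kernel (fun z => mom s z * p z) /\
  {ae lebM n, forall x, convRn (fun z => mom s z * p z) g x = 0}.
Proof.
move=> kp pe hg ae0; elim=> [|i s [ks IH]].
  by have -> : (fun z => mom [::] z * p z) = p by apply/funext => z; rewrite mom_nil mul1r.
have -> : (fun z => mom (i :: s) z * p z) = (fun z => coord i z * (mom s z * p z)).
  by apply/funext => z; rewrite mom_cons mulrA.
have mc : measurable_fun setT (fun z : Rn R n => coord i z) by exact: measurable_coord.
split.
  have [ms [M sM] s0] := ks; split; [by meas|exists M => z|by move=> z /s0 ->; rewrite mulr0].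
  have [z1|z1] := ltP (sqnorm z) 1; last by rewrite s0// mulr0 normr0 (le_trans _ (sM z)).
  by rewrite normrM (le_trans _ (sM z))// ler_piMl// coord_le1.
apply: (convRn_virial (e := (-1) ^+ size s * e) ks) => //.
- by move=> z; rewrite momN pe; ring.
- exact: coordB.
- exact: coord_le1.
Qed.

End Moments.

(** * Polynomial approximation of a step *)

Section PolynomialStep.
Context {R : realType}.
Implicit Types t y : R.

Lemma bernoulli_sub t N : 0 <= t <= 1 -> 1 - N%:R * t <= (1 - t) ^+ N.
Proof.
move=> /andP[t0 t1]; elim: N => [|N IH]; first by rewrite mul0r subr0.
rewrite exprS -natr1; have h : 0 <= 1 - t by rewrite subr_ge0.
apply: le_trans (ler_wpM2l h IH).
rewrite -subr_ge0; have -> : (1 - t) * (1 - N%:R * t) - (1 - (N%:R + 1) * t) = N%:R * t ^+ 2.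
  by ring.
by rewrite mulr_ge0// sqr_ge0.
Qed.

Lemma bernoulli_inv t N : 0 <= t <= 1 -> (1 - t) ^+ N * (1 + N%:R * t) <= 1.
Proof.
move=> /andP[t0 t1]; elim: N => [|N IH]; first by rewrite mul0r addr0 mulr1.
apply: le_trans IH; rewrite exprSr -mulrA ler_wpM2l//; first by rewrite exprn_ge0// subr_ge0.
rewrite -natr1 -subr_ge0.
have -> : 1 + N%:R * t - (1 - t) * (1 + (N%:R + 1) * t) = (N%:R + 1) * t ^+ 2 by ring.
by rewrite mulr_ge0 ?sqr_ge0// addr_ge0.
Qed.

(* On [0, 1] these polynomials tend boundedly to the indicator of [0, 1/2). *)
Definition stepf (k : nat) (y : R) : R := (1 - y ^+ k) ^+ (2 ^ k).

Lemma stepf_itv k y : 0 <= y <= 1 -> 0 <= stepf k y <= 1.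
Proof.
move=> /andP[y0 y1]; have h0 : 0 <= y ^+ k by exact: exprn_ge0.
have h1 : y ^+ k <= 1 by exact: exprn_ile1.
by rewrite /stepf exprn_ge0 ?exprn_ile1//; lra.
Qed.

(** The exponent 2^k places the threshold at 1/2: [bernoulli_sub] bounds the value below by 1 - (2
    y)^k, and above the threshold [bernoulli_inv] bounds it by (2 y)^(-k). *)
Lemma stepf_cvg1 y : 0 <= y -> y < 2^-1 -> stepf k y @[k --> \oo] --> (1 : R).
Proof.
move=> y0 y2; have y01 : 0 <= y <= 1 by apply/andP; split; lra.
apply: (@squeeze_cvgr _ _ _ _ (fun k => 1 - (2 * y) ^+ k) (fun=> 1)); last 2 first.
- rewrite -[X in _ --> X]subr0; apply: cvgB; first exact: cvg_cst.
  by apply: cvg_expr; rewrite ger0_norm; lra.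
- exact: cvg_cst.
apply: nearW => k; have /andP[_ ->] := stepf_itv k y01; rewrite andbT exprMn -natrX.
apply: bernoulli_sub; rewrite exprn_ge0 ?exprn_ile1//; lra.
Qed.

Lemma stepf_cvg0 y : y <= 1 -> 2^-1 < y -> stepf k y @[k --> \oo] --> (0 : R).
Proof.
move=> y1 y2; have y01 : 0 <= y <= 1 by apply/andP; split; lra.
have y2p : 0 < 2 * y by lra.
apply: (@squeeze_cvgr _ _ _ _ (fun=> 0) (fun k => ((2 * y)^-1) ^+ k)); last 2 first.
- exact: cvg_cst.
- by apply: cvg_expr; rewrite ger0_norm ?invr_ge0 ?invf_lt1//; lra.
apply: nearW => k; have /andP[s0 s1] := stepf_itv k y01; rewrite s0 /= exprVn.
rewrite -[leRHS]mul1r ler_pdivlMr ?exprn_gt0//.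
have yk : 0 <= y ^+ k <= 1 by rewrite exprn_ge0 ?exprn_ile1//; lra.
apply: le_trans (bernoulli_inv (2 ^ k) yk).
rewrite -/(stepf k y) ler_wpM2l// exprMn natrX; lra.
Qed.

End PolynomialStep.

(** * Determinacy by moments *)

Section MomentDeterminacy.
Context {R : realType}.
Local Notation leb := (@lebesgue_measure R).
Local Notation RR := (measurableTypeR R).

Lemma moments_poly (u : RR -> R) :
  (forall j, leb.-integrable setT (EFin \o (fun x => x ^+ j * u x))) ->
  (forall j, (\int[leb]_x (x ^+ j * u x))%R = 0) -> forall q : {poly R},
  leb.-integrable setT (EFin \o (fun x => q.[x] * u x)) /\
  (\int[leb]_x (q.[x] * u x))%R = 0.
Proof.
move=> iu u0 q.
(* The additional power x^j lets the induction on [q] absorb each new factor ['X]. *)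
suff H j : leb.-integrable setT (EFin \o (fun x => q.[x] * (x ^+ j * u x))) /\
    (\int[leb]_x (q.[x] * (x ^+ j * u x)))%R = 0.
  by have := H 0%N; have -> : (fun x => q.[x] * (x ^+ 0 * u x)) = (fun x => q.[x] * u x)
    by apply/funext => x; rewrite mul1r.
elim/poly_ind: q j => [|q c IH] j.
  have -> : (fun x : RR => (0 : {poly R}).[x] * (x ^+ j * u x)) = (fun=> 0).
    by apply/funext => x; rewrite horner0 mul0r.
  split; first exact: integrable0.
  by rewrite /Rintegral integral0.
have -> : (fun x : RR => (q * 'X + c%:P).[x] * (x ^+ j * u x)) =
    (fun x => q.[x] * (x ^+ j.+1 * u x) + c * (x ^+ j * u x)).
  by apply/funext => x; rewrite hornerMXaddC exprS; ring.
have [i1 e1] := IH j.+1; have i2 := integrableZl measurableT c (iu j).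
split; first by have := integrableD measurableT i1 i2.
by rewrite RintegralD// e1 add0r RintegralZl// u0 mulr0.
Qed.

(** Composed with an affine map, the polynomials [stepf] tend boundedly on [-1, 1] to the indicator
    of ]-oo, c], so all integrals of u over such half-lines vanish; Lebesgue differentiation then
    gives u = 0. *)
Lemma moment_determinacy1 (u : RR -> R) :
  leb.-integrable setT (EFin \o u) -> (forall x : R, 1 <= x ^+ 2 -> u x = 0) ->
  (forall j, (\int[leb]_x (x ^+ j * u x))%R = 0) -> {ae leb, forall x, u x = 0}.
Proof.
move=> iu supp mom0.
have mu : measurable_fun setT u by have /measurable_EFinP := measurable_int _ iu.
have x1 x : u x != 0 -> `|x| <= 1.
  move=> ux; rewrite leNgt; apply: contraNN ux => x1; apply/eqP/supp.
  by rewrite -real_normK ?num_real// exprn_ege1// ltW.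
have iuj j : leb.-integrable setT (EFin \o (fun x => x ^+ j * u x)).
  apply: (le_integrable measurableT _ _ iu); first by meas.
  move=> x _; rewrite /= lee_fin normrM; have [->|/x1 h] := eqVneq (u x) 0.
    by rewrite normr0 mulr0.
  by rewrite ler_piMl// normrX exprn_ile1.
have cum (c : R) : (\int[leb]_(x in `]-oo, c]) (u x)%:E = 0)%E.
  (* As |x - c| <= 1 + |c| on [-1, 1], this slope makes the map [y] below send [-1, 1] into [0, 1]
     and c to 1/2. The slope is positive, so small x are the points where [stepf] tends to 1. *)
  pose a : R := (2 * (1 + `|c|))^-1.
  have a0 : 0 < a by rewrite invr_gt0 mulr_gt0// ltr_pwDl.
  pose y (x : R) : R := a * (x - c) + 2^-1.
  pose q k : {poly R} := (1 - (a *: ('X - c%:P) + (2^-1)%:P) ^+ k) ^+ (2 ^ k).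
  have qE k x : (q k).[x] = stepf k (y x).
    by rewrite /q /stepf /y !hornerE.
  have y01 x : u x != 0 -> 0 <= y x <= 1.
    move=> /x1 h; have hxc : `|x - c| <= 1 + `|c|.
      by apply: le_trans (ler_normB _ _) _; rewrite lerD2r.
    have : `|a * (x - c)| <= 2^-1.
      rewrite normrM (gtr0_norm a0) /a invfM -mulrA ler_piMr ?invr_ge0//.
      by rewrite mulrC ler_pdivrMr ?mul1r// ltr_pwDl.
    by rewrite ler_norml /y => /andP[h1 h2]; apply/andP; split; lra.
  have qi k := (moments_poly iuj mom0 (q k)).1.
  have q0 k := (moments_poly iuj mom0 (q k)).2.
  have Qb k x : `|(q k).[x] * u x| <= `|u x|.
    rewrite normrM; have [->|/y01 h] := eqVneq (u x) 0; first by rewrite normr0 mulr0.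
    rewrite ler_piMl// qE; have /andP[s0 s1] := stepf_itv k h.
    by rewrite ger0_norm.
  rewrite integral_mkcond.
  have [] := @dominated_convergence _ _ _ leb setT measurableT
    (fun k x => ((q k).[x] * u x)%:E) ((fun x => (u x)%:E) \_ `]-oo, c])
    (fun x => `|u x|%:E) _ _ _ _ _ => //.
  - by move=> k; exact: measurable_int (qi k).
  - by apply/(measurable_restrictT _ _).1 => //; apply: measurable_funTS; meas.
  (* The threshold 1/2 is left out of the two limits of [stepf]; it is met only at x = c, a null
     set. *)
  - exists [set c]; split; [exact: measurable_set1|exact: lebesgue_measure_set1|].
    move=> x /=; apply: contra_notP => /eqP xc _.
    have [u0|/y01/andP[y0 y1]] := eqVneq (u x) 0.
      have -> : ((fun x => (u x)%:E) \_ `]-oo, c]) x = 0%E by rewrite /patch u0; case: ifP.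
      by apply: cvg_near_cst; apply: nearW => k; rewrite u0 mulr0.
    rewrite /patch mem_setE in_itv/=; case: (ltP x c) => xc'.
      rewrite (ltW xc'); apply: cvg_EFin; first exact: nearW.
      rewrite -[X in _ --> X]mul1r; apply: cvgM; last exact: cvg_cst.
      rewrite (_ : (fun k => (q k).[x]) = stepf^~ (y x)); last by apply/funext => k; rewrite qE.
      apply: stepf_cvg1 => //; rewrite /y gtrDr.
      by rewrite pmulr_rlt0// subr_lt0.
    have {}xc : c < x by rewrite lt_neqAle eq_sym xc.
    rewrite leNgt xc /=; apply: cvg_EFin; first exact: nearW.
    rewrite -[X in _ --> X](mul0r (u x)); apply: cvgM; last exact: cvg_cst.
    rewrite (_ : (fun k => (q k).[x]) = stepf^~ (y x)); last by apply/funext => k; rewrite qE.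
    apply: stepf_cvg0 => //; rewrite /y ltrDr.
    by rewrite pmulr_rgt0// subr_gt0.
  - exact: integrable_norm iu.
  - by apply: aeW => x k _; rewrite lee_fin Qb.
  move=> _ _.
  rewrite (_ : [sequence _]_k = (fun=> 0%E)); last first.
    apply/funext => k; have q0k := q0 k; rewrite /Rintegral in q0k.
    exact: etrans (esym (fineK (integrable_fin_num measurableT (qi k)))) (congr1 EFin q0k).
  by move=> /cvg_lim <-//; rewrite lim_cst.
have iuy (y : R) : leb.-integrable `]-oo, y] (EFin \o u) by exact: integrableS iu.
have locu : locally_integrable [set: R] u.
  by apply: open_integrable_locally; [exact: openT|exact: iu].
have [N [mN N0 NP]] := FTC1Ny iuy locu.
exists N; split=> // x /= ux; apply: NP => /= -[_ h]; apply: ux.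
rewrite -h; have -> : (fun y => (\int[leb]_(t in `]-oo, y]) u t)%R) = cst 0.
  by apply/funext => y; rewrite /Rintegral cum.
by rewrite derive1_cst.
Qed.

End MomentDeterminacy.

Section MultivariateMoments.
Context {R : realType}.
Local Notation leb := (@lebesgue_measure R).
Local Notation RR := (measurableTypeR R).

Lemma integrable_fine d (T : measurableType d) (mu : {measure set T -> \bar R})
    (F : T -> \bar R) :
  mu.-integrable setT F -> mu.-integrable setT (EFin \o (fun x => fine (F x))).
Proof.
move=> iF; have mF := measurable_int _ iF.
apply: (le_integrable measurableT _ _ iF).
  by apply/measurable_EFinP; apply: (measurableT_comp (f := fine)) => //; exact: fine_measurable.
by move=> x _; rewrite /=; case: (F x) => [r| |] //=; rewrite normr0 leey.
Qed.

Lemma integrable_supp n (u v : Rn R n -> R) : measurable_fun setT v ->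
  (lebM n).-integrable setT (EFin \o u) ->
  (forall z, 1 <= sqnorm z -> u z = 0) -> (forall z, sqnorm z < 1 -> `|v z| <= 1) ->
  (lebM n).-integrable setT (EFin \o (fun z => v z * u z)).
Proof.
move=> mv iu supp v1; apply: (le_integrable measurableT _ _ iu).
  by have /measurable_EFinP mu := measurable_int _ iu; meas.
move=> z _; rewrite /= lee_fin normrM.
have [z1|z1] := ltP (sqnorm z) 1; last by rewrite supp// normr0 mulr0.
by rewrite ler_piMl// v1.
Qed.

(** For a fixed monomial [s] in the last variables, the partial moment of [u] is a function of the
    first variable all of whose moments vanish, so it is 0 almost everywhere by the one-dimensional
    case. The induction hypothesis then applies to almost every slice of [u]. *)
Lemma moment_determinacy n (u : Rn R n -> R) :
  (lebM n).-integrable setT (EFin \o u) -> (forall z, 1 <= sqnorm z -> u z = 0) ->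
  (forall s, (\int[lebM n]_z (mom s z * u z))%R = 0) -> {ae lebM n, forall z, u z = 0}.
Proof.
elim: n u => [|n IH] u iu supp mom0.
  apply: (moment_determinacy1 iu supp) => j; rewrite -(mom0 (nseq j 0%N)).
  by apply: eq_Rintegral => x _; rewrite mom_nseq0.
pose v s (z : Rn R n.+1) := mom s z.2 * u z.
have mm s : measurable_fun setT (fun z : Rn R n => mom s z) by exact: measurable_mom.
have le_sq (z : Rn R n.+1) : sqnorm z < 1 -> sqnorm z.2 < 1 /\ `|z.1| <= 1.
  move=> z1; split; last by rewrite -[z.1]/(@coord R n.+1 0%N z); exact: coord_le1.
  by apply: le_lt_trans z1; rewrite /= lerDr sqr_ge0.
have iv s : (leb \x lebM n)%E.-integrable setT (EFin \o v s).
  apply: (integrable_supp (v := fun z : Rn R n.+1 => mom s z.2) _ iu supp).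
    by apply: measurable_mom; exact: measurable_snd.
  by move=> z /le_sq[h _]; exact: mom_le1.
have iw j s : (leb \x lebM n)%E.-integrable setT (EFin \o (fun z : Rn R n.+1 => z.1 ^+ j * v s z)).
  have -> : (fun z => z.1 ^+ j * v s z) = (fun z => (z.1 ^+ j * mom s z.2) * u z).
    by apply/funext => z; rewrite /v mulrA.
  apply: (integrable_supp (v := fun z : Rn R n.+1 => z.1 ^+ j * mom s z.2) _ iu supp).
    apply: measurable_funM; first by meas.
    by apply: measurable_mom; exact: measurable_snd.
  move=> z /le_sq[h1 h2]; rewrite normrM mulr_ile1// ?mom_le1//.
  by rewrite normrX exprn_ile1.
pose F s (x : RR) := (\int[lebM n]_y (v s (x, y))%:E)%E.
have iF s : leb.-integrable setT (F s) := integrable_fubini_F (iv s).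
have U0 s : {ae leb, forall x, fine (F s x) = 0}.
  apply: (moment_determinacy1 (integrable_fine (iF s))).
    move=> x x1; rewrite /F (eq_integral (cst 0%E)) ?integral0// => y _.
    by rewrite /v supp ?mulr0// (le_trans x1)//= lerDl sqnorm_ge0.
  move=> j; rewrite -(mom0 (nseq j 0%N ++ map S s)) /Rintegral; congr fine.
  transitivity (\int[leb]_x fubini_F (lebM n) (EFin \o (fun z : Rn R n.+1 => z.1 ^+ j * v s z)%R) x)%E.
    apply: ae_eq_integral => //.
    - by have /measurable_EFinP mF := measurable_int _ (integrable_fine (iF s)); meas.
    - exact: measurable_int (integrable_fubini_F (iw j s)).
    - apply: filterS (ae_integrable1 (iv s)) => x ix _.
      rewrite EFinM /F fineK; last exact: (integrable_fin_num measurableT ix).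
      exact: esym (integralZl measurableT ix (x ^+ j)).
  rewrite (integral12_prod_meas1 (iw j s)).
  by apply: eq_integral => z _; rewrite /= mom_pair /v mulrA.
(* Enumerating the lists [s] merges the countably many null sets into one. *)
have Uall : {ae leb, forall x, forall k,
    fine (F (odflt [::] (unpickle k)) x) = 0}.
  by apply: ae_foralln => k; exact: U0.
have iu' : (leb \x lebM n)%E.-integrable setT (EFin \o u) := iu.
have zero : {ae leb, forall x, (\int[lebM n]_y `|(u (x, y))%:E| = 0)%E}.
  apply: filterS2 (ae_integrable1 iu') Uall => x ix Ux.
  apply/(ae_eq_integral_abs (lebM n) measurableT (measurable_int _ ix)).
  apply: filterS (IH (fun y => u (x, y)) ix _ _) => [y /= -> //|y y1|s].
    by apply: supp; rewrite (le_trans y1)//= lerDr sqr_ge0.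
  by have := Ux (pickle s); rewrite pickleK.
have mu := measurable_int _ iu.
have /(ae_eq_integral_abs (lebM n.+1) measurableT mu) :
    (\int[lebM n.+1]_z `|(EFin \o u) z| = 0)%E.
  have mau : measurable_fun setT (fun z : RR * Rn R n => `|(u z)%:E|%E).
    by apply: measurableT_comp mu.
  rewrite (integral_lebMS mau) ?(fubini_tonelli1)//.
  rewrite (ae_eq_integral (cst 0%E)) ?integral0//.
    exact: (measurable_fun_fubini_tonelli_F (m2 := lebM n) _ mau).
  by apply: filterS zero => x h _.
by apply: filterS => z /(_ I) /= [].
Qed.

End MultivariateMoments.

(** * Injectivity of the convolution operator *)

Section ConvolutionInjective.
Context {R : realType} {n : nat}.
Local Notation mu := (@lebM R n).
Implicit Types p g : Rn R n -> R.

(* For almost every [x], all moments of [p z * g (x - z)] vanish. *)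
Lemma convRn_inj_ae p g e : ball_kernel p ->
  (forall z, p (subv (zerov n) z) = e * p z) -> (0 < \int[mu]_z `|(p z)%:E|)%E ->
  L2 g -> {ae mu, forall x, convRn p g x = 0} -> {ae mu, forall x, g x = 0}.
Proof.
move=> kp pe p_gt0 hg ae0; have hp := ball_kernel_L2 kp.
have [mp mg] := (ball_kernel_meas kp, L2_meas hg).
pose F (z : Rn R n * Rn R n) := `|(p (subv z.1 z.2) * g z.2)%:E|%E.
have mF : measurable_fun setT F.
  rewrite (_ : F = fun z => (`|p (subv z.1 z.2) * g z.2|)%:E)//; meas.
have F0 z : (0 <= F z)%E by exact: abse_ge0.
have all0 : {ae mu, forall x, forall k,
    convRn (fun z => mom (odflt [::] (unpickle k)) z * p z) g x = 0}.
  by apply: ae_foralln => k; have [] := convRn_moments kp pe hg ae0 (odflt [::] (unpickle k)).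
have Fx0 : {ae mu, forall x, (\int[mu]_y F (x, y) = 0)%E}.
  apply: filterS all0 => x h.
  have mFx : measurable_fun setT (fun y => F (x, y)).
    by rewrite (_ : (fun y => _) = fun y => (`|p (subv x y) * g y|)%:E)//; meas.
  rewrite -(integral_subv_signed x mFx).
  have i := L2_integrableM hp (L2_subv x hg).
  rewrite (_ : (fun y => _) = (fun z => `|(p z * g (subv x z))%:E|)%E); last first.
    by apply/funext => z; rewrite /F /= subvK.
  apply/(ae_eq_integral_abs mu measurableT (measurable_int _ i)).
  apply: filterS (moment_determinacy i _ _) => [z /= -> //|z z1|s].
    by case: kp => _ _ ->//; rewrite mul0r.
  have := h (pickle s); rewrite pickleK /= convRnE => <-.
  have mH : measurable_fun setT (fun y => (mom s (subv x y) * p (subv x y) * g y)%:E).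
    have mm : measurable_fun setT (fun y => mom s (subv x y)).
      by apply: measurable_mom; meas.
    by meas.
  congr fine; rewrite -[RHS](integral_subv_signed x mH).
  by apply: eq_integral => z _; rewrite subvK mulrA.
have mgn : measurable_fun setT (fun y => (`|g y|)%:E) by meas.
have mpn : measurable_fun setT (fun y => `|(p y)%:E|%E).
  by rewrite (_ : (fun y => _) = (fun y => (`|p y|)%:E))//; meas.
have : (\int[mu]_x \int[mu]_y F (x, y) = 0)%E.
  rewrite (ae_eq_integral (cst 0%E)) ?integral0//.
    exact: (measurable_fun_fubini_tonelli_F (m2 := mu) F mF F0).
  by apply: filterS Fx0 => x h _.
rewrite (fubini_tonelli (m1 := mu) (m2 := mu) F mF F0).
(* By Tonelli the double integral is the product of the L^1 norms of p and g, where the latter might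
   be infinite; the product is 0 and the first factor is positive. *)
have -> : (\int[mu]_y \int[mu]_x F (x, y) =
    \int[mu]_y (\int[mu]_z `|(p z)%:E| * (`|g y|)%:E))%E.
  apply: eq_integral => y _.
  rewrite -(integral_subvl y mpn) muleC -ge0_integralZl_EFin//; last first.
    by rewrite (_ : (fun x => _) = (fun x => (`|p (subv x y)|)%:E))//; meas.
  by apply: eq_integral => x _; rewrite /F /= normrM EFinM muleC.
have [A A0 hA] := ball_kernel_mass kp.
have pfin : (\int[mu]_z `|(p z)%:E|)%E \is a fin_num.
  by rewrite ge0_fin_numE ?(ltW p_gt0)//; apply: le_lt_trans hA (ltry _).
rewrite -(fineK pfin) ge0_integralZl_EFin//; last by rewrite fine_ge0 ?(ltW p_gt0).
move=> /eqP; rewrite mule_eq0 fineK// gt_eqF//= => /eqP g0.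
have mgE : measurable_fun setT (EFin \o g) by meas.
have /(ae_eq_integral_abs mu measurableT mgE) : (\int[mu]_y `|(EFin \o g) y| = 0)%E by exact: g0.
by apply: filterS => y /(_ I) /= [].
Qed.

End ConvolutionInjective.

(** * Completeness of L^2 *)

Section RieszFischer.
Context {R : realType} {n : nat}.
Local Notation mu := (@lebM R n).
Implicit Types f g : Rn R n -> R.

Lemma L2norm_lt f e : L2 f -> 0 < e ->
  (L2norm f < e) = (\int[mu]_x (f x ^+ 2)%:E < (e ^+ 2)%:E)%E.
Proof.
move=> hf e0; have /L2P[_ fy] := hf.
have f0 : (0 <= \int[mu]_x (f x ^+ 2)%:E)%E.
  by apply: integral_ge0 => x _; rewrite lee_fin sqr_ge0.
rewrite /L2norm -lebME; move: fy f0; case: (\int[mu]_x _)%E => [r| |]// _.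
rewrite lee_fin lte_fin /= => r0.
by rewrite -[LHS](ltr_pXn2r (ltn0Sn 1)) ?nnegrE ?sqrtr_ge0 ?(ltW e0)// sqr_sqrtr.
Qed.

Lemma limn_einf_le (u : (\bar R)^nat) (b : \bar R) K :
  (forall k, (K <= k)%N -> (u k <= b)%E) -> (limn_einf u <= b)%E.
Proof.
move=> ub; rewrite limn_einf_lim; apply: lime_le; first exact: is_cvg_einfs.
apply: nearW => k; apply: le_trans (ub (maxn k K) (leq_maxr _ _)).
by apply: ereal_inf_lbound; exists (maxn k K) => //=; exact: leq_maxl.
Qed.

(** Each term 4^k h_k^2 is at most the finite sum, so |h_k| decays like 2^(-k) and the series
    converges absolutely. *)
Lemma cvgn_weighted (h : nat -> R) :
  (\sum_(0 <= k <oo) (4 ^+ k * h k ^+ 2)%:E < +oo)%E -> cvgn (series h).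
Proof.
move=> Sy; set S := (\sum_(0 <= k <oo) _)%E in Sy.
have t0 k : (0 <= (4 ^+ k * h k ^+ 2)%:E)%E by rewrite lee_fin mulr_ge0 ?sqr_ge0 ?exprn_ge0.
have S0 : (0 <= S)%E by exact: nneseries_ge0.
(* The square of S + 1 dominates S, and S + 1 is positive even if S = 0. *)
pose M := fine S + 1.
have M0 : 0 < M by rewrite /M ltr_wpDl// fine_ge0.
have hM k : `|h k| <= M * (2^-1) ^+ k.
  have : (4 ^+ k * h k ^+ 2 <= fine S).
    rewrite -lee_fin fineK ?ge0_fin_numE//.
    apply: le_trans (nneseries_lim_ge k.+1 (fun i _ _ => t0 i)).
    rewrite big_nat_recr//= leeDr// sume_ge0//.
  have e4 : (4 : R) = 2 ^+ 2 by ring.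
  rewrite e4 exprAC -exprMn => hS.
  have : `|2 ^+ k * h k| <= M.
    rewrite -(ler_pXn2r (ltn0Sn 1)) ?nnegrE ?(ltW M0)// real_normK ?num_real//.
    apply: le_trans hS _; rewrite /M; have := fine_ge0 S0.
    by move: (fine S) => s s0; nra.
  rewrite normrM ger0_norm ?exprn_ge0// exprVn ler_pdivlMr ?exprn_gt0//.
  by rewrite mulrC.
apply: normed_cvg.
apply: (series_le_cvg (v_ := geometric M 2^-1)) => //.
- by move=> k; rewrite /= normr_ge0.
- by move=> k; rewrite /geometric/= mulr_ge0 ?(ltW M0)// exprn_ge0.
- by apply: is_cvg_geometric_series; rewrite ger0_norm// invf_lt1//; lra.
Qed.

(* A subsequence whose increments h_k have norm below 4^-k converges a.e., as
   the sum of the 4^k h_k^2 is integrable; Fatou's lemma gives the L^2 distance. *)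
Lemma L2_complete (u : nat -> Rn R n -> R) : (forall j, L2 (u j)) ->
  (forall e : R, 0 < e -> exists N, forall p q, (N <= p)%N -> (N <= q)%N ->
     L2norm (fun x => u p x - u q x) < e) ->
  exists2 g, L2 g & forall e : R, 0 < e -> exists N, forall p, (N <= p)%N ->
     L2norm (fun x => u p x - g x) < e.
Proof.
move=> hu cau.
have [N NP] : {N : nat -> nat & forall k p q, (N k <= p)%N -> (N k <= q)%N ->
    L2norm (fun x => u p x - u q x) < (4^-1) ^+ k}.
  apply: (@choice _ _ (fun k N => forall p q, (N <= p)%N -> (N <= q)%N ->
    L2norm (fun x => u p x - u q x) < (4^-1) ^+ k)) => k.
  by apply: cau; rewrite exprn_gt0.
(* The partial sum dominates [N k] and makes the index sequence monotone; the summand k makes it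
   unbounded. *)
pose phi k := (k + \sum_(i < k.+1) N i)%N.
have phiS k : (phi k <= phi k.+1)%N.
  by rewrite /phi; apply: leq_add => //; rewrite [leqRHS]big_ord_recr leq_addr.
have phiN k : (N k <= phi k)%N by rewrite /phi big_ord_recr/= addnA leq_addl.
pose h k x := u (phi k.+1) x - u (phi k) x.
have hh k : L2 (h k) by exact: L2B.
have mh k : measurable_fun setT (fun x => h k x) by exact: L2_meas.
have mU k : measurable_fun setT (fun x => u k x) by exact: L2_meas.
have hint k : (\int[mu]_x (h k x ^+ 2)%:E <= (((4^-1) ^+ k) ^+ 2)%:E)%E.
  rewrite ltW// -L2norm_lt ?exprn_gt0//; apply: NP; last exact: phiN.
  exact: leq_trans (phiN k) (phiS k).
pose T k x := (4 ^+ k * h k x ^+ 2)%:E.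
have T0 k x : (0 <= T k x)%E by rewrite lee_fin mulr_ge0 ?sqr_ge0 ?exprn_ge0.
have mT k : measurable_fun setT (T k) by have mhk := mh k; rewrite /T; meas.
have mS : measurable_fun setT (fun x => \sum_(0 <= k <oo) T k x)%E.
  by apply: ge0_emeasurable_sum.
have Sy : (\int[mu]_x \sum_(0 <= k <oo) T k x < +oo)%E.
  rewrite integral_nneseries//; apply: (@le_lt_trans _ _ 2%:E); last exact: ltry.
  apply: lime_le; first by apply: is_cvg_nneseries => k _ _; exact: integral_ge0.
  apply: nearW => K.
  (* The k-th integral is at most 4^k (4^-k)^2 = 4^-k. The bound 2 - 2 * 4^-K increases by 3/2 times
     4^-K at each step, which leaves room for the induction. *)
  suff : (\sum_(0 <= k < K) \int[mu]_x T k x <= (2 - 2 * (4^-1) ^+ K)%:E)%E.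
    by move=> /le_trans; apply; rewrite lee_fin gerBl mulr_ge0// exprn_ge0.
  elim: K => [|K IH]; first by rewrite big_nil lee_fin mulr1 subrr.
  rewrite big_nat_recr//=.
  have hK : (\int[mu]_x T K x <= ((4^-1) ^+ K)%:E)%E.
    rewrite /T; under eq_integral => x _ do rewrite EFinM.
    have mhK := mh K.
    rewrite ge0_integralZl_EFin ?exprn_ge0//; [|by move=> x _; rewrite lee_fin sqr_ge0|by meas].
    apply: (@le_trans _ _ ((4 ^+ K)%:E * (((4^-1) ^+ K) ^+ 2)%:E)%E).
      by apply: lee_wpmul2l; rewrite ?lee_fin ?exprn_ge0.
    by rewrite -EFinM lee_fin expr2 mulrA -exprMn divff// expr1n mul1r.
  apply: le_trans (leeD IH hK) _; rewrite -EFinD lee_fin exprS.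
  have := exprn_ge0 K (_ : 0 <= 4^-1 :> R); move: ((4^-1 : R) ^+ K) => q hq.
  by have := hq ltac:(by []); lra.
have Sfin : {ae mu, forall x, (\sum_(0 <= k <oo) T k x < +oo)%E}.
  have S0 x : (0 <= \sum_(0 <= k <oo) T k x)%E by exact: nneseries_ge0.
  have iS : mu.-integrable setT (fun x => \sum_(0 <= k <oo) T k x)%E.
    apply/integrableP; split=> //; apply: le_lt_trans Sy.
    by rewrite le_eqVlt; apply/orP; left; apply/eqP/eq_integral => x _; rewrite gee0_abs.
  by apply: filterS (integrable_ae measurableT iS) => x /(_ I); rewrite ge0_fin_numE.
(* The upper limit yields a function measurable everywhere, and it is the limit wherever the
   subsequence converges. *)
pose g x := fine (limn_esup (fun k => (u (phi k) x)%:E)).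
have mg : measurable_fun setT g.
  apply: (measurableT_comp (f := fine)); first exact: fine_measurable.
  by apply: measurable_fun_limn_esup => k; have mUk := mU (phi k); meas.
have gcvg : {ae mu, forall x, u (phi k) x @[k --> \oo] --> g x}.
  apply: filterS Sfin => x /cvgn_weighted c.
  have {c} c : cvgn (fun k => u (phi k) x).
    have -> : (fun k => u (phi k) x) = (fun k => u (phi 0%N) x + series (h^~ x) k).
      apply/funext => k; rewrite /series/=.
      elim: k => [|k IH]; first by rewrite big_nil addr0.
      by rewrite big_nat_recr//= addrA -IH /h addrC subrK.
    by apply: is_cvgD => //; exact: is_cvg_cst.
  have cE : (u (phi k) x)%:E @[k --> \oo] --> (limn (fun k => u (phi k) x))%:E.
    by apply: cvg_EFin; [exact: nearW|exact: c].
  by rewrite /g (cvg_limn_einf_sup cE).2.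
have dist (e : R) : 0 < e -> exists K, forall p, (K <= p)%N ->
    (\int[mu]_x ((u p x - g x) ^+ 2)%:E <= (e ^+ 2)%:E)%E.
  move=> e0; have [K hK] := cau e e0; exists K => p Kp.
  pose D k x := ((u p x - u (phi k) x) ^+ 2)%:E.
  have mD k : measurable_fun setT (D k).
    by have [m1 m2] := (mU p, mU (phi k)); rewrite /D; meas.
  have D0 k x : (0 <= D k x)%E by rewrite lee_fin sqr_ge0.
  rewrite (ae_eq_integral (fun x => limn_einf (D^~ x))) //.
  - apply: le_trans (fatou mu measurableT mD (fun k x _ => D0 k x)) _.
    apply: (limn_einf_le (K := K)) => k Kk; rewrite ltW// -L2norm_lt//; last exact: L2B.
    by apply: hK => //; rewrite /phi (leq_trans Kk)// leq_addr.
  - by have mUp := mU p; meas.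
  - have -> : (fun x => limn_einf (D^~ x)) = (fun x => - limn_esup (fun k => - D k x))%E.
      by apply/funext => x; rewrite -[LHS]oppeK -limn_esupN.
    apply: measurableT_comp => //; apply: measurable_fun_limn_esup => k.
    exact: measurableT_comp.
  - apply: filterS gcvg => x c _.
    have cD : D k x @[k --> \oo] --> ((u p x - g x) ^+ 2)%:E.
      apply: cvg_EFin; first exact: nearW.
      have cB : u p x - u (phi k) x @[k --> \oo] --> u p x - g x.
        by apply: cvgB => //; exact: cvg_cst.
      exact: (cvgM cB cB).
    by rewrite (cvg_limn_einf_sup cD).1.
have L2d (e : R) p : 0 < e -> (\int[mu]_x ((u p x - g x) ^+ 2)%:E <= (e ^+ 2)%:E)%E ->
    L2 (fun x => u p x - g x).
  move=> e0 h2; apply/L2P; split; first by have mUp := mU p; meas.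
  exact: le_lt_trans h2 (ltry _).
have hg : L2 g.
  have [K hK] := dist 1 ltr01; have := L2B (hu K) (L2d 1 K ltr01 (hK K (leqnn K))).
  by congr L2; apply/funext => x; rewrite opprB addrC subrK.
(* Half of [e] turns the weak inequality from Fatou's lemma into a strict one. *)
exists g => // e e0; have e2 : 0 < e / 2 by rewrite divr_gt0.
have [K hK] := dist _ e2; exists K => p Kp.
rewrite L2norm_lt//; last exact: L2B.
apply: le_lt_trans (hK p Kp) _; rewrite lte_fin.
by rewrite ltr_pXn2r ?nnegrE ?(ltW e0) ?(ltW e2)// ltr_pdivrMr// ltr_pMr// ltr1n.
Qed.

End RieszFischer.

(** * The native space *)

Section ConvolutionSpace.
Context {R : realType} {n : nat}.
Local Notation mu := (@lebM R n).
Variable P : Rn R n -> R.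
Hypothesis kP : ball_kernel P.
Hypothesis P_inj : forall g, L2 g -> {ae mu, forall x, convRn P g x = 0} ->
  {ae mu, forall x, g x = 0}.
Implicit Types f g : Rn R n -> R.

Definition conv_space : set (Rn R n -> R) := [set f | exists2 g, L2 g & f = convRn P g].

(** A chosen preimage of [f] in L^2, through which the inner product is transported. By injectivity
    two preimages agree almost everywhere, so [conv_ip] does not depend on the choice, see
    [conv_ipE]. *)
Definition conv_rep f : Rn R n -> R :=
  xget (fun=> 0) [set g | L2 g /\ f = convRn P g].

Definition conv_ip f1 f2 : R := ipL2 (conv_rep f1) (conv_rep f2).

(** The section at y is P applied to z |-> P(y - z), so its inner product with P * g is the integral
    of P(y - z) g(z), which is (P * g)(y): the reproducing property holds by construction. *)
Definition conv_kernel (x y : Rn R n) : R := convRn P (fun z => P (subv y z)) x.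

Lemma convRn_lin a f g : L2 f -> L2 g ->
  convRn P (fun x => a * f x + g x) = (fun x => a * convRn P f x + convRn P g x).
Proof.
move=> hf hg; apply/funext => x; rewrite !convRnE.
have hp := ball_kernel_L2 kP.
have i1 := conv_integrable x hp hf; have i2 := conv_integrable x hp hg.
rewrite -(RintegralZl a measurableT i1) -RintegralD//; last first.
  exact: (integrableZl measurableT a i1).
by apply: eq_Rintegral => y _; ring.
Qed.

Lemma convRn_sub f g : L2 f -> L2 g ->
  convRn P (fun x => f x - g x) = (fun x => convRn P f x - convRn P g x).
Proof.
move=> hf hg; have e : (fun x => f x - g x) = (fun x => (-1) * g x + f x).
  by apply/funext => x; rewrite mulN1r addrC.
by rewrite e convRn_lin//; apply/funext => x; rewrite mulN1r addrC.
Qed.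

Lemma convRn_zero : convRn P (fun=> 0) = (fun=> 0).
Proof.
apply/funext => x; apply: convRn_ae0; [exact: ball_kernel_L2|exact: measurable_cst|].
exact: aeW.
Qed.

Lemma convRn_inj f g : L2 f -> L2 g -> convRn P f = convRn P g ->
  {ae mu, forall x, f x = g x}.
Proof.
move=> hf hg fg; have := P_inj (L2B hf hg) _.
rewrite convRn_sub// fg => /(_ (aeW _ (fun x => subrr _))).
by apply: filterS => x /eqP; rewrite subr_eq0 => /eqP.
Qed.

Lemma conv_repP f : conv_space f -> L2 (conv_rep f) /\ f = convRn P (conv_rep f).
Proof.
move=> [g hg fg]; rewrite /conv_rep.
have : exists g, [set g | L2 g /\ f = convRn P g] g by exists g.
by move=> /(xgetPex (fun=> 0)).
Qed.

Lemma ipL2_ae f f' g g' : L2 f -> L2 f' -> L2 g -> L2 g' ->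
  {ae mu, forall x, f x = f' x} -> {ae mu, forall x, g x = g' x} ->
  ipL2 f g = ipL2 f' g'.
Proof.
move=> hf hf' hg hg' e1 e2; rewrite /ipL2 /Rintegral; congr fine.
apply: ae_eq_integral => //.
- exact: measurable_int (L2_integrableM hf hg).
- exact: measurable_int (L2_integrableM hf' hg').
- by apply: filterS2 e1 e2 => x -> -> _.
Qed.

Lemma conv_ipE f g : L2 f -> L2 g -> conv_ip (convRn P f) (convRn P g) = ipL2 f g.
Proof.
move=> hf hg.
have [h1 e1] := conv_repP (ex_intro2 _ _ f hf (erefl (convRn P f))).
have [h2 e2] := conv_repP (ex_intro2 _ _ g hg (erefl (convRn P g))).
by apply: ipL2_ae => //; apply: convRn_inj.
Qed.

Lemma conv_hnormE g : L2 g -> hnorm conv_ip (convRn P g) = L2norm g.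
Proof. by move=> hg; rewrite /hnorm conv_ipE// L2normE. Qed.

Lemma conv_space_rkhs : is_RKHS conv_space conv_ip conv_kernel.
Proof.
have hP := ball_kernel_L2 kP.
have H g : L2 g -> conv_space (convRn P g) by move=> hg; exists g.
split.
- split.
  + by exists (fun=> 0); [exact: L2_0|rewrite convRn_zero].
  + move=> _ _ [f hf ->] [g hg ->]; exists (fun x => 1 * f x + g x).
      by apply: L2D => //; exact: L2Z.
    by rewrite convRn_lin//; apply/funext => x; rewrite mul1r.
  + move=> a _ [f hf ->]; exists (fun x => a * f x + 0).
      by apply: L2D; [exact: L2Z|exact: L2_0].
    by rewrite (convRn_lin a hf L2_0) convRn_zero; apply/funext => x; rewrite addr0.
  + by move=> f g _ _; exact: ipL2C.
  + split=> [a _ _ _ [f hf ->] [g hg ->] [h hh ->]|f _|_ [f hf ->]].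
    * by rewrite -convRn_lin// !conv_ipE ?ipL2_lin//; apply: L2D => //; exact: L2Z.
    * exact: ipL2_ge0.
    (* Vanishing almost everywhere of the preimage makes its convolution vanish at every point, as
       definiteness for plain functions demands. *)
    * rewrite conv_ipE// => /(ipL2_eq0 hf) f0; apply/funext => x.
      by apply: convRn_ae0 => //; exact: L2_meas.
- move=> u uH cau; pose g j := conv_rep (u j).
  have hg j : L2 (g j) by have [] := conv_repP (uH j).
  have ug j : u j = convRn P (g j) by have [] := conv_repP (uH j).
  have uB p h : L2 h -> hnorm conv_ip (fun x => u p x - convRn P h x) =
      L2norm (fun x => g p x - h x).
    by move=> hh; rewrite ug -convRn_sub// conv_hnormE//; exact: L2B.
  have [h hh hP'] : exists2 h, L2 h & forall e : R, 0 < e -> exists N, forall p, (N <= p)%N ->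
      L2norm (fun x => g p x - h x) < e.
    apply: L2_complete => // e /cau[N hN]; exists N => p q Np Nq.
    by rewrite -uB// -ug; exact: hN.
  exists (convRn P h); first exact: H.
  by move=> e /hP'[N hN]; exists N => p Np; rewrite uB//; exact: hN.
- have hk y : L2 (fun z => P (subv y z)) by exact: L2_subv.
  split=> [y|_ y [g hg ->]]; first exact: H.
  rewrite /conv_kernel conv_ipE// convRnE; apply: eq_Rintegral => z _.
  exact: mulrC.
Qed.

End ConvolutionSpace.

(** * The root kernel and the generalized Wu function *)

Section WuKernel.
Context {R : realType}.

Lemma subvBB n (x y z : Rn R n) : subv (subv x y) (subv z y) = subv x z.
Proof.
elim: n x y z => [x y z|n IH [a x] [b y] [c z]] /=; first by ring.
by rewrite IH; congr (_, _); ring.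
Qed.

(** The positive square root of [wu_cst l m], whence the exponent k / 2 with k = m / 2. *)
Definition root_cst (m : nat) (l : R) : R :=
  Gamma (l + 1) / Gamma (l - m%:R / 2 + 1) * (2 / pi) `^ (m%:R / 2 / 2).

Definition root_kernel (m : nat) (l : R) (x : Rn R m) : R :=
  root_cst m l * tpow (1 - enorm x ^+ 2) (l - m%:R / 2).

Variables (m : nat) (l : R).
Hypothesis (l0 : 0 <= l) (ml : m%:R / 2 <= l).

Local Notation a := (wu_exp l m).
Local Notation c := (root_cst m l).

Lemma wu_exp_ge0 : 0 <= a.
Proof. by rewrite /wu_exp subr_ge0. Qed.

Lemma root_cst_gt0 : 0 < c.
Proof.
by rewrite mulr_gt0 ?powR_gt0 ?divr_gt0 ?pi_gt0 ?Gamma_gt0//; move: ml l0; lra.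
Qed.

Lemma root_cst_sqr : c ^+ 2 = wu_cst l m.
Proof.
rewrite /root_cst /wu_cst exprMn mulrC; congr (_ * _).
rewrite -powR_mulrn ?powR_ge0// -powRrM; congr (_ `^ _).
by rewrite divfK.
Qed.

Lemma root_kernelE x : @root_kernel m l x = c * tpow (1 - sqnorm x) a.
Proof. by rewrite /root_kernel sqr_enorm. Qed.

Lemma ball_kernel_root : ball_kernel (@root_kernel m l).
Proof.
have -> : @root_kernel m l = (fun x => c * tpow (1 - sqnorm x) a).
  by apply/funext => x; rewrite root_kernelE.
split; [by meas|exists c => z|move=> z z1].
  rewrite ger0_norm ?(pmulr_rge0 _ root_cst_gt0) ?tpow_ge0//.
  by rewrite ler_piMr ?(ltW root_cst_gt0)// tpow_sqnorm_le1// wu_exp_ge0.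
by rewrite /tpow subr_gt0 ltNge z1 mulr0.
Qed.

Lemma root_kernel_inj g : L2 g ->
  {ae lebM m, forall x, convRn (@root_kernel m l) g x = 0} -> {ae lebM m, forall x, g x = 0}.
Proof.
apply: (convRn_inj_ae (e := 1) ball_kernel_root).
  by move=> z; rewrite !root_kernelE sqnormN mul1r.
have -> : (\int[lebM m]_z `|(root_kernel l z)%:E| =
    c%:E * \int[lebM m]_z (tpow (1 - sqnorm z) a)%:E)%E.
  rewrite -ge0_integralZl_EFin ?(ltW root_cst_gt0)//; [|by move=> x _; rewrite lee_fin tpow_ge0|by meas].
  apply: eq_integral => z _; rewrite root_kernelE gee0_abs ?EFinM//.
  by rewrite lee_fin (pmulr_rge0 _ root_cst_gt0) tpow_ge0.
by rewrite mule_gt0 ?lte_fin ?root_cst_gt0//; apply: ball_integral_gt0; have := wu_exp_ge0; lra.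
Qed.

(** Translating by y turns P(x - z) P(y - z) into the integrand of the self-convolution at x - y;
    since P is even, the sign of z - y is irrelevant. *)
Lemma wu_conv_kernel (x y : Rn R m) :
  wu l (m%:R / 2) (enorm (subv x y)) = conv_kernel (@root_kernel m l) x y.
Proof.
rewrite (wuE _ wu_exp_ge0) /conv_kernel convRnE /Rintegral -root_cst_sqr.
have bf : ballconv a (subv x y) \is a fin_num.
  by rewrite ge0_fin_numE ?ballconv_ge0// ballconv_lty// wu_exp_ge0.
apply: (@EFin_inj R); rewrite EFinM !fineK//; last first.
  apply: (integrable_fin_num measurableT); apply: conv_integrable.
    exact: ball_kernel_L2 ball_kernel_root.
  exact: L2_subv (ball_kernel_L2 ball_kernel_root).
pose h (w : Rn R m) := (tpow (1 - sqnorm (subv (subv x y) w)) a * tpow (1 - sqnorm w) a)%:E.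
have mh : measurable_fun setT h by rewrite /h; meas.
have mh' : measurable_fun setT (fun z => h (subv z y)) by rewrite /h; meas.
have h0 w : (0 <= h w)%E by rewrite lee_fin mulr_ge0 ?tpow_ge0.
have -> : ballconv a (subv x y) = (\int[lebM m]_z h (subv z y))%E.
  exact: esym (integral_subvl y mh).
rewrite -(ge0_integralZl_EFin (lebM m) measurableT (fun z _ => h0 (subv z y)) mh' (sqr_ge0 c)).
apply: eq_integral => z _; rewrite /h !root_kernelE subvBB -(subvN y z) sqnormN -EFinM.
by congr EFin; rewrite expr2; ring.
Qed.

End WuKernel.

(* k = m/2 ranges over N/2; the ambient space R^(2k+1) = R^(m+1) is Rn R m. *)
Theorem theorem4p2 (R : realType) (m : nat) (l : R) :
  0 <= l -> m%:R / 2 <= l ->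
  let k : R := m%:R / 2 in
  let Phi : Rn R m -> R := fun x => wu l k (enorm x) in
  let P : Rn R m -> R := fun x =>
    Gamma (l + 1) / Gamma (l - k + 1) * (2 / pi) `^ (k / 2) *
    tpow (1 - enorm x ^+ 2) (l - k) in
  (exists H ip, is_native_space Phi H ip) /\
  (forall (H : set (Rn R m -> R)) (ip : (Rn R m -> R) -> (Rn R m -> R) -> R),
    is_native_space Phi H ip ->
    [/\ (forall f, H f <-> exists2 g, L2 g & f = convRn P g),
        (forall g, L2 g -> hnorm ip (convRn P g) = L2norm g) &
        (forall g1 g2, L2 g1 -> L2 g2 -> convRn P g1 = convRn P g2 ->
           {ae @lebn R m, forall x, g1 x = g2 x})]).
Proof.
move=> l0 ml k Phi P.
have kP : ball_kernel P := ball_kernel_root l0 ml.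
have injP : forall g, L2 g -> {ae lebM m, forall x, convRn P g x = 0} ->
    {ae lebM m, forall x, g x = 0} := root_kernel_inj l0 ml.
have E : (fun x y => Phi (subv x y)) = conv_kernel P.
  by apply/funext => x; apply/funext => y; exact: wu_conv_kernel.
have rk := conv_space_rkhs kP injP; rewrite -E in rk.
split; first by exists (conv_space P), (conv_ip P).
(* Any native space is compared with [conv_space P] by [rkhs_unique], in both directions for
   membership and in one for the norm. *)
move=> H ip rkH; split.
- move=> f; split=> [Hf|/(rkhs_unique rk rkH)[]//].
  by have [] := rkhs_unique rkH rk Hf.
- move=> g hg; have [_ ->] := rkhs_unique rk rkH (ex_intro2 _ _ g hg (erefl (convRn P g))).
  exact: conv_hnormE.
- by move=> g1 g2 h1 h2 e; rewrite -lebME; exact: (convRn_inj kP injP).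
Qed.
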